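(* Assume that the discriminant $D$ of the deformation $F=f+\sum_{i=1}^mg_is_i$ is reduced (e.g. $F$ is a miniversal deformation of $f$). Then $$\mathrm{End}_{R((u))\langle\partial_{s_i},t\rangle}(\widehat G_R)=\mathbb C ;$$ equivalently, the higher residue pairings on $\widehat G_R$ are unique up to a nonzero constant multiple: any two isomorphisms of $R((u))\langle\partial_{s_i},t\rangle$-modules $\widehat G_R\simeq\mathbb D(\widehat G_R)$ differ by multiplication by a nonzero complex number.
   Context: $f\in\mathbb C\{x\}=\mathbb C\{x_0,\dots,x_n\}$ has an isolated singularity at $0$, $f(0)=0$, with Milnor number $r$; $F=f+\sum_{i=1}^mg_is_i$ with $g_i\in\mathbb C\{x\}$, $\mathbf s=(s_1,\dots,s_m)$; $R=\mathbb C[[\mathbf s]]$, and $u=\partial_t^{-1}$ is a formal variable. The formal Brieskorn lattice in this setting is $$\widehat H_R=H^{n+1}\bigl(\Omega^\bullet_{\mathbb C^{n+1},0}[[\mathbf s]][[u]],\,ud-dF\wedge\bigr)\quad(d=\text{differential in }x),$$ a free $R[[u]]$-module of rank $r$, and the formal Gauss-Manin system is $\widehat G_R=\widehat H_R\otimes_{R[[u]]}R((u))$, a free $R((u))$-module of rank $r$ (note: coefficients are in $R((u))=\mathbb C[[\mathbf s]]((u))$, not in $\mathbb C((u))[[\mathbf s]]$). The actions are $t[\omega]=[F\omega+u^2\partial_u\omega]$, $\partial_{s_i}[\omega]=[\partial_{s_i}\omega-u^{-1}g_i\omega]$. $\mathrm{End}_{R((u))\langle\partial_{s_i},t\rangle}$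 denotes $R((u))$-linear endomorphisms commuting with $t$ and all $\partial_{s_i}$, and $\mathbb C$ is embedded as scalar multiplications. The discriminant $D$ is the divisor on $(\mathbb C\times\mathbb C^m,0)$ (coordinates $t,s_1,\dots,s_m$) which is the image under $(F,\mathbf s)$ of the relative critical locus $\{\partial_{x_0}F=\dots=\partial_{x_n}F=0\}$, counted with multiplicity, i.e. defined by the characteristic polynomial in $t$ of multiplication by $F$ on the free $\mathbb C\{\mathbf s\}$-module $\mathbb C\{x,\mathbf s\}/(\partial_{x_0}F,\dots,\partial_{x_n}F)$ of rank $r$; $D$ reduced means that this defining function is square-free. The dual is $\mathbb D(\widehat G_R)=\mathrm{Hom}_{R((u))}(\widehat G_R,R((u)))$ with actions: $u$ acts by $(u\phi)(a)=-u\,\phi(a)$ (and $R$ by multiplication), $(t\phi)(a)=\phi(ta)-u^2\partial_u(\phi(a))$, $(\partial_{s_i}\phi)(a)=\partial_{s_i}(\phi(a))-\phi(\partial_{s_i}a)$. An isomorphism $\widehat G_R\simeq\mathbb D(\widehat G_R)$, $b\mapsto S(\cdot,b)$, is the same as a non-degenerate $R$-bilinear pairing $S:\widehat G_R\times\widehat G_R\to R((u))$ with $S(ua,b)=uS(a,b)=-S(a,ub)$ and, more generally, $S(ha,b)=h(u)S(a,b)=S(a,h(-u)b)$ for $h\in R((u))$, $S(ta,b)-S(a,tb)=u^2\partial_uS(a,b)$, $\partial_{s_i}S(a,b)=S(\partial_{s_i}a,b)+S(a,\partial_{s_i}b)$; this is what is meant by a higher residue pairing here. *)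

(* Defs.v *)
From HB Require Import structures.
From mathcomp Require Import all_boot all_order all_algebra.
From mathcomp Require Import complex mpoly.
From mathcomp Require Import boolp classical_sets fsbigop reals.
From mathcomp Require Import zify ring.
Set Implicit Arguments.
Unset Strict Implicit.
Unset Printing Implicit Defensive.

Import Order.TTheory GRing.Theory Num.Theory.
Local Open Scope ring_scope.

(* A[[x_1, ..., x_p]]: the coefficient of x^m in a is a m. *)
Record mps (p : nat) (A : Type) := Mps { mcf :> 'X_{1..p} -> A }.

HB.instance Definition _ p A := gen_eqMixin (mps p A).
HB.instance Definition _ p A := gen_choiceMixin (mps p A).

Lemma mpsP p A (a b : mps p A) : a =1 b -> a = b.
Proof. by case: a b => [a] [b] /= /funext ->. Qed.

Definition mps_map p (A B : Type) (h : A -> B) (a : mps p A) : mps p B :=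
  Mps (fun m => h (a m)).

Section MpsRing.
Variables (p : nat) (A : comNzRingType).
Implicit Types (a b c : mps p A) (m : 'X_{1..p}).

Definition mps_add a b : mps p A := Mps (fun m => a m + b m).
Definition mps_opp a : mps p A := Mps (fun m => - a m).
Definition mpsC (x : A) : mps p A := Mps (fun m => if m == 0%MM then x else 0).
Definition mpsX (i : 'I_p) : mps p A := Mps (fun m => (m == U_(i)%MM)%:R).
Definition mps_mul a b : mps p A := Mps (fun m =>
  \sum_(k : 'X_{1..p < (mdeg m).+1, (mdeg m).+1} | m == (k.1 + k.2)%MM)
    a k.1 * b k.2).

Fact mps_addA : associative mps_add.
Proof. by move=> a b c; apply: mpsP => m /=; rewrite addrA. Qed.
Fact mps_addC : commutative mps_add.
Proof. by move=> a b; apply: mpsP => m /=; rewrite addrC. Qed.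
Fact mps_add0 : left_id (mpsC 0) mps_add.
Proof. by move=> a; apply: mpsP => m /=; rewrite if_same add0r. Qed.
Fact mps_addN : left_inverse (mpsC 0) mps_opp mps_add.
Proof. by move=> a; apply: mpsP => m /=; rewrite if_same addNr. Qed.

HB.instance Definition _ :=
  GRing.isZmodule.Build (mps p A) mps_addA mps_addC mps_add0 mps_addN.

Definition mtrunc k a : {mpoly A[p]} := \sum_(m : 'X_{1..p < k}) a m *: 'X_[m].

Lemma mcoeff_mtrunc k a m : (mdeg m < k)%N -> (mtrunc k a)@_m = a m.
Proof. exact: mcoeff_mpoly. Qed.

Lemma mps_mulE a b m (P Q : {mpoly A[p]}) :
    (forall m', (mdeg m' <= mdeg m)%N -> P@_m' = a m') ->
    (forall m', (mdeg m' <= mdeg m)%N -> Q@_m' = b m') ->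
  mps_mul a b m = (P * Q)@_m.
Proof.
move=> Pa Qb; rewrite mcoeffM /=; apply: eq_bigr => -[k1 k2] /= _.
by rewrite Pa ?Qb // -ltnS bmdeg.
Qed.

Fact mps_mulA : associative mps_mul.
Proof.
move=> a b c; apply: mpsP => m; pose T := mtrunc (mdeg m).+1.
have TE d m' : (mdeg m' <= mdeg m)%N -> (T d)@_m' = d m'.
  by move=> le_m; rewrite mcoeff_mtrunc.
have TM d e m' : (mdeg m' <= mdeg m)%N -> (T d * T e)@_m' = mps_mul d e m'.
  move=> le_m; apply/esym/mps_mulE => m2 le_m2;
  exact: TE (leq_trans le_m2 le_m).
rewrite (@mps_mulE _ _ _ (T a) (T b * T c)) ?mulrA; last 2 first.
- by move=> m'; apply: TE.
- by move=> m'; apply: TM.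
by apply/esym/mps_mulE => m'; [apply: TM | apply: TE].
Qed.

Fact mps_mulC : commutative mps_mul.
Proof.
move=> a b; apply: mpsP => m; pose T := mtrunc (mdeg m).+1.
have TE d m' : (mdeg m' <= mdeg m)%N -> (T d)@_m' = d m'.
  by move=> le_m; rewrite mcoeff_mtrunc.
rewrite (@mps_mulE a b m (T a) (T b)) 1?mulrC; try by move=> m'; apply: TE.
by apply/esym/mps_mulE => m'; apply: TE.
Qed.

Fact mps_mul1 : left_id (mpsC 1) mps_mul.
Proof.
move=> a; apply: mpsP => m; pose T := mtrunc (mdeg m).+1.
have TE d m' : (mdeg m' <= mdeg m)%N -> (T d)@_m' = d m'.
  by move=> le_m; rewrite mcoeff_mtrunc.
rewrite (@mps_mulE _ _ m 1 (T a)) ?mul1r ?TE //; last by move=> m'; apply: TE.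
by move=> m' _ /=; rewrite mcoeff1; case: eqP.
Qed.

Fact mps_mulDl : left_distributive mps_mul +%R.
Proof.
move=> a b c; apply: mpsP => m /=; rewrite -big_split /=.
by apply: eq_bigr => k _; rewrite mulrDl.
Qed.

Fact mps_oner_neq0 : mpsC 1 != 0.
Proof.
apply/eqP => /(congr1 (fun a : mps p A => a 0%MM)) /=.
by rewrite !eqxx; apply/eqP; rewrite oner_neq0.
Qed.

HB.instance Definition _ := GRing.Zmodule_isComNzRing.Build (mps p A)
  mps_mulA mps_mulC mps_mul1 mps_mulDl mps_oner_neq0.

Lemma mps0E m : (0 : mps p A) m = 0. Proof. exact: if_same. Qed.
Lemma mpsDE a b m : (a + b) m = a m + b m. Proof. by []. Qed.
Lemma mpsNE a m : (- a) m = - a m. Proof. by []. Qed.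
Lemma mpsBE a b m : (a - b) m = a m - b m. Proof. by []. Qed.
Lemma mpsME a b m : (a * b) m =
  \sum_(k : 'X_{1..p < (mdeg m).+1, (mdeg m).+1} | m == (k.1 + k.2)%MM)
    a k.1 * b k.2.
Proof. by []. Qed.
Lemma mps1E m : (1 : mps p A) m = (m == 0%MM)%:R.
Proof. by rewrite /= [LHS]/=; case: eqP. Qed.

Lemma mpsC_is_zmod_morphism : zmod_morphism mpsC.
Proof.
by move=> x y; apply: mpsP => m; rewrite mpsBE /=; case: eqP; rewrite ?subr0.
Qed.
HB.instance Definition _ :=
  GRing.isZmodMorphism.Build A (mps p A) mpsC mpsC_is_zmod_morphism.

Lemma mpsC_is_monoid_morphism : monoid_morphism mpsC.
Proof.
split=> // x y; apply: mpsP => m.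
have CE z m' : z%:MP_[p]@_m' = mpsC z m'.
  by rewrite mcoeffC /=; case: eqP; rewrite ?mulr1 ?mulr0.
by rewrite -CE mpolyCM; apply/esym/mps_mulE => m' _; apply: CE.
Qed.
HB.instance Definition _ :=
  GRing.isMonoidMorphism.Build A (mps p A) mpsC mpsC_is_monoid_morphism.

Definition mps_der (i : 'I_p) a : mps p A :=
  Mps (fun m => a (m + U_(i))%MM *+ (m i).+1).

Lemma mps_der_is_zmod_morphism i : zmod_morphism (mps_der i).
Proof. by move=> a b; apply: mpsP => m /=; rewrite mulrnBl. Qed.
HB.instance Definition _ i := GRing.isZmodMorphism.Build (mps p A) (mps p A)
  (mps_der i) (mps_der_is_zmod_morphism i).

Lemma mps_derM i a b : mps_der i (a * b) = mps_der i a * b + a * mps_der i b.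
Proof.
apply: mpsP => m; pose T := mtrunc (mdeg m).+2.
have TE d m' : (mdeg m' <= (mdeg m).+1)%N -> (T d)@_m' = d m'.
  by move=> le_m; rewrite mcoeff_mtrunc.
have degU : mdeg (m + U_(i)) = (mdeg m).+1 by rewrite mdegD mdeg1 addn1.
have TD d m' : (mdeg m' <= mdeg m)%N -> (mderiv i (T d))@_m' = mps_der i d m'.
  by move=> le_m; rewrite mcoeff_deriv TE // mdegD mdeg1 addn1.
have TE' d m' : (mdeg m' <= mdeg m)%N -> (T d)@_m' = d m'.
  by move=> le_m; rewrite TE // leqW.
transitivity ((mderiv i (T a * T b))@_m).
  rewrite mcoeff_deriv; congr (_ *+ _).
  by apply: mps_mulE => m'; rewrite degU; apply: TE.
rewrite mderivM mcoeffD mpsDE; congr (_ + _); apply/esym/mps_mulE => m'.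
- exact: TD.
- exact: TE'.
- exact: TE'.
exact: TD.
Qed.

Lemma mps_derC i x : mps_der i (mpsC x) = 0.
Proof. by apply: mpsP => m /=; rewrite mnmD_eq0 mnm1_eq0 andbF if_same mul0rn. Qed.

Lemma mps_derX i j : mps_der i (mpsX j) = (i == j)%:R.
Proof.
apply: mpsP => m /=; have -> : (i == j)%:R = mpsC (i == j)%:R.
  by case: eqP; rewrite ?rmorph1 ?rmorph0.
rewrite /=; case: (m =P 0%MM) => [->|/eqP nz].
  by rewrite add0m mnm0E mulr1n eq_mnm1.
case: eqP => [e|]; last by rewrite mul0rn.
have := congr1 (@mdeg p) e.
by rewrite mdegD !mdeg1 addn1 => -[] /eqP; rewrite mdeg_eq0 (negPf nz).
Qed.

Lemma mps_der_comm i j a : mps_der i (mps_der j a) = mps_der j (mps_der i a).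
Proof.
apply: mpsP => m /=; rewrite -!mulrnA -!addmA [(U_(j) + _)%MM]addmC.
congr (_ *+ _); rewrite !mnmDE !mnm1E [j == i]eq_sym.
by case: eqP => [->|_]; rewrite ?addn1 ?addn0 // mulnC.
Qed.

End MpsRing.

Section MpsMap.
Variables (p : nat) (A B : comNzRingType).

Lemma mps_map_is_zmod_morphism (h : {additive A -> B}) :
  zmod_morphism (mps_map (p := p) h).
Proof. by move=> a b; apply: mpsP => m /=; rewrite raddfB. Qed.
HB.instance Definition _ (h : {additive A -> B}) :=
  GRing.isZmodMorphism.Build (mps p A) (mps p B) (mps_map h)
    (mps_map_is_zmod_morphism h).

Lemma mps_map_is_monoid_morphism (h : {rmorphism A -> B}) :
  monoid_morphism (mps_map (p := p) h).
Proof.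
split=> [|a b]; apply: mpsP => m.
  by rewrite mps1E /= -(rmorph_nat h); case: eqP.
rewrite mpsME [LHS]/= rmorph_sum; apply: eq_bigr => k _.
by rewrite rmorphM.
Qed.
HB.instance Definition _ (h : {rmorphism A -> B}) :=
  GRing.isMonoidMorphism.Build (mps p A) (mps p B) (mps_map h)
    (mps_map_is_monoid_morphism h).

Lemma mps_map_der (h : {additive A -> B}) i (a : mps p A) :
  mps_der i (mps_map h a) = mps_map h (mps_der i a).
Proof. by apply: mpsP => m /=; rewrite raddfMn. Qed.

End MpsMap.

Lemma mps_map_derivation p (A : comNzRingType) (d : {additive A -> A}) :
    (forall x y, d (x * y) = d x * y + x * d y) ->
  forall a b : mps p A,
    mps_map d (a * b) = mps_map d a * b + a * mps_map d b.
Proof.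
move=> dM a b; apply: mpsP => m; rewrite mpsDE !mpsME [LHS]/= raddf_sum.
by rewrite -big_split; apply: eq_bigr => k _; apply: dM.
Qed.

(* A[[u]]: the coefficient of u^k in a is a k. *)
Record pser (A : Type) := Pser { pcf :> nat -> A }.

HB.instance Definition _ A := gen_eqMixin (pser A).
HB.instance Definition _ A := gen_choiceMixin (pser A).

Lemma pserP A (a b : pser A) : a =1 b -> a = b.
Proof. by case: a b => [a] [b] /= /funext ->. Qed.

Definition pser_map (A B : Type) (h : A -> B) (a : pser A) : pser B :=
  Pser (fun k => h (a k)).

Section PserRing.
Variable A : comNzRingType.
Implicit Types a b c : pser A.

Definition pser_add a b : pser A := Pser (fun k => a k + b k).
Definition pser_opp a : pser A := Pser (fun k => - a k).
Definition pserC (x : A) : pser A := Pser (fun k => if k is 0%N then x else 0).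
Definition pserU : pser A := Pser (fun k => (k == 1%N)%:R).
Definition pser_mul a b : pser A :=
  Pser (fun k => \sum_(j < k.+1) a j * b (k - j)%N).

Fact pser_addA : associative pser_add.
Proof. by move=> a b c; apply: pserP => k /=; rewrite addrA. Qed.
Fact pser_addC : commutative pser_add.
Proof. by move=> a b; apply: pserP => k /=; rewrite addrC. Qed.
Fact pser_add0 : left_id (pserC 0) pser_add.
Proof. by move=> a; apply: pserP => -[|k] /=; rewrite add0r. Qed.
Fact pser_addN : left_inverse (pserC 0) pser_opp pser_add.
Proof. by move=> a; apply: pserP => -[|k] /=; rewrite addNr. Qed.

HB.instance Definition _ :=
  GRing.isZmodule.Build (pser A) pser_addA pser_addC pser_add0 pser_addN.

Definition ptrunc n a : {poly A} := \poly_(k < n) a k.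

Lemma pser_mulE a b k (P Q : {poly A}) :
    (forall j, (j <= k)%N -> P`_j = a j) ->
    (forall j, (j <= k)%N -> Q`_j = b j) ->
  pser_mul a b k = (P * Q)`_k.
Proof.
move=> Pa Qb; rewrite coefM /=; apply: eq_bigr => j _.
by rewrite Pa ?Qb ?leq_subr // -ltnS.
Qed.

Fact pser_mulA : associative pser_mul.
Proof.
move=> a b c; apply: pserP => k; pose T := ptrunc k.+1.
have TE d j : (j <= k)%N -> (T d)`_j = d j by move=> jk; rewrite coef_poly ltnS jk.
have TM d e j : (j <= k)%N -> (T d * T e)`_j = pser_mul d e j.
  move=> jk; apply/esym/pser_mulE => i ij; exact: TE (leq_trans ij jk).
rewrite (@pser_mulE _ _ _ (T a) (T b * T c)) ?mulrA; last 2 first.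
- by move=> j; apply: TE.
- by move=> j; apply: TM.
by apply/esym/pser_mulE => j; [apply: TM | apply: TE].
Qed.

Fact pser_mulC : commutative pser_mul.
Proof.
move=> a b; apply: pserP => k; pose T := ptrunc k.+1.
have TE d j : (j <= k)%N -> (T d)`_j = d j by move=> jk; rewrite coef_poly ltnS jk.
rewrite (@pser_mulE a b k (T a) (T b)) 1?mulrC; try by move=> j; apply: TE.
by apply/esym/pser_mulE => j; apply: TE.
Qed.

Fact pser_mul1 : left_id (pserC 1) pser_mul.
Proof.
move=> a; apply: pserP => k; rewrite /= big_ord_recl subn0 mul1r big1 ?addr0 //.
by move=> i _; rewrite mul0r.
Qed.

Fact pser_mulDl : left_distributive pser_mul +%R.
Proof.
move=> a b c; apply: pserP => k /=; rewrite -big_split /=.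
by apply: eq_bigr => j _; rewrite mulrDl.
Qed.

Fact pser_oner_neq0 : pserC 1 != 0.
Proof.
apply/eqP => /(congr1 (fun a : pser A => a 0%N)) /=.
by apply/eqP; rewrite oner_neq0.
Qed.

HB.instance Definition _ := GRing.Zmodule_isComNzRing.Build (pser A)
  pser_mulA pser_mulC pser_mul1 pser_mulDl pser_oner_neq0.

Lemma pser0E k : (0 : pser A) k = 0. Proof. by case: k. Qed.
Lemma pserDE a b k : (a + b) k = a k + b k. Proof. by []. Qed.
Lemma pserBE a b k : (a - b) k = a k - b k. Proof. by []. Qed.
Lemma pserME a b k : (a * b) k = \sum_(j < k.+1) a j * b (k - j)%N.
Proof. by []. Qed.
Lemma pser_sumE (I : Type) (r : seq I) (P : pred I) (E : I -> pser A) k :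
  (\sum_(i <- r | P i) E i) k = \sum_(i <- r | P i) E i k.
Proof.
by elim/big_rec2: _ => [|i x y _ <-]; [exact: pser0E | exact: pserDE].
Qed.
Lemma pserCME x a k : (pserC x * a) k = x * a k.
Proof.
rewrite pserME big_ord_recl subn0 big1 ?addr0 //.
by move=> i _; rewrite mul0r.
Qed.
Lemma pserU0 a : (pserU * a) 0%N = 0.
Proof. by rewrite pserME big_ord_recl big_ord0 mul0r addr0. Qed.
Lemma pserUS a k : (pserU * a) k.+1 = a k.
Proof.
rewrite pserME !big_ord_recl mul0r add0r /= mul1r subSS subn0 big1 ?addr0 //.
by move=> i _; rewrite mul0r.
Qed.

End PserRing.

Arguments pserU {A}.

Section PserMap.
Variables A B : comNzRingType.

Lemma pser_map_is_zmod_morphism (h : {additive A -> B}) :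
  zmod_morphism (pser_map h).
Proof. by move=> a b; apply: pserP => k /=; rewrite raddfB. Qed.
HB.instance Definition _ (h : {additive A -> B}) :=
  GRing.isZmodMorphism.Build (pser A) (pser B) (pser_map h)
    (pser_map_is_zmod_morphism h).

Lemma pser_map_is_monoid_morphism (h : {rmorphism A -> B}) :
  monoid_morphism (pser_map h).
Proof.
split=> [|a b]; apply: pserP => k.
  by case: k => [|k]; rewrite /= ?rmorph1 ?rmorph0.
rewrite pserME [LHS]/= rmorph_sum; apply: eq_bigr => j _.
by rewrite rmorphM.
Qed.
HB.instance Definition _ (h : {rmorphism A -> B}) :=
  GRing.isMonoidMorphism.Build (pser A) (pser B) (pser_map h)
    (pser_map_is_monoid_morphism h).

End PserMap.

(* A((u)): the coefficient of u^k in a is a k, for k in Z. *)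
Definition bounded_below (A : comNzRingType) (a : int -> A) :=
  exists N : int, forall k, k < N -> a k = 0.

Record laurent (A : comNzRingType) :=
  Laurent { lcf :> int -> A; lcf_bounded : bounded_below lcf }.

HB.instance Definition _ A := gen_eqMixin (laurent A).
HB.instance Definition _ A := gen_choiceMixin (laurent A).

Lemma laurentP (A : comNzRingType) (a b : laurent A) : a =1 b -> a = b.
Proof.
case: a b => [a a_] [b b_] /= /funext ab; case: _ / ab in b_ *.
by congr Laurent; apply: Prop_irrelevance.
Qed.

Section LaurentMap.
Variables A B : comNzRingType.
Implicit Type h : {additive A -> B}.

Fact laurent_map_bounded h (a : laurent A) : bounded_below (fun k => h (a k)).
Proof. by case: (lcf_bounded a) => N aN; exists N => k /aN ->; rewrite raddf0. Qed.

Definition laurent_map h (a : laurent A) : laurent B :=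
  Laurent (laurent_map_bounded h a).

End LaurentMap.

Section LaurentRing.
Variable A : comNzRingType.
Implicit Types (a b c : laurent A) (N M k : int).

Definition zbelow a N := forall k, k < N -> a k = 0.

Lemma zbelowW a N M : M <= N -> zbelow a N -> zbelow a M.
Proof. by move=> MN aN k kM; apply: aN (lt_le_trans kM MN). Qed.

Lemma zbelow2 a b : exists2 N, zbelow a N & zbelow b N.
Proof.
case: (lcf_bounded a) (lcf_bounded b) => [N aN] [M bM].
by exists (Num.min N M); [move: aN | move: bM]; apply: zbelowW;
  rewrite ge_min lexx ?orbT.
Qed.

Fact laurent_add_bounded a b : bounded_below (fun k => a k + b k).
Proof. by have [N aN bN] := zbelow2 a b; exists N => k kN; rewrite aN ?bN ?addr0. Qed.
Definition laurent_add a b : laurent A := Laurent (laurent_add_bounded a b).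

Fact laurent_opp_bounded a : bounded_below (fun k => - a k).
Proof. by case: (lcf_bounded a) => N aN; exists N => k /aN ->; rewrite oppr0. Qed.
Definition laurent_opp a : laurent A := Laurent (laurent_opp_bounded a).

Fact laurentC_bounded (x : A) : bounded_below (fun k : int => if k == 0 then x else 0).
Proof. by exists 0 => k k0; rewrite lt_eqF. Qed.
Definition laurentC x : laurent A := Laurent (laurentC_bounded x).

Fact upow_bounded (d : int) : bounded_below (fun k => (k == d)%:R : A).
Proof. by exists d => k kd; rewrite lt_eqF. Qed.
(* u^d *)
Definition upow d : laurent A := Laurent (upow_bounded d).

Definition lconv a b k : A := \sum_(i \in [set: int]%classic) a i * b (k - i).

Lemma lconv_lt a b N M k : zbelow a N -> zbelow b M -> k < N + M ->
  lconv a b k = 0.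
Proof.
move=> aN bM kNM; apply: fsbig1 => i _; case: (ltP i N) => [/aN ->|Ni].
  by rewrite mul0r.
by rewrite [b _]bM ?mulr0 // ltrBlDl (lt_le_trans kNM) // lerD2r.
Qed.

Lemma lconv_ge a b N M n : zbelow a N -> zbelow b M ->
  lconv a b (N + M + n%:Z) =
  \sum_(j < n.+1) a (N + j%:Z) * b (M + (n - j)%N%:Z).
Proof.
move=> aN bM; rewrite /lconv.
rewrite (@fsbigE _ _ _ _ _ [seq N + j%:Z | j <- iota 0 n.+1]) //; first last.
- move=> i _ iN; case: (ltP i N) => [/aN ->|Ni]; first by rewrite mul0r.
  rewrite [b _]bM ?mulr0 //; suff : (n%:Z < i - N)%R by lia.
  rewrite ltNge; apply: contra iN => iNn; apply/mapP.
  by exists `|i - N|%N; [rewrite mem_iota; lia | lia].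
- by rewrite map_inj_uniq ?iota_uniq // => i j /addrI [].
rewrite big_map big_mkcond -[X in iota 0 X]subn0 -/(index_iota _ _) big_mkord.
apply: eq_bigr => j _; rewrite in_setT; congr (_ * b _).
by have := ltn_ord j; lia.
Qed.

Fact laurent_mul_bounded a b : bounded_below (lconv a b).
Proof.
have [N aN bN] := zbelow2 a b; exists (N + N) => k.
exact: lconv_lt aN bN.
Qed.
Definition laurent_mul a b : laurent A := Laurent (laurent_mul_bounded a b).

Fact laurent_addA : associative laurent_add.
Proof. by move=> a b c; apply: laurentP => k /=; rewrite addrA. Qed.
Fact laurent_addC : commutative laurent_add.
Proof. by move=> a b; apply: laurentP => k /=; rewrite addrC. Qed.
Fact laurent_add0 : left_id (laurentC 0) laurent_add.
Proof. by move=> a; apply: laurentP => k /=; rewrite if_same add0r. Qed.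
Fact laurent_addN : left_inverse (laurentC 0) laurent_opp laurent_add.
Proof. by move=> a; apply: laurentP => k /=; rewrite if_same addNr. Qed.

HB.instance Definition _ := GRing.isZmodule.Build (laurent A)
  laurent_addA laurent_addC laurent_add0 laurent_addN.

(* u^-N a as a power series, when a has no powers of u below u^N *)
Definition lau_shift N a : pser A := Pser (fun n => a (N + n%:Z)).

Lemma zbelowM a b N M : zbelow a N -> zbelow b M ->
  zbelow (laurent_mul a b) (N + M).
Proof. by move=> aN bM k; apply: lconv_lt aN bM. Qed.

Lemma lau_shiftM a b N M : zbelow a N -> zbelow b M ->
  lau_shift (N + M) (laurent_mul a b) = lau_shift N a * lau_shift M b.
Proof. by move=> aN bM; apply: pserP => n; apply: lconv_ge aN bM. Qed.

Lemma lau_shift_inj a b N : zbelow a N -> zbelow b N ->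
  lau_shift N a = lau_shift N b -> a = b.
Proof.
move=> aN bN ab; apply: laurentP => k; case: (ltP k N) => [kN|Nk].
  by rewrite aN ?bN.
have := congr1 (fun s : pser A => s `|k - N|%N) ab.
by rewrite /= (_ : N + `|k - N|%N%:Z = k) //; lia.
Qed.

Lemma zbelow1 : zbelow (laurentC 1) 0.
Proof. by move=> k k0 /=; rewrite lt_eqF. Qed.

Fact laurent_mulA : associative laurent_mul.
Proof.
move=> a b c; have [N aN bN] := zbelow2 a b; case: (lcf_bounded c) => M cM.
apply: (@lau_shift_inj _ _ (N + N + M)).
- by rewrite -addrA; do !apply: zbelowM.
- by do !apply: zbelowM.
rewrite -{1}addrA !lau_shiftM ?mulrA //; exact: zbelowM.
Qed.

Fact laurent_mulC : commutative laurent_mul.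
Proof.
move=> a b; have [N aN bN] := zbelow2 a b.
by apply: (@lau_shift_inj _ _ (N + N)); rewrite ?lau_shiftM 1?mulrC //; apply: zbelowM.
Qed.

Fact laurent_mul1 : left_id (laurentC 1) laurent_mul.
Proof.
move=> a; case: (lcf_bounded a) => N aN; apply: (@lau_shift_inj _ _ N) => //.
  by rewrite -[N]add0r; apply: zbelowM => //; apply: zbelow1.
rewrite -[in LHS](add0r N) lau_shiftM //; last exact: zbelow1.
rewrite -[RHS]mul1r; congr (_ * _); apply: pserP => -[|n] //=.
Qed.

Fact laurent_mulDl : left_distributive laurent_mul +%R.
Proof.
move=> a b c; have [N aN bN] := zbelow2 a b; case: (lcf_bounded c) => M cM.
have zbelowD d e L : zbelow d L -> zbelow e L -> zbelow (d + e) L.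
  by move=> dL eL k kL; rewrite [LHS]/= dL ?eL ?addr0.
have lau_shiftD d e L : lau_shift L (d + e) = lau_shift L d + lau_shift L e by exact: pserP.
apply: (@lau_shift_inj _ _ (N + M)).
- by apply: zbelowM => //; apply: zbelowD.
- by apply: zbelowD; apply: zbelowM.
by rewrite lau_shiftD !lau_shiftM ?lau_shiftD ?mulrDl //; apply: zbelowD.
Qed.

Fact laurent_oner_neq0 : laurentC 1 != 0.
Proof.
apply/eqP => /(congr1 (fun a : laurent A => a 0)) /=.
by apply/eqP; rewrite oner_neq0.
Qed.

HB.instance Definition _ := GRing.Zmodule_isComNzRing.Build (laurent A)
  laurent_mulA laurent_mulC laurent_mul1 laurent_mulDl laurent_oner_neq0.

Lemma laurent0E k : (0 : laurent A) k = 0. Proof. exact: if_same. Qed.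
Lemma laurentDE a b k : (a + b) k = a k + b k. Proof. by []. Qed.
Lemma laurentNE a k : (- a) k = - a k. Proof. by []. Qed.
Lemma laurentBE a b k : (a - b) k = a k - b k. Proof. by []. Qed.
Lemma laurentME a b k :
  (a * b) k = \sum_(i \in [set: int]%classic) a i * b (k - i).
Proof. by []. Qed.
Lemma laurent_sumE (I : Type) (r : seq I) (P : pred I) (E : I -> laurent A) k :
  (\sum_(i <- r | P i) E i) k = \sum_(i <- r | P i) E i k.
Proof.
by elim/big_rec2: _ => [|i x y _ <-]; [exact: laurent0E | exact: laurentDE].
Qed.
Lemma laurent_mul_zbelow a b N M n : zbelow a N -> zbelow b M ->
  (a * b) (N + M + n%:Z) =
  \sum_(j < n.+1) a (N + j%:Z) * b (M + (n - j)%N%:Z).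
Proof. exact: lconv_ge. Qed.

Lemma upowME d a k : (upow d * a) k = a (k - d).
Proof.
rewrite laurentME (@fsbigE _ _ _ _ _ [:: d]) //; last first.
  by move=> i _ /=; rewrite inE => /negPf ->; rewrite mul0r.
by rewrite big_mkcond big_seq1 in_setT /= eqxx mul1r.
Qed.

Lemma laurentCME x a k : (laurentC x * a) k = x * a k.
Proof.
rewrite laurentME (@fsbigE _ _ _ _ _ [:: 0]) //; last first.
  by move=> i _ /=; rewrite inE => /negPf ->; rewrite mul0r.
by rewrite big_mkcond big_seq1 in_setT /= subr0.
Qed.

Lemma upowD d e : upow (d + e) = upow d * upow e.
Proof. by apply: laurentP => k; rewrite upowME /= subr_eq addrC. Qed.

Lemma upow0 : upow 0 = 1.
Proof. by apply: laurentP => k /=; case: eqP. Qed.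

Lemma upowK d : upow (- d) * upow d = 1.
Proof. by rewrite -upowD addNr upow0. Qed.

Lemma laurentC_is_zmod_morphism : zmod_morphism laurentC.
Proof.
by move=> x y; apply: laurentP => k; rewrite laurentBE /=; case: eqP; rewrite ?subr0.
Qed.
HB.instance Definition _ :=
  GRing.isZmodMorphism.Build A (laurent A) laurentC laurentC_is_zmod_morphism.

Lemma laurentC_is_monoid_morphism : monoid_morphism laurentC.
Proof.
split=> // x y; apply: laurentP => k.
by rewrite laurentCME /=; case: eqP; rewrite ?mulr0.
Qed.
HB.instance Definition _ :=
  GRing.isMonoidMorphism.Build A (laurent A) laurentC laurentC_is_monoid_morphism.

(* u^2 d/du maps u^(k-1) to (k-1) u^k *)
Fact u2du_bounded a : bounded_below (fun k => a (k - 1) *~ (k - 1)).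
Proof.
case: (lcf_bounded a) => N aN; exists N => k kN.
by rewrite aN ?mul0rz // (lt_trans _ kN) // ltrBlDr ltrDl.
Qed.
Definition u2du a : laurent A := Laurent (u2du_bounded a).

Lemma u2du_is_zmod_morphism : zmod_morphism u2du.
Proof. by move=> a b; apply: laurentP => k; rewrite laurentBE /= mulrzBl. Qed.
HB.instance Definition _ := GRing.isZmodMorphism.Build (laurent A) (laurent A)
  u2du u2du_is_zmod_morphism.

Lemma zbelow_u2du a N : zbelow a N -> zbelow (u2du a) (N + 1).
Proof. by move=> aN k kN /=; rewrite aN ?mul0rz // ltrBlDr. Qed.

Lemma u2duM a b : u2du (a * b) = u2du a * b + a * u2du b.
Proof.
have [N aN bN] := zbelow2 a b.
have dN := zbelow_u2du aN; have eN := zbelow_u2du bN.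
have ND : N + N + 1 = N + 1 + N by rewrite addrAC.
apply: (@lau_shift_inj _ _ (N + N + 1)).
- by apply: zbelow_u2du; apply: zbelowM.
- move=> k kN; rewrite laurentDE.
  by rewrite (zbelowM dN bN) -?ND // (zbelowM aN eN) ?addr0 // addrA.
apply: pserP => n.
have E1 := laurent_mul_zbelow n aN bN.
have E2 := laurent_mul_zbelow n dN bN.
have E3 := laurent_mul_zbelow n aN eN.
transitivity ((a * b) (N + N + n%:Z) *~ (N + N + n%:Z)).
  by rewrite /lau_shift /= (_ : N + N + 1 + n%:Z - 1 = N + N + n%:Z) //; lia.
transitivity ((u2du a * b) (N + 1 + N + n%:Z) + (a * u2du b) (N + (N + 1) + n%:Z)).
  rewrite E1 E2 E3 mulrz_suml -big_split /=; apply: eq_bigr => j _.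
  rewrite (_ : N + 1 + j%:Z - 1 = N + j%:Z); last by lia.
  rewrite (_ : N + 1 + (n - j)%N%:Z - 1 = N + (n - j)%N%:Z); last by lia.
  rewrite mulrzAl mulrzAr -mulrzDr; congr (_ *~ _).
  by have := ltn_ord j; lia.
rewrite (_ : N + 1 + N + n%:Z = N + N + 1 + n%:Z); last by lia.
by rewrite (_ : N + (N + 1) + n%:Z = N + N + 1 + n%:Z) //; lia.
Qed.

(* h(u) |-> h(-u) *)
Fact utwist_bounded a : bounded_below (fun k => (-1) ^+ `|k|%N * a k).
Proof. by case: (lcf_bounded a) => N aN; exists N => k /aN ->; rewrite mulr0. Qed.
Definition utwist a : laurent A := Laurent (utwist_bounded a).

Lemma utwist_is_zmod_morphism : zmod_morphism utwist.
Proof. by move=> a b; apply: laurentP => k; rewrite laurentBE /= mulrBr. Qed.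
HB.instance Definition _ := GRing.isZmodMorphism.Build (laurent A) (laurent A)
  utwist utwist_is_zmod_morphism.

Lemma utwist_is_monoid_morphism : monoid_morphism utwist.
Proof.
split=> [|a b].
  by apply: laurentP => k /=; case: eqP => [->|]; rewrite ?mulr1 ?mulr0.
have [N aN bN] := zbelow2 a b.
have tN c : zbelow c N -> zbelow (utwist c) N.
  by move=> cN k /cN /= ->; rewrite mulr0.
apply: (@lau_shift_inj _ _ (N + N)).
- by move=> k kN; rewrite [LHS]/= (lconv_lt aN bN) ?mulr0.
- by apply: zbelowM; apply: tN.
apply: pserP => n; rewrite /lau_shift /=.
rewrite -[lconv (utwist a) _ _]/((utwist a * utwist b) _).
rewrite -[lconv a b _]/((a * b) _).
rewrite (laurent_mul_zbelow _ aN bN) (laurent_mul_zbelow _ (tN _ aN) (tN _ bN)).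
rewrite mulr_sumr; apply: eq_bigr => j _ /=; rewrite mulrACA; congr (_ * _).
rewrite -signr_odd -[in RHS]signr_odd -[X in _ = _ * X]signr_odd -signr_addb.
congr (_ ^+ _); have := ltn_ord j; lia.
Qed.
HB.instance Definition _ := GRing.isMonoidMorphism.Build (laurent A) (laurent A)
  utwist utwist_is_monoid_morphism.

End LaurentRing.

Section LaurentMapRing.
Variables A B : comNzRingType.
Implicit Types a b : laurent A.

Lemma laurent_map_is_zmod_morphism (h : {additive A -> B}) :
  zmod_morphism (laurent_map h).
Proof. by move=> a b; apply: laurentP => k; rewrite laurentBE /= raddfB. Qed.
HB.instance Definition _ (h : {additive A -> B}) :=
  GRing.isZmodMorphism.Build (laurent A) (laurent B) (laurent_map h)
    (laurent_map_is_zmod_morphism h).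

Lemma zbelow_map (h : {additive A -> B}) a N :
  zbelow a N -> zbelow (laurent_map h a) N.
Proof. by move=> aN k /aN /= ->; rewrite raddf0. Qed.

Lemma laurent_map_is_monoid_morphism (h : {rmorphism A -> B}) :
  monoid_morphism (laurent_map h).
Proof.
split=> [|a b].
  by apply: laurentP => k /=; case: eqP; rewrite ?rmorph1 ?rmorph0.
have [N aN bN] := zbelow2 a b.
have hN (c : laurent A) : zbelow c N -> zbelow (laurent_map h c) N.
  exact: zbelow_map.
apply: (@lau_shift_inj _ _ _ (N + N)).
- by apply: zbelow_map; apply: zbelowM.
- by apply: zbelowM; apply: hN.
apply: pserP => n.
change (h ((a * b) (N + N + n%:Z)) =
  (laurent_map h a * laurent_map h b) (N + N + n%:Z)).
rewrite (laurent_mul_zbelow _ (hN _ aN) (hN _ bN)) (laurent_mul_zbelow _ aN bN).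
rewrite rmorph_sum.
by apply: eq_bigr => j _; rewrite rmorphM.
Qed.
HB.instance Definition _ (h : {rmorphism A -> B}) :=
  GRing.isMonoidMorphism.Build (laurent A) (laurent B) (laurent_map h)
    (laurent_map_is_monoid_morphism h).

Lemma laurent_mapC (h : {additive A -> B}) x :
  laurent_map h (laurentC x) = laurentC (h x).
Proof. by apply: laurentP => k /=; case: eqP; rewrite ?raddf0. Qed.

Lemma laurent_map_upow (h : {rmorphism A -> B}) d :
  laurent_map h (upow A d) = upow B d.
Proof. by apply: laurentP => k /=; rewrite rmorph_nat. Qed.

Lemma laurent_map_upowM (h : {additive A -> B}) d a :
  laurent_map h (upow A d * a) = upow B d * laurent_map h a.
Proof. by apply: laurentP => k; rewrite upowME /= -(upowME d a). Qed.

Lemma laurent_map_u2du (h : {additive A -> B}) a :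
  laurent_map h (u2du a) = u2du (laurent_map h a).
Proof. by apply: laurentP => k /=; rewrite raddfMz. Qed.

Lemma laurent_map_utwist (h : {additive A -> B}) a :
  laurent_map h (utwist a) = utwist (laurent_map h a).
Proof.
apply: laurentP => k /=; rewrite -signr_odd -[in RHS]signr_odd.
by case: odd; rewrite ?expr1 ?expr0 ?mulN1r ?raddfN ?mul1r.
Qed.

End LaurentMapRing.

Section LaurentDerivation.
Variable A : comNzRingType.

Lemma laurent_map_derivation (d : {additive A -> A}) :
    (forall x y, d (x * y) = d x * y + x * d y) ->
  forall a b : laurent A,
    laurent_map d (a * b) = laurent_map d a * b + a * laurent_map d b.
Proof.
move=> dM a b; have [N aN bN] := zbelow2 a b.
have daN := zbelow_map d aN; have dbN := zbelow_map d bN.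
apply: (@lau_shift_inj _ _ _ (N + N)).
- by apply: zbelow_map; apply: zbelowM.
- by move=> k kN; rewrite laurentDE (zbelowM daN bN) ?(zbelowM aN dbN) ?addr0.
apply: pserP => n.
change (d ((a * b) (N + N + n%:Z)) = (laurent_map d a * b) (N + N + n%:Z) +
  (a * laurent_map d b) (N + N + n%:Z)).
rewrite (laurent_mul_zbelow _ daN bN) (laurent_mul_zbelow _ aN dbN).
rewrite (laurent_mul_zbelow _ aN bN) raddf_sum.
by rewrite -big_split; apply: eq_bigr => j _; apply: dM.
Qed.

Lemma laurent_map_derivation_upow (d : {additive A -> A}) e :
    (forall x y, d (x * y) = d x * y + x * d y) ->
  laurent_map d (upow A e) = 0.
Proof.
move=> dM; have d1 : d 1 = 0.
  by apply: (addIr (d 1)); rewrite -[in RHS](mul1r 1) dM !mul1r mulr1 add0r.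
by apply: laurentP => k; rewrite laurent0E /= raddfMn d1 mul0rn.
Qed.

Lemma u2du_upow d : u2du (upow A d) = upow A (d + 1) *~ d.
Proof.
have mzE (a : laurent A) (z k : int) : (a *~ z) k = a k *~ z.
  have nE (n : nat) : (a *+ n) k = a k *+ n.
    by elim: n => [|n IHn]; rewrite ?laurent0E // !mulrS laurentDE IHn.
  by case: z => n; rewrite ?NegzE ?mulrNz -?pmulrn ?laurentNE nE.
apply: laurentP => k; rewrite mzE /= subr_eq.
by case: eqP => [->|_]; rewrite ?addrK // !mul0rz.
Qed.

Lemma utwist_upow d : utwist (upow A d) = (-1) ^+ `|d|%N * upow A d.
Proof.
have -> : (-1) ^+ `|d|%N = laurentC ((-1) ^+ `|d|%N) :> laurent A.
  by rewrite rmorphXn rmorphN rmorph1.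
apply: laurentP => k; rewrite laurentCME /=.
by case: eqP => [->|]; rewrite ?mulr0.
Qed.

(* the inclusion A[[u]] -> A((u)) *)
Definition laurent_coef (a : pser A) (k : int) : A :=
  if k is Posz j then a j else 0.
Fact laurent_coef_bounded a : bounded_below (laurent_coef a).
Proof. by exists 0; case. Qed.
Definition laurent_of a : laurent A := Laurent (laurent_coef_bounded a).

Lemma laurent_of_is_zmod_morphism : zmod_morphism laurent_of.
Proof.
by move=> a b; apply: laurentP => -[k|k]; rewrite laurentBE /= ?subr0.
Qed.
HB.instance Definition _ := GRing.isZmodMorphism.Build (pser A) (laurent A)
  laurent_of laurent_of_is_zmod_morphism.

Lemma laurent_of_is_monoid_morphism : monoid_morphism laurent_of.
Proof.
split=> [|a b]; first by apply: laurentP => -[[]|].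
have b0 c : zbelow (laurent_of c) 0 by case.
have s0 c : lau_shift 0 (laurent_of c) = c by apply: pserP => k.
apply: (@lau_shift_inj _ _ _ (0 + 0)) => //; first by apply: zbelowM.
by rewrite [RHS](lau_shiftM (b0 a) (b0 b)) !addr0 !s0.
Qed.
HB.instance Definition _ := GRing.isMonoidMorphism.Build (pser A) (laurent A)
  laurent_of laurent_of_is_monoid_morphism.

Lemma laurent_of_inj : injective laurent_of.
Proof.
move=> a b ab; apply: pserP => k.
exact: (congr1 (fun c : laurent A => c k%:Z) ab).
Qed.

Lemma laurent_ofC x : laurent_of (pserC x) = laurentC x.
Proof. by apply: laurentP => -[[]|]. Qed.

Lemma laurent_ofU : laurent_of pserU = upow A 1.
Proof. by apply: laurentP => -[k|k]. Qed.

Lemma laurent_of_shift (a : laurent A) :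
  exists n (b : pser A), a = upow A (- n%:Z) * laurent_of b.
Proof.
case: (lcf_bounded a) => N aN; have [n Nn] : exists n : nat, - n%:Z <= N.
  by exists `|N|%N; lia.
exists n, (lau_shift (- n%:Z) a); apply: laurentP => k; rewrite upowME /=.
case E : (k - - n%:Z) => [j|j]; first by congr (a _); lia.
by apply: aN; lia.
Qed.

End LaurentDerivation.

Lemma laurent_of_map (A B : comNzRingType) (h : {additive A -> B}) (a : pser A) :
  laurent_of (pser_map h a) = laurent_map h (laurent_of a).
Proof. by apply: laurentP => -[k|k] /=; rewrite ?raddf0. Qed.

Section Convergent.
Variable R : realType.
Local Notation C := R[i].

(* The finite partial sums of sum_m |a_m| rho^|m| are bounded by M, that is,  *)
(* a converges absolutely and uniformly on the polydisc of radius rho.        *)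
(* Since 0 < rho in R[i] entails that rho is real, radii are taken in R[i].   *)
Definition normal_at p (a : mps p C) (rho M : C) :=
  forall s : seq 'X_{1..p}, uniq s -> \sum_(m <- s) `|a m| * rho ^+ mdeg m <= M.

Definition convergent p : {pred mps p C} := fun a =>
  `[< exists2 rho : C, 0 < rho & exists M : C, normal_at a rho M >].
Arguments convergent : clear implicits.

Lemma normal_atW p (a : mps p C) rho rho' M :
  0 <= rho' -> rho' <= rho -> normal_at a rho M -> normal_at a rho' M.
Proof.
move=> r0 rr aM s us; apply: le_trans (aM s us); apply: ler_sum => m _.
by rewrite ler_wpM2l // lerXn2r // nnegrE // (le_trans r0).
Qed.

Lemma convergent2 p (a b : mps p C) : a \in convergent p -> b \in convergent p ->
  exists2 rho, 0 < rho & exists M N, normal_at a rho M /\ normal_at b rho N.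
Proof.
move=> /asboolP[r r0 [M aM]] /asboolP[s s0 [N bN]].
case: (real_leP (gtr0_real r0) (gtr0_real s0)) => rs.
- by exists r => //; exists M, N; split=> //; apply: normal_atW bN; rewrite // ltW.
by exists s => //; exists M, N; split=> //; apply: normal_atW aM; rewrite // ltW.
Qed.

Lemma normal_at0 p (a : mps p C) rho M : normal_at a rho M -> 0 <= M.
Proof. by move/(_ [::] isT); rewrite big_nil. Qed.

Lemma normal_at_bnd p (a : mps p C) rho M N : normal_at a rho M ->
  \sum_(k : 'X_{1..p < N}) `|a k| * rho ^+ mdeg k <= M.
Proof.
move=> aM; have /aM : uniq [seq val k | k <- index_enum 'X_{1..p < N}].
  by rewrite map_inj_uniq ?index_enum_uniq //; apply: val_inj.
by rewrite big_map.
Qed.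

Lemma convergentM p (a b : mps p C) :
  a \in convergent p -> b \in convergent p -> a * b \in convergent p.
Proof.
move=> ca cb; have [r r0 [M [N [aM bN]]]] := convergent2 ca cb.
apply/asboolP; exists r => //; exists (M * N) => s us.
pose d := (\max_(m <- s) mdeg m).+1.
have sd m : m \in s -> (mdeg m < d)%N.
  by move=> ms; rewrite ltnS (big_rem m) //= leq_maxl.
pose X (k : 'X_{1..p < d, d}) :=
  (`|a k.1| * r ^+ mdeg k.1) * (`|b k.2| * r ^+ mdeg k.2).
have X0 k : 0 <= X k by rewrite !mulr_ge0 ?exprn_ge0 // ltW.
apply: (@le_trans _ _ (\sum_(k : 'X_{1..p < d, d}) X k)); last first.
  rewrite -(pair_bigA _ (fun i j : 'X_{1..p < d} =>
    (`|a i| * r ^+ mdeg i) * (`|b j| * r ^+ mdeg j))) /=.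
  under eq_bigr do rewrite -mulr_sumr.
  rewrite -mulr_suml ler_pM ?normal_at_bnd //; apply: sumr_ge0 => i _;
  by rewrite mulr_ge0 ?exprn_ge0 // ltW.
apply: (@le_trans _ _
  (\sum_(m <- s) \sum_(k : 'X_{1..p < d, d} | m == (k.1 + k.2)%MM) X k)).
  rewrite big_seq [leRHS]big_seq; apply: ler_sum => m /sd md.
  have -> : (a * b) m =
      \sum_(k : 'X_{1..p < d, d} | m == (k.1 + k.2)%MM) a k.1 * b k.2.
    rewrite [LHS](@mps_mulE _ _ _ _ _ (mtrunc d a) (mtrunc d b)); last 2 first.
    - by move=> m' le_m; rewrite mcoeff_mtrunc // (leq_ltn_trans le_m).
    - by move=> m' le_m; rewrite mcoeff_mtrunc // (leq_ltn_trans le_m).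
    rewrite [LHS](mcoeff_poly_mul _ _ md); apply: eq_bigr => -[k1 k2] /= _.
    by rewrite !mcoeff_mtrunc ?bmdeg.
  rewrite mulrC; apply: le_trans (ler_wpM2l _ (ler_norm_sum _ _ _)) _.
    by rewrite exprn_ge0 // ltW.
  rewrite mulr_sumr; apply: ler_sum => k /eqP ->.
  by rewrite normrM mdegD exprD mulrC mulrACA.
under eq_bigr do rewrite big_mkcond.
rewrite exchange_big /=; apply: ler_sum => k _.
rewrite -big_mkcond /=.
case: (boolP ((k.1 + k.2)%MM \in s)) => ks.
  by rewrite -big_filter filter_pred1_uniq // big_seq1.
rewrite big_seq_cond big1 // => m /andP[ms /eqP e].
by rewrite -e ms in ks.
Qed.

Lemma convergentB p (a b : mps p C) :
  a \in convergent p -> b \in convergent p -> a - b \in convergent p.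
Proof.
move=> ca cb; have [r r0 [M [N [aM bN]]]] := convergent2 ca cb.
apply/asboolP; exists r => //; exists (M + N) => s us.
apply: le_trans (lerD (aM s us) (bN s us)); rewrite -big_split /=.
apply: ler_sum => m _; rewrite -mulrDl ler_wpM2r ?exprn_ge0 ?(ltW r0) //.
exact: ler_normB.
Qed.

Lemma convergent_finite p (a : mps p C) (t : seq 'X_{1..p}) :
  (forall m, m \notin t -> a m = 0) -> a \in convergent p.
Proof.
move=> a0; apply/asboolP; exists 1 => //; exists (\sum_(m <- undup t) `|a m|) => s us.
under eq_bigr do rewrite expr1n mulr1.
rewrite (bigID (mem t)) /= [X in _ + X]big1 ?addr0; last by move=> m /a0 ->; rewrite normr0.
rewrite -big_filter [leRHS](bigID (mem s)) /= -[leLHS]addr0 lerD //; last first.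
  by apply: sumr_ge0.
rewrite -[X in _ <= X]big_filter le_eqVlt (perm_big _ (_ : perm_eq _ [seq m <- undup t | m \in s])) ?eqxx //.
apply: uniq_perm; rewrite ?filter_uniq ?undup_uniq // => m.
by rewrite !mem_filter mem_undup andbC.
Qed.

Lemma convergent_subring p : subring_closed (convergent p).
Proof.
split; [|exact: convergentB|exact: convergentM].
apply: (@convergent_finite _ _ [:: 0%MM]) => m; rewrite inE => /negPf m0.
by rewrite mps1E m0.
Qed.

HB.instance Definition _ p :=
  GRing.isSubringClosed.Build (mps p C) (convergent p) (convergent_subring p).

Lemma convergent_der p i (a : mps p C) :
  a \in convergent p -> mps_der i a \in convergent p.
Proof.
case/asboolP=> r r0 [M aM]; apply/asboolP; exists (r / 2).
  by rewrite divr_gt0 ?ltr0n.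
exists (r^-1 * M) => s us.
have us' : uniq [seq (m + U_(i))%MM | m <- s].
  by rewrite map_inj_uniq // => m m' /eqP; rewrite eqm_add2r => /eqP.
apply: le_trans (ler_wpM2l _ (aM _ us')); last by rewrite invr_ge0 ltW.
rewrite mulr_sumr big_map; apply: ler_sum => m _ /=.
rewrite mdegD mdeg1 addn1 exprS mulrCA mulKf ?gt_eqF // normrMn expr_div_n.
rewrite mulrnAl -mulrnAr ler_wpM2l // -mulrnAr ler_piMr ?exprn_ge0 ?(ltW r0) //.
rewrite -mulr_natl.
rewrite ler_pdivrMr ?exprn_gt0 ?ltr0n // mul1r -natrX ler_nat.
apply: leq_trans (ltn_expl (mdeg m) (ltnSn 1)).
by rewrite ltnS mdegE (bigD1 i) //= leq_addr.
Qed.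

(* x_i |-> x_(h i), for h injective *)
Definition mps_incl p q (h : 'I_p -> 'I_q) (a : mps p C) : mps q C :=
  Mps (fun m => if [forall j, (j \in codom h) || (m j == 0%N)]
                then a [multinom m (h i) | i < p] else 0).

Lemma convergent_incl p q (h : 'I_p -> 'I_q) (a : mps p C) :
  injective h -> a \in convergent p -> mps_incl h a \in convergent q.
Proof.
move=> h_inj /asboolP[r r0 [M aM]]; apply/asboolP; exists r => //; exists M => s us.
pose P (m : 'X_{1..q}) := [forall j, (j \in codom h) || (m j == 0%N)].
pose f (m : 'X_{1..q}) : 'X_{1..p} := [multinom m (h i) | i < p].
rewrite (bigID P) /= [X in _ + X]big1 ?addr0 => [|m]; last first.
  by rewrite /P => /negPf ->; rewrite normr0 mul0r.
have uf : uniq [seq f m | m <- s & P m].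
  rewrite map_inj_in_uniq ?filter_uniq // => m m'.
  rewrite !mem_filter => /andP[/forallP Pm _] /andP[/forallP Pm' _] /mnmP ff.
  apply/mnmP => j; case/orP: (Pm j) => [/codomP[i ->]|/eqP mj].
    by have := ff i; rewrite !mnmE.
  case/orP: (Pm' j) => [/codomP[i ->]|/eqP m'j]; last by rewrite mj m'j.
  by have := ff i; rewrite !mnmE.
apply: le_trans (aM _ uf); rewrite big_map big_filter.
apply: ler_sum => m Pm; rewrite /= -/(P m) Pm -/(f m).
suff -> : mdeg m = mdeg (f m) by [].
rewrite !mdegE (bigID (mem (codom h))) /= [X in (_ + X)%N]big1 ?addn0; last first.
  by move=> j jh; have /forallP/(_ j) := Pm; rewrite (negPf jh) => /eqP.
under [RHS]eq_bigr do rewrite mnmE.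
have uc : uniq (codom h) by rewrite map_inj_uniq ?enum_uniq.
by rewrite -big_uniq //= big_image.
Qed.

Lemma convergentC p c : mpsC p c \in convergent p.
Proof.
apply: (@convergent_finite _ _ [:: 0%MM]) => m.
by rewrite inE => /negPf m0; rewrite /= m0.
Qed.

Lemma convergentX p i : mpsX C i \in convergent p.
Proof.
apply: (@convergent_finite _ _ [:: U_(i)%MM]) => m.
by rewrite inE => /negPf mi; rewrite /= mi.
Qed.

(* C{x_1, ..., x_p} *)
Record conv p := Conv { conv_mps :> mps p C; _ : conv_mps \in convergent p }.

HB.instance Definition _ p := [isSub for @conv_mps p].
HB.instance Definition _ p := [Choice of conv p by <:].
HB.instance Definition _ p := [SubChoice_isSubComNzRing of conv p by <:].

Lemma convP p (a b : conv p) : (a : mps p C) =1 b -> a = b.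
Proof. by move=> ab; apply/val_inj/mpsP. Qed.

Definition convC p (c : C) : conv p := Conv (convergentC p c).
Definition convX p (i : 'I_p) : conv p := Conv (convergentX i).
Definition conv_der p (i : 'I_p) (a : conv p) : conv p :=
  Conv (convergent_der i (valP a)).
Definition conv_incl p q (h : 'I_p -> 'I_q) (h_inj : injective h) (a : conv p) :
  conv q := Conv (convergent_incl h_inj (valP a)).

Lemma convC_is_zmod_morphism p : zmod_morphism (convC p).
Proof. by move=> x y; apply: val_inj; rewrite /= raddfB. Qed.
HB.instance Definition _ p :=
  GRing.isZmodMorphism.Build C (conv p) (convC p) (@convC_is_zmod_morphism p).

Lemma convC_is_monoid_morphism p : monoid_morphism (convC p).
Proof. by split=> [|x y]; apply: val_inj; rewrite //= rmorphM. Qed.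
HB.instance Definition _ p :=
  GRing.isMonoidMorphism.Build C (conv p) (convC p) (@convC_is_monoid_morphism p).

Lemma conv_der_is_zmod_morphism p i : zmod_morphism (@conv_der p i).
Proof. by move=> x y; apply: val_inj; rewrite /= raddfB. Qed.
HB.instance Definition _ p i := GRing.isZmodMorphism.Build (conv p) (conv p)
  (@conv_der p i) (@conv_der_is_zmod_morphism p i).

Lemma conv_derM p (i : 'I_p) a b :
  conv_der i (a * b) = conv_der i a * b + a * conv_der i b.
Proof. by apply: val_inj; rewrite /= mps_derM. Qed.

Lemma conv_derC p (i : 'I_p) c : conv_der i (convC p c) = 0.
Proof. by apply: val_inj; rewrite /= mps_derC. Qed.

Lemma conv_der_comm p (i j : 'I_p) a :
  conv_der i (conv_der j a) = conv_der j (conv_der i a).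
Proof. by apply: val_inj; rewrite /= mps_der_comm. Qed.

End Convergent.

Section GaussManinModules.
Variables (C : comNzRingType) (m : nat).
Local Notation K := (laurent (mps m C)).

Definition lau_ds (j : 'I_m) : K -> K := laurent_map (@mps_der m C j).
HB.instance Definition _ j := GRing.Additive.on (lau_ds j).

Lemma lau_dsM j a b : lau_ds j (a * b) = lau_ds j a * b + a * lau_ds j b.
Proof. exact/laurent_map_derivation/mps_derM. Qed.

Lemma lau_ds_comm i j a : lau_ds i (lau_ds j a) = lau_ds j (lau_ds i a).
Proof. by apply: laurentP => k; apply: mps_der_comm. Qed.

Lemma lau_ds_u2du j a : lau_ds j (u2du a) = u2du (lau_ds j a).
Proof. exact: laurent_map_u2du. Qed.

Lemma lau_ds_utwist j a : lau_ds j (utwist a) = utwist (lau_ds j a).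
Proof. exact: laurent_map_utwist. Qed.

Lemma u2du_utwist (a : K) : u2du (utwist a) = - utwist (u2du a).
Proof.
apply: laurentP => k; rewrite laurentNE /=.
rewrite -signr_odd -[in RHS]signr_odd (_ : odd `|k|%N = ~~ odd `|k - 1|%N); last by lia.
by rewrite signrN mulNr opprK mulrzAr.
Qed.

(* Modules over R((u))<d_{s_1}, ..., d_{s_m}, t> for R = C[[s_1, ..., s_m]],  *)
(* where [t, u] = u^2, [d_{s_j}, s_j] = 1 and all other generators commute.   *)
Record gm_module := GMModule {
  gm_car :> lmodType K;
  gm_t : gm_car -> gm_car;
  gm_ds : 'I_m -> gm_car -> gm_car;
  gm_tD : {morph gm_t : x y / x + y};
  gm_tZ : forall h x, gm_t (h *: x) = u2du h *: x + h *: gm_t x;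
  gm_dsD : forall j, {morph gm_ds j : x y / x + y};
  gm_dsZ : forall j h x, gm_ds j (h *: x) = lau_ds j h *: x + h *: gm_ds j x;
  gm_t_ds : forall j x, gm_t (gm_ds j x) = gm_ds j (gm_t x);
  gm_ds_comm : forall i j x, gm_ds i (gm_ds j x) = gm_ds j (gm_ds i x) }.

Definition gm_hom (M N : gm_module) (phi : M -> N) : Prop :=
  [/\ linear phi,
      forall x, phi (gm_t x) = gm_t (phi x)
    & forall j x, phi (gm_ds j x) = gm_ds j (phi x)].

Definition gm_iso (M N : gm_module) (phi : M -> N) : Prop :=
  gm_hom phi /\ bijective phi.

Definition gm_const (c : C) : K := laurentC (mpsC m c).

Section Dual.
Variable M : gm_module.

Record gm_form := GMForm { gm_form_fun :> M -> K; gm_formP : scalar gm_form_fun }.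

HB.instance Definition _ := gen_eqMixin gm_form.
HB.instance Definition _ := gen_choiceMixin gm_form.

Lemma gm_form_eq (p q : gm_form) : p =1 q -> p = q.
Proof.
case: p q => [p p_] [q q_] /= /funext pq; case: _ / pq in q_ *.
by congr GMForm; apply: Prop_irrelevance.
Qed.

Implicit Types (p q : gm_form) (h : K).

Lemma gm_formD p x y : p (x + y) = p x + p y.
Proof. by have := gm_formP p 1 x y; rewrite scale1r mul1r. Qed.

Lemma gm_formZ p h x : p (h *: x) = h * p x.
Proof.
have p0 : p 0 = 0 by apply: (addIr (p 0)); rewrite -gm_formD !addr0 add0r.
by have := gm_formP p h x 0; rewrite p0 !addr0.
Qed.

Fact gm_form0_subproof : scalar (fun _ : M => 0 : K).
Proof. by move=> h x y; rewrite mulr0 addr0. Qed.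
Definition gm_form0 := GMForm gm_form0_subproof.

Fact gm_form_opp_subproof p : scalar (fun x => - p x).
Proof. by move=> h x y; rewrite gm_formP opprD mulrN. Qed.
Definition gm_form_opp p := GMForm (gm_form_opp_subproof p).

Fact gm_form_add_subproof p q : scalar (fun x => p x + q x).
Proof. by move=> h x y; rewrite !gm_formP mulrDr addrACA. Qed.
Definition gm_form_add p q := GMForm (gm_form_add_subproof p q).

Fact gm_form_addA : associative gm_form_add.
Proof. by move=> a b c; apply: gm_form_eq => x /=; rewrite addrA. Qed.
Fact gm_form_addC : commutative gm_form_add.
Proof. by move=> a b; apply: gm_form_eq => x /=; rewrite addrC. Qed.
Fact gm_form_add0 : left_id gm_form0 gm_form_add.
Proof. by move=> a; apply: gm_form_eq => x /=; rewrite add0r. Qed.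
Fact gm_form_addN : left_inverse gm_form0 gm_form_opp gm_form_add.
Proof. by move=> a; apply: gm_form_eq => x /=; rewrite addNr. Qed.

HB.instance Definition _ := GRing.isZmodule.Build gm_form
  gm_form_addA gm_form_addC gm_form_add0 gm_form_addN.

(* (u phi)(x) = - u (phi x), so h(u) acts as multiplication by h(-u). *)
Fact gm_form_scale_subproof h p : scalar (fun x => utwist h * p x).
Proof. by move=> k x y; rewrite gm_formP mulrDr mulrCA. Qed.
Definition gm_form_scale h p := GMForm (gm_form_scale_subproof h p).

Fact gm_form_scaleA a b p :
  gm_form_scale a (gm_form_scale b p) = gm_form_scale (a * b) p.
Proof. by apply: gm_form_eq => x /=; rewrite rmorphM mulrA. Qed.
Fact gm_form_scale1 : left_id 1 gm_form_scale.
Proof. by move=> p; apply: gm_form_eq => x /=; rewrite rmorph1 mul1r. Qed.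
Fact gm_form_scaleDr : right_distributive gm_form_scale +%R.
Proof. by move=> h p q; apply: gm_form_eq => x /=; rewrite mulrDr. Qed.
Fact gm_form_scaleDl p : {morph gm_form_scale^~ p : a b / a + b}.
Proof. by move=> a b; apply: gm_form_eq => x /=; rewrite raddfD mulrDl. Qed.

HB.instance Definition _ := GRing.Zmodule_isLmodule.Build K gm_form
  gm_form_scaleA gm_form_scale1 gm_form_scaleDr gm_form_scaleDl.

Fact gm_form_t_subproof p : scalar (fun x => p (gm_t x) - u2du (p x)).
Proof.
move=> h x y; rewrite gm_tD gm_tZ !gm_formD !gm_formZ raddfD /= u2duM.
ring.
Qed.
Definition gm_form_t p := GMForm (gm_form_t_subproof p).

Fact gm_form_ds_subproof j p : scalar (fun x => lau_ds j (p x) - p (gm_ds j x)).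
Proof.
move=> h x y; rewrite gm_dsD gm_dsZ !gm_formD !gm_formZ raddfD /= lau_dsM.
ring.
Qed.
Definition gm_form_ds j p := GMForm (gm_form_ds_subproof j p).

Fact gm_form_tD : {morph gm_form_t : p q / p + q}.
Proof. by move=> p q; apply: gm_form_eq => x /=; rewrite raddfD opprD addrACA. Qed.

Fact gm_form_tZ h p : gm_form_t (h *: p) = u2du h *: p + h *: gm_form_t p.
Proof.
apply: gm_form_eq => x /=; rewrite u2duM u2du_utwist.
ring.
Qed.

Fact gm_form_dsD j : {morph gm_form_ds j : p q / p + q}.
Proof. by move=> p q; apply: gm_form_eq => x /=; rewrite raddfD opprD addrACA. Qed.

Fact gm_form_dsZ j h p :
  gm_form_ds j (h *: p) = lau_ds j h *: p + h *: gm_form_ds j p.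
Proof.
apply: gm_form_eq => x /=; rewrite lau_dsM lau_ds_utwist.
ring.
Qed.

Fact gm_form_t_ds j p : gm_form_t (gm_form_ds j p) = gm_form_ds j (gm_form_t p).
Proof.
apply: gm_form_eq => x /=; rewrite !raddfB /= lau_ds_u2du gm_t_ds /=.
ring.
Qed.

Fact gm_form_ds_comm i j p :
  gm_form_ds i (gm_form_ds j p) = gm_form_ds j (gm_form_ds i p).
Proof.
apply: gm_form_eq => x /=; rewrite !raddfB /= lau_ds_comm gm_ds_comm /=.
ring.
Qed.

Definition gm_dual : gm_module := @GMModule gm_form gm_form_t gm_form_ds
  gm_form_tD gm_form_tZ gm_form_dsD gm_form_dsZ gm_form_t_ds gm_form_ds_comm.

End Dual.
End GaussManinModules.

Section QuotientModule.
Variables (K B : comNzRingType) (sc : {rmorphism K -> B}) (I : zmodClosed B).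
Hypothesis I_sc : forall c a, a \in I -> sc c * a \in I.
Local Notation Q := (Quotient.quot I).
Local Open Scope quotient_scope.

Lemma quot_piP (a b : B) : (\pi_Q a = \pi_Q b) <-> (a - b \in I).
Proof. by rewrite Quotient.idealrBE; split=> [->|/eqP]. Qed.

Lemma quot_repr (a : B) : repr (\pi_Q a) - a \in I.
Proof. by apply/quot_piP; rewrite reprK. Qed.

Definition quot_scale (c : K) (x : Q) : Q := \pi_Q (sc c * repr x).

Lemma quot_scaleE c a : quot_scale c (\pi_Q a) = \pi_Q (sc c * a).
Proof. by apply/quot_piP; rewrite -mulrBr I_sc // quot_repr. Qed.

Fact quot_scaleA a b x : quot_scale a (quot_scale b x) = quot_scale (a * b) x.
Proof. by rewrite -[x]reprK (quot_scaleE b) !quot_scaleE rmorphM mulrA. Qed.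
Fact quot_scale1 : left_id 1 quot_scale.
Proof. by move=> x; rewrite -[x]reprK quot_scaleE rmorph1 mul1r. Qed.
Fact quot_scaleDr : right_distributive quot_scale +%R.
Proof.
move=> c x y; rewrite -[x]reprK -[y]reprK -raddfD !quot_scaleE mulrDr.
exact: raddfD.
Qed.
Fact quot_scaleDl x : {morph quot_scale^~ x : a b / a + b}.
Proof.
by move=> a b; rewrite -[x]reprK !quot_scaleE rmorphD mulrDl; apply: raddfD.
Qed.

End QuotientModule.

Section GaussManin.
Variables (R : realType) (n m : nat).
Local Notation C := R[i].
Local Notation O := (conv R n.+1).
Local Notation S := (mps m O).
Local Notation K := (laurent (mps m C)).
Local Notation K0 := (pser (mps m C)).
Variables (f : O) (g : 'I_m -> O).

(* F = f + sum_j g_j s_j *)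
Definition unfolding : S := mpsC m f + \sum_(j < m) mpsC m (g j) * mpsX O j.

Definition ddx (i : 'I_n.+1) : S -> S := mps_map (@conv_der R n.+1 i).
HB.instance Definition _ i := GRing.Additive.on (ddx i).

Definition scal : mps m C -> S := mps_map (@convC R n.+1).
HB.instance Definition _ := GRing.RMorphism.on scal.

Lemma ddxM i a b : ddx i (a * b) = ddx i a * b + a * ddx i b.
Proof. exact/mps_map_derivation/conv_derM. Qed.

Lemma ddx_scal i c : ddx i (scal c) = 0.
Proof. by apply: mpsP => k; rewrite mps0E /= conv_derC. Qed.

Lemma ddx_der i j a : mps_der j (ddx i a) = ddx i (mps_der j a).
Proof. exact: mps_map_der. Qed.

Lemma der_unfolding j : mps_der j unfolding = mpsC m (g j).
Proof.
rewrite raddfD raddf_sum /= mps_derC add0r (bigD1 j) //= big1 => [|i ij].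
  by rewrite mps_derM mps_derC mul0r add0r mps_derX eqxx mulr1 addr0.
by rewrite mps_derM mps_derC mul0r add0r mps_derX eq_sym (negPf ij) mulr0.
Qed.

(* Identify Omega^{n+1} with the functions through omega = w dx, and Omega^n  *)
(* with (n+1)-tuples of functions through eta = sum_i eta_i (-1)^i            *)
(* dx_0 /\ .. /\ (dx_i omitted) /\ .. /\ dx_n, so that dx_i /\ eta = eta_i dx *)
(* and (u d - dF /\) eta = (sum_i (u d_i eta_i - (d_i F) eta_i)) dx.          *)

Definition brieskorn_d (eta : 'I_n.+1 -> pser S) : pser S :=
  \sum_i (pserU * pser_map (ddx i) (eta i) - pserC (ddx i unfolding) * eta i).

Definition gauss_manin_d (eta : 'I_n.+1 -> laurent S) : laurent S :=
  \sum_i (upow S 1 * laurent_map (ddx i) (eta i)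
          - laurentC (ddx i unfolding) * eta i).

Lemma brieskorn_dB eta eta' :
  brieskorn_d eta - brieskorn_d eta' = brieskorn_d (fun i => eta i - eta' i).
Proof. by rewrite -sumrB; apply: eq_bigr => i _; rewrite raddfB /=; ring. Qed.

Lemma gauss_manin_dB eta eta' :
  gauss_manin_d eta - gauss_manin_d eta' = gauss_manin_d (fun i => eta i - eta' i).
Proof. by rewrite -sumrB; apply: eq_bigr => i _; rewrite raddfB /=; ring. Qed.

Definition brieskorn_rel : {pred pser S} :=
  fun w => `[< exists eta, w = brieskorn_d eta >].

Definition gauss_manin_rel : {pred laurent S} :=
  fun w => `[< exists eta, w = gauss_manin_d eta >].

Lemma brieskorn_relP w : reflect (exists eta, w = brieskorn_d eta) (w \in brieskorn_rel).
Proof. exact: asboolP. Qed.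

Lemma gauss_manin_relP w :
  reflect (exists eta, w = gauss_manin_d eta) (w \in gauss_manin_rel).
Proof. exact: asboolP. Qed.

Lemma brieskorn_rel_zmod : zmod_closed brieskorn_rel.
Proof.
split=> [|_ _ /brieskorn_relP[e ->] /brieskorn_relP[e' ->]]; apply/brieskorn_relP.
  exists (fun=> 0); rewrite /brieskorn_d big1 // => i _.
  by rewrite raddf0 !mulr0 subr0.
by rewrite brieskorn_dB; eexists.
Qed.
HB.instance Definition _ :=
  GRing.isZmodClosed.Build (pser S) brieskorn_rel brieskorn_rel_zmod.

Lemma gauss_manin_rel_zmod : zmod_closed gauss_manin_rel.
Proof.
split=> [|_ _ /gauss_manin_relP[e ->] /gauss_manin_relP[e' ->]]; apply/gauss_manin_relP.
  exists (fun=> 0); rewrite /gauss_manin_d big1 // => i _.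
  by rewrite raddf0 !mulr0 subr0.
by rewrite gauss_manin_dB; eexists.
Qed.
HB.instance Definition _ :=
  GRing.isZmodClosed.Build (laurent S) gauss_manin_rel gauss_manin_rel_zmod.

Definition brieskorn_scal : K0 -> pser S := pser_map scal.
HB.instance Definition _ := GRing.RMorphism.on brieskorn_scal.

Definition gauss_manin_scal : K -> laurent S := laurent_map scal.
HB.instance Definition _ := GRing.RMorphism.on gauss_manin_scal.

Lemma pser_ddxM i a b :
  pser_map (ddx i) (a * b) = pser_map (ddx i) a * b + a * pser_map (ddx i) b.
Proof.
apply: laurent_of_inj; rewrite rmorphD !rmorphM /= !laurent_of_map rmorphM /=.
exact/laurent_map_derivation/ddxM.
Qed.

Lemma lau_ddxM i a b : laurent_map (ddx i) (a * b) =
  laurent_map (ddx i) a * b + a * laurent_map (ddx i) b.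
Proof. exact/laurent_map_derivation/ddxM. Qed.

Lemma brieskorn_rel_scal c a :
  a \in brieskorn_rel -> brieskorn_scal c * a \in brieskorn_rel.
Proof.
case/brieskorn_relP=> eta ->; apply/brieskorn_relP.
exists (fun i => brieskorn_scal c * eta i).
rewrite /brieskorn_d mulr_sumr; apply: eq_bigr => i _.
have -> : pser_map (ddx i) (brieskorn_scal c * eta i) =
    brieskorn_scal c * pser_map (ddx i) (eta i).
  rewrite pser_ddxM (_ : pser_map _ (brieskorn_scal c) = 0) ?mul0r ?add0r //.
  by apply: pserP => k; rewrite pser0E; apply: ddx_scal.
ring.
Qed.

Lemma gauss_manin_rel_scal c a :
  a \in gauss_manin_rel -> gauss_manin_scal c * a \in gauss_manin_rel.
Proof.
case/gauss_manin_relP=> eta ->; apply/gauss_manin_relP.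
exists (fun i => gauss_manin_scal c * eta i).
rewrite /gauss_manin_d mulr_sumr; apply: eq_bigr => i _.
have -> : laurent_map (ddx i) (gauss_manin_scal c * eta i) =
    gauss_manin_scal c * laurent_map (ddx i) (eta i).
  rewrite lau_ddxM (_ : laurent_map _ (gauss_manin_scal c) = 0) ?mul0r ?add0r //.
  by apply: laurentP => k; rewrite laurent0E; apply: ddx_scal.
ring.
Qed.

Definition brieskorn_lattice := Quotient.quot brieskorn_rel.
HB.instance Definition _ := GRing.Zmodule.on brieskorn_lattice.
HB.instance Definition _ := GRing.Zmodule_isLmodule.Build K0 brieskorn_lattice
  (quot_scaleA brieskorn_rel_scal) (quot_scale1 brieskorn_rel_scal)
  (quot_scaleDr brieskorn_rel_scal) (quot_scaleDl brieskorn_rel_scal).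

(* The cokernel of u d - dF /\ on forms with coefficients in C{x}[[s]]((u)).  *)
(* It has the universal property of the extension of scalars of the Brieskorn *)
(* lattice from C[[s]][[u]] to C[[s]]((u)): see gauss_manin_base_change.      *)
Definition gauss_manin_space := Quotient.quot gauss_manin_rel.
HB.instance Definition _ := GRing.Zmodule.on gauss_manin_space.
HB.instance Definition _ := GRing.Zmodule_isLmodule.Build K gauss_manin_space
  (quot_scaleA gauss_manin_rel_scal) (quot_scale1 gauss_manin_rel_scal)
  (quot_scaleDr gauss_manin_rel_scal) (quot_scaleDl gauss_manin_rel_scal).

Definition brieskorn_class (w : pser S) : brieskorn_lattice :=
  (\pi_(Quotient.quot brieskorn_rel) w)%qT.
Definition gauss_manin_class (w : laurent S) : gauss_manin_space :=
  (\pi_(Quotient.quot gauss_manin_rel) w)%qT.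

Lemma brieskorn_classP a b :
  (brieskorn_class a = brieskorn_class b) <-> (a - b \in brieskorn_rel).
Proof. exact: quot_piP. Qed.

Lemma gauss_manin_classP a b :
  (gauss_manin_class a = gauss_manin_class b) <-> (a - b \in gauss_manin_rel).
Proof. exact: quot_piP. Qed.

Lemma brieskorn_classE (x : brieskorn_lattice) : exists w, x = brieskorn_class w.
Proof. by exists (repr x); rewrite /brieskorn_class reprK. Qed.

Lemma gauss_manin_classE (x : gauss_manin_space) :
  exists w, x = gauss_manin_class w.
Proof. by exists (repr x); rewrite /gauss_manin_class reprK. Qed.

Lemma brieskorn_classD a b :
  brieskorn_class (a + b) = brieskorn_class a + brieskorn_class b.
Proof. exact: raddfD. Qed.

Lemma gauss_manin_classD a b :
  gauss_manin_class (a + b) = gauss_manin_class a + gauss_manin_class b.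
Proof. exact: raddfD. Qed.

Lemma brieskorn_classZ c a :
  c *: brieskorn_class a = brieskorn_class (brieskorn_scal c * a).
Proof. exact: quot_scaleE brieskorn_rel_scal c a. Qed.

Lemma gauss_manin_classZ c a :
  c *: gauss_manin_class a = gauss_manin_class (gauss_manin_scal c * a).
Proof. exact: quot_scaleE gauss_manin_rel_scal c a. Qed.

(* t w = F w + u^2 dw/du  and  d_{s_j} w = dw/ds_j - u^-1 g_j w *)
Definition form_t (w : laurent S) : laurent S := laurentC unfolding * w + u2du w.
Definition form_ds (j : 'I_m) (w : laurent S) : laurent S :=
  laurent_map (@mps_der m O j) w - upow S (-1) * laurentC (mpsC m (g j)) * w.

Lemma form_tB a b : form_t (a - b) = form_t a - form_t b.
Proof. by rewrite /form_t raddfB /=; ring. Qed.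
Lemma form_dsB j a b : form_ds j (a - b) = form_ds j a - form_ds j b.
Proof. by rewrite /form_ds raddfB /=; ring. Qed.

Lemma lau_derM j a b : laurent_map (@mps_der m O j) (a * b) =
  laurent_map (@mps_der m O j) a * b + a * laurent_map (@mps_der m O j) b.
Proof. exact/laurent_map_derivation/mps_derM. Qed.

Lemma lau_ddx_upow i d : laurent_map (ddx i) (upow S d) = 0.
Proof. exact/laurent_map_derivation_upow/ddxM. Qed.

Lemma lau_der_upow j d : laurent_map (@mps_der m O j) (upow S d) = 0.
Proof. exact/laurent_map_derivation_upow/mps_derM. Qed.

Lemma u2duC (x : S) : u2du (laurentC x) = 0.
Proof.
apply: laurentP => k; rewrite laurent0E /=.
by case: eqP => [->|_]; rewrite ?mulr0z ?mul0rz.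
Qed.

Lemma upowVK : upow S 1 * upow S (-1) = 1.
Proof. by rewrite mulrC upowK. Qed.

Lemma form_t_rel w : w \in gauss_manin_rel -> form_t w \in gauss_manin_rel.
Proof.
case/gauss_manin_relP=> eta ->; apply/gauss_manin_relP.
exists (fun i => form_t (eta i) + upow S 1 * eta i).
rewrite /form_t /gauss_manin_d; move: unfolding => FF.
rewrite mulr_sumr raddf_sum -big_split /=.
apply: eq_bigr => i _; rewrite raddfB !raddfD /= !u2duM !lau_ddxM u2duC.
rewrite laurent_mapC laurent_map_u2du lau_ddx_upow.
have -> : u2du (upow S 1) = upow S 1 * upow S 1 by rewrite u2du_upow upowD.
ring.
Qed.

Lemma form_ds_rel j w : w \in gauss_manin_rel -> form_ds j w \in gauss_manin_rel.
Proof.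
case/gauss_manin_relP=> eta ->; apply/gauss_manin_relP.
exists (fun i => form_ds j (eta i)).
have := der_unfolding j; rewrite /form_ds /gauss_manin_d.
move: unfolding => FF dF; rewrite mulr_sumr raddf_sum -sumrB /=.
apply: eq_bigr => i _; rewrite !raddfB /= !lau_derM !lau_ddxM.
rewrite !laurent_mapC /= ddx_der dF lau_der_upow lau_ddx_upow.
have -> : laurent_map (@mps_der m O j) (laurent_map (ddx i) (eta i)) =
          laurent_map (ddx i) (laurent_map (@mps_der m O j) (eta i)).
  by apply: laurentP => k; apply: ddx_der.
set u := upow S 1; set v := upow S (-1).
have uv : u * v = 1 by exact: upowVK.
ring: uv.
Qed.

Definition gauss_manin_t (x : gauss_manin_space) : gauss_manin_space :=
  gauss_manin_class (form_t (repr x)).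
Definition gauss_manin_ds (j : 'I_m) (x : gauss_manin_space) : gauss_manin_space :=
  gauss_manin_class (form_ds j (repr x)).

Lemma gauss_manin_tE w :
  gauss_manin_t (gauss_manin_class w) = gauss_manin_class (form_t w).
Proof.
by apply/gauss_manin_classP; rewrite -form_tB; apply/form_t_rel/quot_repr.
Qed.

Lemma gauss_manin_dsE j w :
  gauss_manin_ds j (gauss_manin_class w) = gauss_manin_class (form_ds j w).
Proof.
by apply/gauss_manin_classP; rewrite -form_dsB; apply/form_ds_rel/quot_repr.
Qed.

Fact gauss_manin_tD : {morph gauss_manin_t : x y / x + y}.
Proof.
move=> x y; have [a ->] := gauss_manin_classE x; have [b ->] := gauss_manin_classE y.
rewrite -gauss_manin_classD !gauss_manin_tE -gauss_manin_classD.
congr gauss_manin_class; rewrite /form_t raddfD /=; ring.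
Qed.

Fact gauss_manin_tZ (h : K) x :
  gauss_manin_t (h *: x) = u2du h *: x + h *: gauss_manin_t x.
Proof.
have [a ->] := gauss_manin_classE x.
rewrite (gauss_manin_tE a) (gauss_manin_classZ h a) gauss_manin_tE.
rewrite (gauss_manin_classZ (u2du h) a) (gauss_manin_classZ h) -gauss_manin_classD.
congr gauss_manin_class; rewrite /form_t u2duM.
have -> : u2du (gauss_manin_scal h) = gauss_manin_scal (u2du h).
  by rewrite /gauss_manin_scal laurent_map_u2du.
ring.
Qed.

Fact gauss_manin_dsD j : {morph gauss_manin_ds j : x y / x + y}.
Proof.
move=> x y; have [a ->] := gauss_manin_classE x; have [b ->] := gauss_manin_classE y.
rewrite -gauss_manin_classD !gauss_manin_dsE -gauss_manin_classD.
congr gauss_manin_class; rewrite /form_ds raddfD /=; ring.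
Qed.

Fact gauss_manin_dsZ j (h : K) x :
  gauss_manin_ds j (h *: x) = lau_ds j h *: x + h *: gauss_manin_ds j x.
Proof.
have [a ->] := gauss_manin_classE x.
rewrite (gauss_manin_dsE j a) (gauss_manin_classZ h a) gauss_manin_dsE.
rewrite (gauss_manin_classZ (lau_ds j h) a) (gauss_manin_classZ h).
rewrite -gauss_manin_classD.
congr gauss_manin_class; rewrite /form_ds lau_derM.
have -> : laurent_map (@mps_der m O j) (gauss_manin_scal h) =
          gauss_manin_scal (lau_ds j h).
  by apply: laurentP => k; apply: mps_map_der.
ring.
Qed.

Fact gauss_manin_t_ds j x :
  gauss_manin_t (gauss_manin_ds j x) = gauss_manin_ds j (gauss_manin_t x).
Proof.
have [a ->] := gauss_manin_classE x.
rewrite gauss_manin_dsE !gauss_manin_tE gauss_manin_dsE.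
congr gauss_manin_class; rewrite /form_t /form_ds raddfB /=.
have dF := der_unfolding j; move: unfolding dF => FF dF.
rewrite raddfD /= lau_derM !u2duM !u2duC laurent_mapC /= dF laurent_map_u2du.
have -> : u2du (upow S (-1)) = - 1 by rewrite u2du_upow addNr upow0 mulrNz.
ring.
Qed.

Fact gauss_manin_ds_comm i j x :
  gauss_manin_ds i (gauss_manin_ds j x) = gauss_manin_ds j (gauss_manin_ds i x).
Proof.
have [a ->] := gauss_manin_classE x; rewrite !gauss_manin_dsE.
congr gauss_manin_class; rewrite /form_ds !raddfB /= !lau_derM.
rewrite !laurent_mapC /= !mps_derC !lau_der_upow.
have -> : laurent_map (@mps_der m O i) (laurent_map (@mps_der m O j) a) =
          laurent_map (@mps_der m O j) (laurent_map (@mps_der m O i) a).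
  by apply: laurentP => k; apply: mps_der_comm.
ring.
Qed.

Definition gauss_manin : gm_module C m := @GMModule C m gauss_manin_space
  gauss_manin_t gauss_manin_ds gauss_manin_tD gauss_manin_tZ
  gauss_manin_dsD gauss_manin_dsZ gauss_manin_t_ds gauss_manin_ds_comm.



Lemma upow_nat (A : comNzRingType) (k : nat) : upow A k%:Z = laurent_of (pserU ^+ k).
Proof.
elim: k => [|k IHk]; first by rewrite upow0 rmorph1.
by rewrite exprS rmorphM /= laurent_ofU -IHk -upowD; rewrite (_ : 1 + k%:Z = k.+1%:Z) //; lia.
Qed.

Lemma gauss_manin_d_of eta :
  gauss_manin_d (fun i => laurent_of (eta i)) = laurent_of (brieskorn_d eta).
Proof.
rewrite /gauss_manin_d /brieskorn_d; move: unfolding => FF.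
rewrite rmorph_sum; apply: eq_bigr => i _.
by rewrite rmorphB !rmorphM /= laurent_ofU laurent_of_map laurent_ofC.
Qed.

Lemma gauss_manin_d_upow d eta :
  upow S d * gauss_manin_d eta = gauss_manin_d (fun i => upow S d * eta i).
Proof.
rewrite /gauss_manin_d mulr_sumr; apply: eq_bigr => i _.
rewrite lau_ddxM lau_ddx_upow; ring.
Qed.

Lemma clear_poles (eta : 'I_n.+1 -> laurent S) :
  exists N eta', forall i, upow S N%:Z * eta i = laurent_of (eta' i).
Proof.
have /choice[kb kbE] i :
    exists kb : nat * pser S, eta i = upow S (- kb.1%:Z) * laurent_of kb.2.
  by have [k [b ->]] := laurent_of_shift (eta i); exists (k, b).
pose N := (\max_i (kb i).1)%N.
exists N, (fun i => pserU ^+ (N - (kb i).1) * (kb i).2) => i.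
have le_kN : ((kb i).1 <= N)%N by exact: leq_bigmax.
rewrite rmorphM /= -upow_nat kbE mulrA -upowD.
by rewrite (_ : N%:Z + - (kb i).1%:Z = (N - (kb i).1)%N%:Z) //; lia.
Qed.

Lemma gauss_manin_rel_clear (a a' : nat) (b b' : pser S) :
    upow S (- a%:Z) * laurent_of b - upow S (- a'%:Z) * laurent_of b'
      \in gauss_manin_rel ->
  exists N, pserU ^+ (N + a') * b - pserU ^+ (N + a) * b' \in brieskorn_rel.
Proof.
case/gauss_manin_relP=> eta E; have [N [eta' etaE]] := clear_poles eta.
exists N; apply/brieskorn_relP; exists (fun i => pserU ^+ (a + a') * eta' i).
apply: laurent_of_inj; rewrite -gauss_manin_d_of rmorphB !rmorphM /= -!upow_nat.
have -> : gauss_manin_d (fun i => laurent_of (pserU ^+ (a + a') * eta' i)) =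
    upow S (N + a + a')%N%:Z * gauss_manin_d eta.
  rewrite gauss_manin_d_upow; congr gauss_manin_d; apply: funext => i.
  rewrite rmorphM /= -upow_nat -etaE mulrA -upowD.
  by rewrite (_ : (N + a + a')%N%:Z = (a + a')%N%:Z + N%:Z) //; lia.
rewrite -E mulrBr !mulrA -!upowD.
rewrite (_ : (N + a + a')%N%:Z + - a%:Z = (N + a')%N%:Z); last by lia.
by rewrite (_ : (N + a + a')%N%:Z + - a'%:Z = (N + a)%N%:Z) //; lia.
Qed.

Definition gauss_manin_of (x : brieskorn_lattice) : gauss_manin_space :=
  gauss_manin_class (laurent_of (repr x)).

Lemma gauss_manin_ofE w :
  gauss_manin_of (brieskorn_class w) = gauss_manin_class (laurent_of w).
Proof.
apply/gauss_manin_classP; rewrite -raddfB.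
have /brieskorn_relP[eta ->] := quot_repr brieskorn_rel w.
by apply/gauss_manin_relP; eexists; rewrite /= -gauss_manin_d_of.
Qed.

Lemma gauss_manin_scal_upow d : gauss_manin_scal (upow _ d) = upow S d.
Proof. exact: laurent_map_upow. Qed.

Lemma gauss_manin_scal_of a :
  gauss_manin_scal (laurent_of a) = laurent_of (brieskorn_scal a).
Proof. by rewrite /gauss_manin_scal -laurent_of_map. Qed.

Lemma gauss_manin_rep (x : gauss_manin_space) : exists (k : nat) (b : pser S),
  x = upow _ (- k%:Z) *: gauss_manin_of (brieskorn_class b).
Proof.
have [w ->] := gauss_manin_classE x; have [k [b ->]] := laurent_of_shift w.
by exists k, b; rewrite gauss_manin_ofE gauss_manin_classZ gauss_manin_scal_upow.
Qed.

Theorem gauss_manin_base_change (V : lmodType K) (phi : brieskorn_lattice -> V) :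
    {morph phi : x y / x + y} ->
    (forall a x, phi (a *: x) = laurent_of a *: phi x) ->
  exists! psi : gauss_manin_space -> V,
    linear psi /\ forall x, psi (gauss_manin_of x) = phi x.
Proof.
move=> phiD phiZ.
have phiU k b : phi (brieskorn_class (pserU ^+ k * b)) =
    upow _ k%:Z *: phi (brieskorn_class b).
  rewrite upow_nat -phiZ brieskorn_classZ rmorphXn /=.
  rewrite (_ : brieskorn_scal pserU = pserU) //.
  by apply: pserP => j; apply: rmorph_nat.
pose rep k b := upow S (- k%:Z) * laurent_of b.
have repE (k : nat) b : upow _ (- k%:Z) *: gauss_manin_of (brieskorn_class b) =
    gauss_manin_class (rep k b).
  by rewrite gauss_manin_ofE gauss_manin_classZ gauss_manin_scal_upow.
have /choice[kb kbE] x : exists kb : nat * pser S, x = gauss_manin_class (rep kb.1 kb.2).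
  by have [k [b ->]] := gauss_manin_rep x; exists (k, b).
pose psi x := upow _ (- (kb x).1%:Z) *: phi (brieskorn_class (kb x).2).
have psiE (k : nat) b :
    psi (gauss_manin_class (rep k b)) = upow _ (- k%:Z) *: phi (brieskorn_class b).
  rewrite /psi; case: (kb _) (kbE (gauss_manin_class (rep k b))) => l c /=.
  move/gauss_manin_classP/gauss_manin_rel_clear => [N /brieskorn_classP/(congr1 phi)].
  rewrite !phiU => /(congr1 (fun v => upow _ (- (N + l + k)%N%:Z) *: v)).
  rewrite !scalerA -!upowD => E; apply/esym.
  rewrite (_ : - k%:Z = - (N + l + k)%N%:Z + (N + l)%N%:Z); last by lia.
  by rewrite E (_ : - (N + l + k)%N%:Z + (N + k)%N%:Z = - l%:Z) //; lia.
exists psi; split; [split|].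
- move=> h x y; have [[k b] /= ->] : exists kb, x = gauss_manin_class (rep kb.1 kb.2).
    by exists (kb x).
  have [[l c] /= ->] : exists kb, y = gauss_manin_class (rep kb.1 kb.2).
    by exists (kb y).
  have [d [h' ->]] := laurent_of_shift h.
  rewrite gauss_manin_classZ -gauss_manin_classD.
  have -> : gauss_manin_scal (upow _ (- d%:Z) * laurent_of h') * rep k b + rep l c =
      rep (d + k + l)%N (pserU ^+ l * (brieskorn_scal h' * b) + pserU ^+ (d + k) * c).
    rewrite /rep rmorphM /= gauss_manin_scal_upow gauss_manin_scal_of.
    rewrite (rmorphD (@laurent_of S)) !rmorphM /= -!upow_nat mulrDr !mulrA.
    rewrite -!upowD [upow S (- d%:Z) * _ * upow S _]mulrAC -upowD.
    rewrite (_ : - (d + k + l)%N%:Z + l%:Z = - d%:Z + - k%:Z); last by lia.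
    by rewrite (_ : - (d + k + l)%N%:Z + (d + k)%N%:Z = - l%:Z) //; lia.
  rewrite !psiE brieskorn_classD phiD !phiU -brieskorn_classZ phiZ scalerDr !scalerA.
  rewrite -!upowD [upow _ (- d%:Z) * _ * upow _ _]mulrAC -upowD.
  rewrite (_ : - (d + k + l)%N%:Z + l%:Z = - d%:Z + - k%:Z); last by lia.
  by rewrite (_ : - (d + k + l)%N%:Z + (d + k)%N%:Z = - l%:Z) //; lia.
- move=> x; have [b ->] := brieskorn_classE x.
  rewrite gauss_manin_ofE (_ : laurent_of b = rep 0%N b); last first.
    by rewrite /rep oppr0 upow0 mul1r.
  by rewrite psiE oppr0 upow0 scale1r.
move=> psi' [psi'L psi'E]; apply: funext => x.
have [k [b ->]] := gauss_manin_rep x; rewrite {1}repE psiE.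
have psi'D y z : psi' (y + z) = psi' y + psi' z.
  by have := psi'L 1 y z; rewrite !scale1r.
have psi'0 : psi' 0 = 0 by apply: (addIr (psi' 0)); rewrite -psi'D !addr0 add0r.
by rewrite -[_ *: gauss_manin_of _]addr0 psi'L psi'0 addr0 psi'E.
Qed.

End GaussManin.

Definition in_ideal (B : comNzRingType) k (d : 'I_k -> B) (a : B) : Prop :=
  exists b : 'I_k -> B, a = \sum_(i < k) b i * d i.

(* The classes of the e_i form a basis of B / I over K, acting through iota. *)
Definition quot_basis (K B : comNzRingType) (iota : K -> B) (I : B -> Prop)
    (r : nat) (e : 'I_r -> B) : Prop :=
  forall a : B, exists! c : 'rV[K]_r, I (a - \sum_(i < r) iota (c 0 i) * e i).

Definition squarefree (B : comNzRingType) (a : B) : Prop :=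
  forall h : B, (exists q, a = q * h ^+ 2) -> exists h', h * h' = 1.

Section Singularity.
Variables (R : realType) (p : nat).
Local Notation C := R[i].
Implicit Type f : conv R p.

(* sum_k f_k z^k = v, summed by increasing total degree *)
Definition conv_value f (z : 'I_p -> C) (v : C) : Prop :=
  forall eps : C, 0 < eps -> exists N, forall d, (N <= d)%N ->
    `|\sum_(k : 'X_{1..p < d}) f k * \prod_(i < p) z i ^+ k i - v| < eps.

Definition isolated_singularity f : Prop :=
  (forall i, conv_der i f 0%MM = 0) /\
  exists2 rho : C, 0 < rho & forall z : 'I_p -> C, (forall i, `|z i| < rho) ->
    (forall i, conv_value (conv_der i f) z 0) -> forall i, z i = 0.

Definition milnor_number f (r : nat) : Prop :=
  exists e : 'I_r -> conv R p,
    quot_basis (@convC R p) (in_ideal (fun i => conv_der i f)) e.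

End Singularity.

Section Discriminant.
Variables (R : realType) (n m : nat).
Variables (f : conv R n.+1) (g : 'I_m -> conv R n.+1).

(* C{x} and C{s} inside C{x, s}; the x are the first n+1 variables *)
Definition incl_x : conv R n.+1 -> conv R (n.+1 + m) :=
  conv_incl (@lshift_inj n.+1 m).
Definition incl_s : conv R m -> conv R (n.+1 + m) :=
  conv_incl (@rshift_inj n.+1 m).

Definition unfolding_germ : conv R (n.+1 + m) :=
  incl_x f + \sum_(j < m) incl_x (g j) * convX R (rshift n.+1 j).

Definition critical_ideal : conv R (n.+1 + m) -> Prop :=
  in_ideal (fun i : 'I_n.+1 => conv_der (lshift m i) unfolding_germ).

(* P is the characteristic polynomial of the multiplication by F on           *)
(* C{x, s} / (dF/dx_0, ..., dF/dx_n), free of rank r over C{s}.               *)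
Definition discriminant_poly (r : nat) (P : {poly conv R m}) : Prop :=
  exists (e : 'I_r -> conv R (n.+1 + m)) (M : 'M[conv R m]_r),
    [/\ quot_basis incl_s critical_ideal e,
        forall j, critical_ideal
          (unfolding_germ * e j - \sum_(i < r) incl_s (M i j) * e i)
      & P = char_poly M].

(* a polynomial in t over C{s} as an element of C{t, s}; t is variable 0 *)
Definition germ_of_poly (P : {poly conv R m}) : conv R m.+1 :=
  (map_poly (conv_incl (@lift_inj m.+1 ord0)) P).[convX R ord0].

Definition discriminant_reduced (r : nat) : Prop :=
  exists2 P, discriminant_poly r P & squarefree (germ_of_poly P).

End Discriminant.

(* Main.v *)
Require Import Defs.
From HB Require Import structures.
From mathcomp Require Import all_boot all_order all_algebra.
From mathcomp Require Import fieldext separable.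
From mathcomp Require Import complex mpoly.
From mathcomp Require Import boolp reals.
From mathcomp Require Import zify ring.
Set Implicit Arguments.
Unset Strict Implicit.
Unset Printing Implicit Defensive.

Import Order.TTheory GRing.Theory Num.Theory.
Local Open Scope ring_scope.

(** Let phi be an endomorphism of the Gauss-Manin system, P its matrix in a
    basis of the Brieskorn lattice over C[[s]][[u]], and T the matrix of t.
    Modulo u the lattice is the Jacobian ring of F over C[[s]], on which t acts
    as the multiplication T_0 by F.

    Since D is reduced, T_0 has distinct eigenvalues over an extension of the
    fraction field of C[[s]] (reduced_simple_spectrum), so its commutant is
    commutative (simple_spectrum_comm), and a matrix X of the commutant is zero
    as soon as all tr X^i with i > 0 are (simple_spectrum_trace0).  The lowest
    coefficient P_v of P commutes with T_0; the next order in u of the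
    commutation with t writes v P_v as a sum of commutators that remain
    traceless after multiplication by powers of P_v.  Hence v = 0
    (lowest_zero): phi preserves the lattice, and it vanishes when P_0 does.
    This is where coefficients in C[[s]]((u)) rather than in C((u))[[s]]
    matter.

    As P_0 commutes with T_0 it commutes with all multiplications, so it is
    the multiplication by an element eps of the Jacobian ring.  The Jacobian
    ring is local: if c is the value of eps at the origin, X = P_0 - c is
    nilpotent at s = 0.  Commutation with the s-derivatives gives X a Lax
    equation, so the traces of its powers are constant in s
    (lax_trace_powers), hence zero.  So X = 0 and phi = c
    (endomorphism_scalar).

    Two facts about singularities support this.  The Brieskorn lattice is free
    of rank r (lattice_generated, lattice_free): the partial derivatives of f
    generate an ideal containing powers of all n + 1 variables, so their Koszul
    complex is acyclic (koszul_relation), and division with remainder by them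
    extends to series in s and u.  And C{s} is integrally closed: it is
    completely integrally closed, by division with respect to a monomial
    order (mps_dvd_of_dvd_powers), and formal quotients of convergent series
    converge (convergent_quotient).  So a multiple eigenvalue of T_0 produces
    a monic square factor of the characteristic polynomial over C{s}, which
    cannot be a unit in C{t, s} as the polynomial is a power of t at s = 0
    (squarefree_uniq_roots). *)

(** * Products and leading monomials of power series *)

Section Lowers.
Variable p : nat.
Implicit Types m k : 'X_{1..p}.

Definition lowers m : seq 'X_{1..p} :=

  map (@bmnm p (mdeg m).+1)
    (enum [pred k : 'X_{1..p < (mdeg m).+1} | (bmnm k <= m)%MM]).

Lemma mdeg_lepm k m : (k <= m)%MM -> (mdeg k <= mdeg m)%N.
Proof. by move=> km; rewrite -(submK km) mdegD leq_addl. Qed.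

Lemma mem_lowers m k : (k \in lowers m) = (k <= m)%MM.
Proof.
apply/mapP/idP => [[k']|km].
  by rewrite mem_enum => k'm ->.
have kd : (mdeg k < (mdeg m).+1)%N by rewrite ltnS mdeg_lepm.
by exists (BMultinom kd); rewrite // mem_enum.
Qed.

Lemma lowers_uniq m : uniq (lowers m).
Proof. by rewrite map_inj_uniq ?enum_uniq //; apply: val_inj. Qed.

Lemma mdeg_subm k m : (k <= m)%MM -> mdeg m = (mdeg k + mdeg (m - k))%N.
Proof. by move=> km; rewrite -{1}(submK km) mdegD addnC. Qed.

End Lowers.

Section MpsMul.
Variables (p : nat) (A : comNzRingType).
Implicit Types (a b c : mps p A) (m k : 'X_{1..p}).

Lemma mps_mulE_lowers a b m :
  (a * b) m = \sum_(k <- lowers m) a k * b (m - k)%MM.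
Proof.
pose T := @mtrunc p A (mdeg m).+1.
rewrite [LHS](@mps_mulE _ _ a b m (T a) (T b)); last 2 first.
- by move=> m' le_m; rewrite mcoeff_mtrunc.
- by move=> m' le_m; rewrite mcoeff_mtrunc.
rewrite [LHS](mcoeff_poly_mul_lin _ _ (ltnSn (mdeg m))).
rewrite big_map big_enum /=; apply: eq_big => [k|k km]; first by rewrite inE.
by rewrite !mcoeff_mtrunc ?bmdeg // ltnS mdeg_lepm // lem_subr.
Qed.

Lemma mps_sumE (I : Type) (r : seq I) (P : pred I) (E : I -> mps p A) m :
  (\sum_(i <- r | P i) E i) m = \sum_(i <- r | P i) E i m.
Proof.
by elim/big_rec2: _ => [|i x y _ <-]; [exact: mps0E | exact: mpsDE].
Qed.

Lemma mps_mul_lead a b m k :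
    (forall l, (l < m)%O -> a l = 0) -> (forall l, (l < k)%O -> b l = 0) ->
  (a * b) (m + k)%MM = a m * b k.
Proof.
move=> am bk; rewrite mps_mulE_lowers (bigD1_seq m) ?lowers_uniq //=; last first.
  by rewrite mem_lowers lem_addr.
rewrite addmC addmK big_seq_cond big1 ?addr0 // => l.
rewrite mem_lowers => /andP[lm lneqm].
case: (ltP l m) => [/am -> | ml]; first by rewrite mul0r.
have {}ml : (m < l)%O by rewrite lt_neqAle ml andbT eq_sym.
rewrite bk ?mulr0 // ltNge; apply/negP => kl.
have := ltmc_le_add ml kl; rewrite [(l + _)%MM]addmC submK //.
by rewrite [(m + k)%MM]addmC ltxx.
Qed.

Lemma mps_mul_lead0 a b m k :
    (forall l, (l < m)%O -> a l = 0) -> (forall l, (l < k)%O -> b l = 0) ->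
  forall l, (l < (m + k)%MM)%O -> (a * b) l = 0.
Proof.
move=> am bk l lmk; rewrite mps_mulE_lowers big_seq big1 // => j.
rewrite mem_lowers => jl; case: (ltP j m) => [/am -> | mj]; first by rewrite mul0r.
rewrite bk ?mulr0 // ltNge; apply/negP => kl.
have := lem_add mj kl; rewrite [(j + _)%MM]addmC submK // => /le_lt_trans/(_ lmk).
by rewrite ltxx.
Qed.

Definition lead_at a m := a m != 0 /\ forall l, (l < m)%O -> a l = 0.

Lemma lead_exists a : a != 0 -> exists m, lead_at a m.
Proof.
move=> a0; apply: contrapT => no; move/eqP: a0; apply; apply: mpsP.
elim/(@ltmwf p) => m IH; rewrite mps0E; apply/eqP/negPn/negP => am.
by apply: no; exists m; split=> // l /IH; rewrite mps0E.
Qed.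

Lemma mps_coef0_is_zmod_morphism : zmod_morphism (fun a => a 0%MM).
Proof. by []. Qed.
Lemma mps_coef0_is_monoid_morphism : monoid_morphism (fun a => a 0%MM).
Proof.
split=> [|a b]; first by rewrite mps1E eqxx.
by rewrite -{1}[0%MM]addm0 mps_mul_lead // => l; rewrite ltNge le0x.
Qed.

End MpsMul.

Section Division.
Variables (p : nat) (F : fieldType).
Implicit Types (a b q : mps p F) (m mu nu : 'X_{1..p}).

(** The quotient is built by recursion on the monomial order: the equation
    for the coefficient at nu + mu involves only the coefficients of q below
    nu. *)
Lemma mps_division a b mu : lead_at b mu ->
  exists q, forall nu, (a - q * b) (nu + mu)%MM = 0.
Proof.
case=> bmu b0.
pose step nu (rec : forall k, (k < nu)%O -> F) : F :=
  (a (nu + mu)%MM - \sum_(k <- lowers (nu + mu))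
     (if pselect (k < nu)%O is left lt then rec k lt else 0)
       * b (nu + mu - k)%MM) / b mu.
pose q := Mps (Fix (@ltom_wf p) (fun=> F) step).
have qE nu : q nu = (a (nu + mu)%MM - \sum_(k <- lowers (nu + mu) | (k < nu)%O)
     q k * b (nu + mu - k)%MM) / b mu.
  rewrite {1}/q /= Fix_eq; last first.
    move=> x f g fg; congr ((_ - _) / _); apply: eq_bigr => k _; congr (_ * _).
    by case: pselect.
  rewrite {1}/step; congr ((_ - _) / _); rewrite [RHS]big_mkcond.
  by apply: eq_bigr => k _; case: pselect => [-> | /negP/negPf ->] //; rewrite mul0r.
exists q => nu; rewrite mpsBE mps_mulE_lowers (bigID (fun k => k < nu)%O) /=.
have -> : \sum_(k <- lowers (nu + mu) | ~~ (k < nu)%O) q k * b (nu + mu - k)%MM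
    = q nu * b mu.
  rewrite big_mkcond /= (bigD1_seq nu) ?lowers_uniq //=; last first.
    by rewrite mem_lowers lem_addr.
  rewrite ltxx addmC addmK [X in _ + X]big_seq_cond [X in _ + X]big1 ?addr0 //.
  move=> k; rewrite mem_lowers => /andP[kle kne].
  case: (ltP k nu) => //= nuk; rewrite b0 ?mulr0 // ltNge; apply/negP => le.
  have lt : (nu < k)%O by rewrite lt_neqAle nuk andbT eq_sym.
  have := ltmc_le_add lt le; rewrite [(k + _)%MM]addmC submK //.
  by rewrite [(mu + nu)%MM]addmC ltxx.
by rewrite qE divfK // opprD addrA subrr.
Qed.

End Division.

Section MpsIdomain.
Variables (p : nat) (F : fieldType).
Implicit Types (a b d q : mps p F) (m mu nu : 'X_{1..p}).

Lemma lead_atM a b m k : lead_at a m -> lead_at b k -> lead_at (a * b) (m + k)%MM.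
Proof.
move=> [am a0] [bk b0]; split; last exact: mps_mul_lead0.
by rewrite mps_mul_lead // mulf_neq0.
Qed.

Lemma lead_atX a m n : lead_at a m -> lead_at (a ^+ n) (m *+ n)%MM.
Proof.
move=> am; elim: n => [|n IHn]; last by rewrite exprS mulmS; apply: lead_atM.
split=> [|l]; first by rewrite mps1E eqxx oner_neq0.
by rewrite ltNge le0x.
Qed.

Lemma lead_at_neq0 a m : lead_at a m -> a != 0.
Proof. by case=> am _; apply: contraNneq am => ->; rewrite mps0E. Qed.

Lemma lead_at_uniq a m k : lead_at a m -> lead_at a k -> m = k.
Proof.
move=> [am a0] [ak a0']; case: (ltgtP m k) => // [/a0' E | /a0 E].
  by rewrite E eqxx in am.
by rewrite E eqxx in ak.
Qed.

Lemma mps_mulf_eq0 a b : a * b = 0 -> (a == 0) || (b == 0).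
Proof.
move=> ab; apply/norP => -[/lead_exists[m am] /lead_exists[k bk]].
by have /lead_at_neq0/eqP := lead_atM am bk.
Qed.

(** C[[s]] is completely integrally closed.  If r is the remainder of a by b,
    then b^n still divides d r^n, so n times the leading exponent of b is
    bounded by that of d plus n times that of r; letting n grow, the leading
    exponent of r is a multiple of the one of b, which a remainder forbids. *)
Lemma mps_dvd_of_dvd_powers a b d : b != 0 -> d != 0 ->
    (forall n, exists q, d * a ^+ n = q * b ^+ n) ->
  exists q, a = q * b.
Proof.
move=> /lead_exists[mu bmu] /lead_exists[de dde] H.
have [q qP] := mps_division a bmu.
exists q; apply/eqP; rewrite -subr_eq0; apply/negP => /negP r0.
have {r0} [rho rrho] := lead_exists r0; set r := a - q * b in qP rrho.
have Hr n : exists x, d * r ^+ n = x * b ^+ n.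
  have [x xP] := choice H.
  rewrite /r exprBn mulr_sumr.
  exists (\sum_(i < n.+1) ((-1) ^+ i * x (n - i)%N * q ^+ i) *+ 'C(n, i)).
  rewrite mulr_suml; apply: eq_bigr => i _.
  rewrite mulrnAr mulrnAl; congr (_ *+ _).
  have -> : b ^+ n = b ^+ (n - i) * b ^+ i by rewrite -exprD subnK // -ltnS.
  transitivity ((-1) ^+ i * (d * a ^+ (n - i)) * (q * b) ^+ i); first by ring.
  by rewrite xP exprMn; ring.
suff murho : (mu <= rho)%MM.
  by case: rrho => + _; rewrite -(submK murho) qP eqxx.
apply/mnm_lepP => i; rewrite leqNgt; apply/negP => lt.
have [x xP] := Hr (de i).+1.
have L := lead_atM dde (lead_atX (de i).+1 rrho).
have x0 : x != 0.
  apply: contraTneq (lead_at_neq0 L) => x0.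
  by rewrite xP x0 mul0r eqxx.
have [xi xxi] := lead_exists x0.
rewrite xP in L; have /mnmP/(_ i) := lead_at_uniq L (lead_atM xxi (lead_atX (de i).+1 bmu)).
rewrite !mnmDE !mulmnE; nia.
Qed.

End MpsIdomain.

(** * Convergence of quotients *)

Section Weights.
Variables (p : nat) (mu : 'X_{1..p}).
Implicit Types k m : 'X_{1..p}.
Let B := (mdeg mu).+1.

(** A linear form on exponents whose minimum on the monomials above mu, for
    the degree-lexicographic order, is attained at mu only: the term
    B ^ p.+1 compares degrees, the digits in base B compare exponents
    lexicographically. *)
Definition weight k : nat :=
  (\sum_(i < p) k i * (B ^ p.+1 + B ^ (p - i.+1)))%N.

Lemma weightD k m : weight (k + m) = (weight k + weight m)%N.
Proof.
by rewrite -big_split; apply: eq_bigr => i _; rewrite mnmDE mulnDl.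
Qed.

Lemma weightE k :
  weight k = (mdeg k * B ^ p.+1 + \sum_(i < p) k i * B ^ (p - i.+1))%N.
Proof.
rewrite mdegE big_distrl -big_split /=; apply: eq_bigr => i _.
by rewrite mulnDr.
Qed.

Lemma mdeg_weight k : (mdeg k <= weight k)%N.
Proof.
by rewrite weightE (leq_trans _ (leq_addr _ _)) // leq_pmulr // expn_gt0.
Qed.

Lemma weight_mdeg k : (weight k <= (B ^ p.+1).*2 * mdeg k)%N.
Proof.
rewrite mdegE mulnC big_distrl /=; apply: leq_sum => i _.
rewrite leq_mul2l -addnn leq_add2l leq_pexp2l ?orbT //; lia.
Qed.

Lemma weight_lt k : (mu < k)%O -> (weight mu < weight k)%N.
Proof.
move=> lt; rewrite !weightE.
have := lemc_mdeg (ltW lt); rewrite leq_eqVlt => /orP[/eqP deg|deg]; last first.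
  have : (\sum_(i < p) mu i * B ^ (p - i.+1) <= mdeg mu * B ^ p)%N.
    rewrite mdegE big_distrl /=; apply: leq_sum => i _.
    by rewrite leq_mul2l leq_pexp2l ?orbT ?leq_subr.
  have : (0 < B ^ p)%N by rewrite expn_gt0.
  move: (\sum_(i < p) mu i * _)%N (\sum_(i < p) k i * _)%N => X Y.
  rewrite expnS; move: (B ^ p)%N => Z; rewrite /B; nia.
rewrite -deg ltn_add2l; case/(ltmcP deg): lt => i eqi lti.
pose P := [pred j : 'I_p | (j < i)%N].
rewrite (bigID P) [ltnRHS](bigID P) /= -addnS.
apply: leq_add; first by apply: leq_sum => j /eqi ->.
rewrite (bigD1 i) ?ltnn // [ltnRHS](bigD1 i) ?ltnn //=.
apply: leq_trans (leq_addr _ _).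
have : (B * (\sum_(j < p | ~~ (j < i)%N && (j != i)) mu j * B ^ (p - j.+1))
    <= mdeg mu * B ^ (p - i.+1))%N.
  rewrite mdegE big_distrr big_distrl /=
    [leqRHS](bigID (fun j : 'I_p => ~~ (j < i)%N && (j != i))) /=.
  apply: leq_trans (leq_addr _ _); apply: leq_sum => j /andP[ji jni].
  rewrite mulnCA leq_mul2l -expnS leq_pexp2l ?orbT //.
  have : (j : nat) != i by [].
  by have := ltn_ord j; lia.
move: (\sum_(j < p | _) _)%N => X.
have : (0 < B ^ (p - i.+1))%N by rewrite expn_gt0.
move: (B ^ _)%N => Z; rewrite /B; nia.
Qed.

End Weights.

Section ConvergentQuotient.
Variables (R : realType) (p : nat).
Local Notation C := R[i].
Implicit Types (a b q : mps p C) (k l mu nu : 'X_{1..p}).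

(** Shrinking the radius r by the factor t, with exponents measured by the
    weight, gains a factor t^d on the terms of weight at least d. *)
Lemma normal_weighted mu a (r t M : C) : 0 < r -> r <= 1 -> normal_at a r M ->
    0 <= t -> t <= 1 -> forall d (s : seq 'X_{1..p}), uniq s ->
    (forall k, k \in s -> a k != 0 -> (d <= weight mu k)%N) ->
  \sum_(k <- s) `|a k| * (r * t) ^+ weight mu k <= t ^+ d * M.
Proof.
move=> r0 r1 aM t0 t1 d s us sd.
apply: le_trans (ler_wpM2l (exprn_ge0 d t0) (aM s us)).
rewrite mulr_sumr big_seq [leRHS]big_seq; apply: ler_sum => k ks.
rewrite mulrCA; case: (eqVneq (a k) 0) => [->|ak]; first by rewrite normr0 !mul0r.
rewrite ler_wpM2l // exprMn mulrC ler_pM ?exprn_ge0 ?(ltW r0) //.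
  by rewrite ler_wiXn2l ?sd.
by rewrite ler_wiXn2l ?(ltW r0) ?mdeg_weight.
Qed.

(** Give x_i the radius e^(lambda_i), with lambda the weights adapted to the
    leading exponent mu of b.  For e small the norm of b minus its leading term
    is at most half of the norm of that term; comparing coefficients of
    q b = a then bounds the partial norms of q by twice the norm of a over that
    of the leading term. *)
Lemma convergent_quotient a b q :
    a \in @convergent R p -> b \in @convergent R p -> b != 0 -> q * b = a ->
  q \in @convergent R p.
Proof.
move=> ca cb /lead_exists[mu [bmu b0]] qb.
have [r' r'0 [Ma [Mb [aM' bM']]]] := convergent2 ca cb.
pose r := r' / (1 + r').
have r'10 : 0 < 1 + r' by rewrite addr_gt0.
have r0 : 0 < r by rewrite divr_gt0.
have r1 : r <= 1 by rewrite ler_pdivrMr // mul1r lerDr.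
have rr' : r <= r' by rewrite ler_pdivrMr // ler_peMr ?(ltW r'0) // lerDl ltW.
have aM := normal_atW (ltW r0) rr' aM'; have bM := normal_atW (ltW r0) rr' bM'.
pose w := weight mu; pose N := `|b mu| * r ^+ w mu.
have N0 : 0 < N by rewrite mulr_gt0 ?normr_gt0 ?exprn_gt0.
have NMb : N <= Mb.
  have := @normal_weighted mu b r 1 Mb r0 r1 bM ler01 (lexx _) 0 [:: mu] isT.
  rewrite big_seq1 mulr1 expr0 mul1r; exact.
have Mb0 : 0 < Mb by apply: lt_le_trans NMb.
pose t := N / (2 * Mb).
have t0 : 0 < t by rewrite divr_gt0 // mulr_gt0 ?ltr0n.
have t1 : t <= 1.
  rewrite ler_pdivrMr ?mulr_gt0 ?ltr0n // mul1r (le_trans NMb) //.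
  by rewrite ler_peMl ?(ltW Mb0) // ler1n.
pose e := r * t; have e0 : 0 < e by rewrite mulr_gt0.
have e1 : e <= 1 by rewrite mulr_ile1 // ltW.
pose H := `|b mu| * e ^+ w mu.
have H0 : 0 < H by rewrite mulr_gt0 ?normr_gt0 ?exprn_gt0.
have bhalf s : uniq s -> mu \notin s ->
    \sum_(k <- s) `|b k| * e ^+ w k <= H / 2.
  move=> us mus; have -> : H / 2 = t ^+ (w mu).+1 * Mb.
    have tMb : t * Mb = N / 2 by rewrite /t; field; rewrite gt_eqF.
    by rewrite exprSr -mulrA tMb /H /N exprMn; field.
  apply: normal_weighted => //; try exact: ltW.
  move=> k ks bk; apply: weight_lt; rewrite lt_neqAle.
  rewrite (contraNneq _ mus) => [/=|->] //.
  by rewrite leNgt; apply: contra bk => /b0 ->.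
have abnd s : uniq s -> \sum_(k <- s) `|a k| * e ^+ w k <= Ma.
  by move=> us; rewrite -[Ma]mul1r -(expr0 t); apply: normal_weighted => //; exact: ltW.
pose X k := `|q k| * e ^+ w k; pose Y k := `|b k| * e ^+ w k.
have X0 k : 0 <= X k by rewrite mulr_ge0 // exprn_ge0 // ltW.
have Y0 k : 0 <= Y k by rewrite mulr_ge0 // exprn_ge0 // ltW.
(* sW W lists the finitely many monomials of weight at most W. *)
have [sW usW msW] : exists2 sW : nat -> seq 'X_{1..p}, (forall W, uniq (sW W))
    & forall W k, (k \in sW W) = (w k <= W)%N.
  exists (fun W => filter (fun k => (w k <= W)%N)
    (map (@bmnm p W.+1) (enum [pred k : 'X_{1..p < W.+1} | true]))) => W.
    by rewrite filter_uniq // map_inj_uniq ?enum_uniq //; apply: val_inj.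
  move=> k; rewrite mem_filter; case: leqP => //= wk.
  have dk : (mdeg k < W.+1)%N by rewrite ltnS (leq_trans (mdeg_weight mu k)).
  by apply/mapP; exists (BMultinom dk); rewrite ?mem_enum.
(* The coefficient of nu + mu in q b = a, solved for q nu.  A product q_k b_l
   on the right-hand side has l > mu, so k has smaller weight than nu. *)
have key W nu : nu \in sW W -> H * X nu <=
    `|a (nu + mu)%MM| * e ^+ w (nu + mu)%MM +
    \sum_(k <- sW W | (k <= nu + mu)%MM && (k != nu)) X k * Y (nu + mu - k)%MM.
  rewrite msW => wnu.
  have -> : H * X nu = `|q nu * b mu| * e ^+ w (nu + mu)%MM.
    by rewrite /H /X /w weightD exprD normrM; ring.
  have qE : q nu * b mu = a (nu + mu)%MM -
      \sum_(k <- lowers (nu + mu) | k != nu) q k * b (nu + mu - k)%MM.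
    rewrite -qb mps_mulE_lowers (bigD1_seq nu) ?lowers_uniq ?mem_lowers ?lem_addr //=.
    by rewrite [(nu + mu)%MM]addmC !addmK addrK.
  rewrite qE; apply: le_trans (ler_wpM2r _ (ler_normB _ _)) _.
    by rewrite exprn_ge0 // ltW.
  rewrite mulrDl lerD2l.
  apply: le_trans (ler_wpM2r _ (ler_norm_sum _ _ _)) _.
    by rewrite exprn_ge0 // ltW.
  rewrite mulr_suml.
  rewrite [leLHS](bigID (fun k => b (nu + mu - k)%MM == 0)) /= big1 ?add0r; last first.
    by move=> k /andP[_ /eqP ->]; rewrite mulr0 normr0 mul0r.
  rewrite -big_filter -[leRHS]big_filter.
  have tE k : (k <= nu + mu)%MM -> `|q k * b (nu + mu - k)%MM| * e ^+ w (nu + mu)%MM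
      = X k * Y (nu + mu - k)%MM.
    by move=> kle; rewrite /X /Y normrM -{2}(submK kle) /w weightD exprD; ring.
  set s1 := [seq _ <- lowers _ | _]; set s2 := [seq _ <- sW W | _].
  have s12 : {subset s1 <= s2}.
    move=> k; rewrite mem_filter mem_lowers => /andP[/andP[kn bk] kle].
    rewrite mem_filter kle kn msW (leq_trans _ wnu) //.
    have lt : (mu < (nu + mu - k)%MM)%O.
      rewrite lt_neqAle; apply/andP; split; last first.
        by rewrite leNgt; apply: contra bk => /b0 ->.
      apply: contra kn => /eqP E; have := submK kle; rewrite -E addmC => /eqP.
      by rewrite eqm_add2r.
    have := weightD mu (nu + mu - k)%MM k; rewrite submK // weightD => D.
    rewrite /w -(leq_add2r (weight mu mu)) D addnC leq_add2r.
    exact: ltnW (weight_lt lt).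
  have us1 : uniq s1 by apply: filter_uniq; exact: lowers_uniq.
  have us2 : uniq s2 by apply: filter_uniq.
  have -> : \sum_(k <- s1) `|q k * b (nu + mu - k)%MM| * e ^+ w (nu + mu)%MM =
      \sum_(k <- s1) X k * Y (nu + mu - k)%MM.
    rewrite big_seq [RHS]big_seq; apply: eq_bigr => k.
    by rewrite mem_filter mem_lowers => /andP[_ /tE].
  rewrite [leRHS](bigID (mem s1)) /= -[leLHS]addr0 lerD //; last first.
    by apply: sumr_ge0 => k _; rewrite mulr_ge0.
  rewrite -[X in _ <= X]big_filter le_eqVlt
    (perm_big _ (_ : perm_eq _ [seq k <- s2 | k \in s1])) ?eqxx //.
  apply: uniq_perm; [exact: us1 | exact: filter_uniq | move=> k].
  by rewrite [in RHS]mem_filter; case: (boolP (k \in s1)) => // /s12 ->.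
have bnd W : \sum_(k <- sW W) X k <= 2 * Ma / H.
  rewrite ler_pdivlMr // mulrC.
  have : H * (\sum_(k <- sW W) X k) <= Ma + H / 2 * \sum_(k <- sW W) X k.
    rewrite mulr_sumr.
    apply: (@le_trans _ _ (\sum_(nu <- sW W) (`|a (nu + mu)%MM| * e ^+ w (nu + mu)%MM +
      \sum_(k <- sW W | (k <= nu + mu)%MM && (k != nu)) X k * Y (nu + mu - k)%MM))).
      by rewrite big_seq [leRHS]big_seq; apply: ler_sum => nu /key.
    rewrite big_split /= lerD //.
      have /abnd : uniq [seq (nu + mu)%MM | nu <- sW W].
        by rewrite map_inj_uniq //; apply: addIm.
      by rewrite big_map.
    under eq_bigr do rewrite big_mkcond.
    rewrite exchange_big /= mulr_sumr; apply: ler_sum => k _.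
    rewrite -big_mkcond /= -mulr_sumr mulrC ler_wpM2r //.
    have /bhalf : uniq [seq (nu + mu - k)%MM | nu <- sW W & (k <= nu + mu)%MM && (k != nu)].
      rewrite map_inj_in_uniq ?filter_uniq // => x y.
      rewrite mem_filter => /andP[/andP[kx _] _].
      rewrite mem_filter => /andP[/andP[ky _] _] E.
      by apply: (@addIm _ mu); rewrite -(submK kx) E submK.
    rewrite big_map big_filter; apply.
    apply/mapP => -[x]; rewrite mem_filter => /andP[/andP[kx kn] _] E.
    move: kn; have := submK kx; rewrite -E addmC => /eqP.
    by rewrite eqm_add2r => ->.
  set Z := \sum_(k <- _) _ => le.
  have -> : H * Z = 2 * (H * Z - H / 2 * Z) by field.
  by rewrite ler_wpM2l ?ler0n // lerBlDr.
pose La := (((mdeg mu).+1 ^ p.+1).*2)%N.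
apply/asboolP; exists (e ^+ La); first by rewrite exprn_gt0.
exists (2 * Ma / H) => s us.
pose W := (\max_(k <- s) w k)%N.
apply: le_trans (bnd W).
have sub : {subset s <= sW W} by move=> k ks; rewrite msW /W (big_rem k) //= leq_maxl.
rewrite [leRHS](bigID (mem s)) /= -[leLHS]addr0 lerD ?sumr_ge0 //.
rewrite -[leRHS]big_filter.
rewrite (perm_big [seq k <- sW W | k \in s]); last first.
  apply: uniq_perm; rewrite ?filter_uniq // => k.
  by rewrite mem_filter; case: (boolP (k \in s)) => // /sub ->.
apply: ler_sum => k _; rewrite ler_wpM2l // -exprM ler_wiXn2l ?(ltW e0) //.
exact: weight_mdeg.
Qed.

End ConvergentQuotient.

(** * Rings of power series *)

Section ClassicalUnits.
Variable T : comNzRingType.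
Implicit Types x y : T.

(** Invertibility is decided classically, which makes the rings of power series
    integral domains of the algebraic hierarchy. *)
Definition cunit : pred T := fun x => `[< exists y, y * x = 1 >].

Definition cinv x : T :=
  if pselect (exists y, y * x = 1) is left e then projT1 (cid e) else x.

Lemma cmulVr : {in cunit, left_inverse 1 cinv *%R}.
Proof.
by move=> x /asboolP ex; rewrite /cinv; case: pselect => // e; case: cid.
Qed.

Lemma cunitP x y : y * x = 1 -> cunit x.
Proof. by move=> yx; apply/asboolP; exists y. Qed.

Lemma cinv_out : {in [predC cunit], cinv =1 id}.
Proof.
by move=> x; rewrite inE => /asboolPn nex; rewrite /cinv; case: pselect.
Qed.

End ClassicalUnits.

HB.instance Definition _ p (F : fieldType) :=
  GRing.ComNzRing_hasMulInverse.Build (mps p F)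
    (@cmulVr (mps p F)) (@cunitP (mps p F)) (@cinv_out (mps p F)).
HB.instance Definition _ p (F : fieldType) :=
  GRing.ComUnitRing_isIntegral.Build (mps p F) (@mps_mulf_eq0 p F).

Section ConvIdomain.
Variables (R : realType) (p : nat).
Local Notation C := R[i].
Implicit Types a b d q : conv R p.

Lemma conv_quotient a b (q : mps p C) : b != 0 -> q * b = a :> mps p C ->
  exists q' : conv R p, a = q' * b.
Proof.
move=> b0 qb; have cq : q \in @convergent R p.
  exact: convergent_quotient (valP a) (valP b) b0 qb.
by exists (Conv cq); apply: val_inj.
Qed.

Lemma conv_mulf_eq0 a b : a * b = 0 -> (a == 0) || (b == 0).
Proof. by move=> /(congr1 val)/eqP; rewrite /= mulf_eq0. Qed.

(** Complete integral closedness passes from formal to convergent series since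
    formal quotients of convergent series converge. *)
Lemma conv_dvd_of_dvd_powers a b d : b != 0 -> d != 0 ->
    (forall n, exists q, d * a ^+ n = q * b ^+ n) ->
  exists q, a = q * b.
Proof.
move=> b0 d0 H; have [q qP] : exists q : mps p C, val a = q * val b.
  refine (@mps_dvd_of_dvd_powers p C _ _ (val d) b0 d0 _) => n.
  have [q qP] := H n.
  by exists (val q); rewrite -!rmorphXn -!rmorphM -qP.
exact: conv_quotient (esym qP).
Qed.

(** Division by a series with leading exponent 0 leaves no remainder. *)
Lemma conv_inverse a : a 0%MM != 0 -> exists b, b * a = 1.
Proof.
move=> a0; have La : lead_at (val a) 0%MM by split=> // l; rewrite ltNge le0x.
have [q qP] := mps_division 1 La.
have [||b ->] := @conv_quotient 1 a q; last by exists b.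
- by apply: contraNneq a0 => ->; rewrite mps0E.
apply/esym/eqP; rewrite -subr_eq0; apply/eqP/mpsP => m.
by rewrite mps0E -(qP m) addm0.
Qed.

End ConvIdomain.

HB.instance Definition _ (R : realType) p :=
  GRing.ComNzRing_hasMulInverse.Build (conv R p)
    (@cmulVr (conv R p)) (@cunitP (conv R p)) (@cinv_out (conv R p)).
HB.instance Definition _ (R : realType) p :=
  GRing.ComUnitRing_isIntegral.Build (conv R p) (@conv_mulf_eq0 R p).

Definition mps_coef0 p (A : comNzRingType) (a : mps p A) : A := a 0%MM.
HB.instance Definition _ p (A : comNzRingType) := GRing.isZmodMorphism.Build (mps p A) A
  (@mps_coef0 p A) (@mps_coef0_is_zmod_morphism p A).
HB.instance Definition _ p (A : comNzRingType) := GRing.isMonoidMorphism.Build (mps p A) A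
  (@mps_coef0 p A) (@mps_coef0_is_monoid_morphism p A).

Definition conv_coef0 (R : realType) p (a : conv R p) : R[i] := mps_coef0 a.
Lemma conv_coef0_is_zmod_morphism (R : realType) p : zmod_morphism (@conv_coef0 R p).
Proof. by []. Qed.
Lemma conv_coef0_is_monoid_morphism (R : realType) p :
  monoid_morphism (@conv_coef0 R p).
Proof. by split=> [|a b]; [apply: (rmorph1 (@mps_coef0 p _)) | apply: rmorphM]. Qed.
HB.instance Definition _ (R : realType) p := GRing.isZmodMorphism.Build
  (conv R p) R[i] (@conv_coef0 R p) (@conv_coef0_is_zmod_morphism R p).
HB.instance Definition _ (R : realType) p := GRing.isMonoidMorphism.Build
  (conv R p) R[i] (@conv_coef0 R p) (@conv_coef0_is_monoid_morphism R p).

(** * Changes of variables *)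

Section Inclusion.
Variables (R : realType) (p q : nat) (h : 'I_p -> 'I_q) (h_inj : injective h).
Local Notation C := R[i].
Implicit Types (m k : 'X_{1..q}) (l : 'X_{1..p}).

Let supported m := [forall j, (j \in codom h) || (m j == 0%N)].
Let restr m : 'X_{1..p} := [multinom m (h i) | i < p].
Let extend l : 'X_{1..q} :=
  [multinom (if [pick i | h i == j] is Some i then l i else 0%N) | j < q].

Let extendE l i : extend l (h i) = l i.
Proof.
rewrite mnmE; case: pickP => [i' /eqP/h_inj -> //|/(_ i)].
by rewrite eqxx.
Qed.

Let extend_supported l : supported (extend l).
Proof.
apply/forallP => j; rewrite mnmE; case: pickP => [i /eqP <-|]; last by rewrite eqxx orbT.
by rewrite codom_f.
Qed.

Let restr_inj m k : supported m -> supported k -> restr m = restr k -> m = k.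
Proof.
move=> /forallP sm /forallP sk /mnmP E; apply/mnmP => j.
case: (boolP (j \in codom h)) => [/codomP[i ->]|jh].
  by have := E i; rewrite !mnmE.
by have := sm j; have := sk j; rewrite (negPf jh) /= => /eqP -> /eqP ->.
Qed.

Let supported_le m k : supported m -> (k <= m)%MM -> supported k.
Proof.
move=> /forallP sm /mnm_lepP km; apply/forallP => j.
have := sm j; case: (j \in _) => //= /eqP mj.
by rewrite -leqn0 -mj km.
Qed.

Let mps_inclE (a : mps p C) m :
  mps_incl h a m = if supported m then a (restr m) else 0.
Proof. by []. Qed.

Let lowers_restr m : supported m ->
  perm_eq [seq restr k | k <- lowers m] (lowers (restr m)).
Proof.
move=> sm; apply: uniq_perm; rewrite ?lowers_uniq //.
  rewrite map_inj_in_uniq ?lowers_uniq // => k k'.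
  rewrite !mem_lowers => km k'm; apply: restr_inj;
  exact: supported_le sm _.
move=> l; rewrite mem_lowers; apply/mapP/idP => [[k]|lm].
  rewrite mem_lowers => /mnm_lepP km ->.
  by apply/mnm_lepP => i; rewrite !mnmE.
exists (extend l); last by apply/mnmP => i; rewrite mnmE extendE.
rewrite mem_lowers; apply/mnm_lepP => j.
case: (boolP (j \in codom h)) => [/codomP[i ->]|jh].
  by rewrite extendE; have /mnm_lepP/(_ i) := lm; rewrite mnmE.
by have /forallP/(_ j) := extend_supported l; rewrite (negPf jh) => /eqP ->.
Qed.

Lemma mps_incl_is_zmod_morphism : zmod_morphism (mps_incl h : mps p C -> _).
Proof.
by move=> a b; apply: mpsP => m; rewrite mpsBE !mps_inclE; case: ifP; rewrite ?subr0.
Qed.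

Lemma mps_incl_is_monoid_morphism : monoid_morphism (mps_incl h : mps p C -> _).
Proof.
split=> [|a b]; apply: mpsP => m.
  rewrite mps_inclE !mps1E; case: (boolP (supported m)) => sm.
    congr (_%:R); congr nat_of_bool; apply/eqP/eqP => [|->]; last first.
      by apply/mnmP => i; rewrite !mnmE.
    move=> E; apply: restr_inj => //; first by apply/forallP => j; rewrite mnmE eqxx orbT.
    by rewrite E; apply/mnmP => i; rewrite !mnmE.
  case: eqP => // m0; case/negP: sm; rewrite m0.
  by apply/forallP => j; rewrite mnmE eqxx orbT.
rewrite mps_inclE !mps_mulE_lowers; case: (boolP (supported m)) => sm.
  rewrite -(perm_big _ (lowers_restr sm)) big_map [LHS]big_seq [RHS]big_seq.
  apply: eq_bigr => k; rewrite mem_lowers => km; rewrite !mps_inclE.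
  rewrite (supported_le sm km) (supported_le sm (lem_subr _ _)).
  by congr (_ * b _); apply/mnmP => i; rewrite !mnmE.
rewrite big_seq big1 // => k; rewrite mem_lowers => km; rewrite !mps_inclE.
case: (boolP (supported k)) => sk; last by rewrite mul0r.
case: (boolP (supported _)) => smk; last by rewrite mulr0.
case/negP: sm; apply/forallP => j.
have /forallP/(_ j) := sk; have /forallP/(_ j) := smk.
case: (j \in _) => //= /eqP E /eqP E'.
by rewrite -(submK km) mnmDE E E'.
Qed.

Lemma conv_incl_is_zmod_morphism : zmod_morphism (conv_incl h_inj : conv R p -> _).
Proof. by move=> a b; apply: val_inj; apply: mps_incl_is_zmod_morphism. Qed.

Lemma conv_incl_is_monoid_morphism : monoid_morphism (conv_incl h_inj : conv R p -> _).
Proof.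
split=> [|a b]; apply: val_inj; first exact: mps_incl_is_monoid_morphism.1.
exact: mps_incl_is_monoid_morphism.2.
Qed.

End Inclusion.

HB.instance Definition _ (R : realType) p q (h : 'I_p -> 'I_q) (h_inj : injective h) :=
  GRing.isZmodMorphism.Build (conv R p) (conv R q) (conv_incl h_inj)
    (@conv_incl_is_zmod_morphism R p q h h_inj).
HB.instance Definition _ (R : realType) p q (h : 'I_p -> 'I_q) (h_inj : injective h) :=
  GRing.isMonoidMorphism.Build (conv R p) (conv R q) (conv_incl h_inj)
    (@conv_incl_is_monoid_morphism R p q h h_inj).

Section Regroup.
Variables (R : realType) (q m : nat).
Local Notation C := R[i].
Implicit Types (a b : conv R (q + m)) (x y : 'X_{1..q}) (k l : 'X_{1..m}).

Definition mjoin x k : 'X_{1..q + m} :=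
  [multinom match split i with inl j => x j | inr j => k j end | i < q + m].

Lemma mjoinl x k i : mjoin x k (lshift m i) = x i.
Proof. by rewrite mnmE (unsplitK (inl i)). Qed.

Lemma mjoinr x k i : mjoin x k (rshift q i) = k i.
Proof. by rewrite mnmE (unsplitK (inr i)). Qed.

Lemma mjoin_ext (u v : 'X_{1..q + m}) : (forall i, u (lshift m i) = v (lshift m i)) ->
  (forall i, u (rshift q i) = v (rshift q i)) -> u = v.
Proof.
move=> uvl uvr; apply/mnmP => i; rewrite -(splitK i).
by case: (split i) => j /=.
Qed.

Lemma mjoin_inj x k y l : mjoin x k = mjoin y l -> x = y /\ k = l.
Proof.
move=> E; split; apply/mnmP => i.
  by rewrite -(mjoinl x k) E mjoinl.
by rewrite -(mjoinr x k) E mjoinr.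
Qed.

Lemma mjoin_eq0 x k : (mjoin x k == 0%MM) = (x == 0%MM) && (k == 0%MM).
Proof.
have -> : 0%MM = mjoin 0%MM 0%MM.
  by apply: mjoin_ext => i; rewrite ?mjoinl ?mjoinr !mnm0E.
by apply/eqP/andP => [/mjoin_inj[-> ->] // | [/eqP -> /eqP ->]].
Qed.

Lemma mjoinB x k y l : mjoin (x - y) (k - l) = (mjoin x k - mjoin y l)%MM.
Proof. by apply: mjoin_ext => i; rewrite mnmBE ?mjoinl ?mjoinr mnmBE. Qed.

Lemma mjoin_le x k y l : (mjoin y l <= mjoin x k)%MM = (y <= x)%MM && (l <= k)%MM.
Proof.
apply/mnm_lepP/andP => [le | [/mnm_lepP yx /mnm_lepP lk] i].
  split; apply/mnm_lepP => i.
    by have := le (lshift m i); rewrite !mjoinl.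
  by have := le (rshift q i); rewrite !mjoinr.
by rewrite -(splitK i); case: (split i) => j /=; rewrite ?mjoinl ?mjoinr.
Qed.

Lemma mjoin_surj (u : 'X_{1..q + m}) :
  u = mjoin [multinom u (lshift m i) | i < q] [multinom u (rshift q i) | i < m].
Proof. by apply: mjoin_ext => i; rewrite ?mjoinl ?mjoinr mnmE. Qed.

Lemma mdeg_mjoin x k : mdeg (mjoin x k) = (mdeg x + mdeg k)%N.
Proof.
rewrite !mdegE big_split_ord /=; congr addn; apply: eq_bigr => i _.
  exact: mjoinl.
exact: mjoinr.
Qed.

Lemma lowers_mjoin x k : perm_eq (lowers (mjoin x k))
  [seq mjoin y l | l <- lowers k, y <- lowers x].
Proof.
apply: uniq_perm; rewrite ?lowers_uniq //.
  apply: allpairs_uniq; rewrite ?lowers_uniq // => -[l y] [l' y'] _ _ /=.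
  by case/mjoin_inj => -> ->.
move=> u; rewrite mem_lowers (mjoin_surj u) mjoin_le; apply/andP/allpairsP.
  by move=> [yx lk]; eexists (_, _); split; rewrite ?mem_lowers; eauto.
move=> [[l y] /= []]; rewrite !mem_lowers => lk yx /mjoin_inj[-> ->].
by [].
Qed.

Definition regroup_coef (a : mps (q + m) C) k : mps q C := Mps (fun x => a (mjoin x k)).

Lemma regroup_coef_convergent (a : mps (q + m) C) k :
  a \in @convergent R (q + m) -> regroup_coef a k \in @convergent R q.
Proof.
case/asboolP=> r r0 [M aM]; apply/asboolP; exists r => //.
exists (r ^- mdeg k * M) => s us.
have us' : uniq [seq mjoin x k | x <- s].
  by rewrite map_inj_uniq // => x y /mjoin_inj[].
apply: le_trans (ler_wpM2l _ (aM _ us')); last by rewrite invr_ge0 exprn_ge0 // ltW.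
rewrite mulr_sumr big_map; apply: ler_sum => x _.
have rk : r ^+ mdeg k != 0 by rewrite expf_neq0 // gt_eqF.
rewrite mdeg_mjoin exprD /=; move: (r ^+ mdeg k) rk (r ^+ mdeg x) `|_| => z z0 w y.
by rewrite [leRHS](_ : _ = y * w) //; field.
Qed.

(** C{x, s} -> C{x}[[s]]. *)
Definition regroup a : mps m (conv R q) :=
  Mps (fun k => Conv (regroup_coef_convergent k (valP a))).

Lemma regroupE a k x : regroup a k x = a (mjoin x k).
Proof. by []. Qed.

Lemma conv_sumE p (I : Type) (s : seq I) (P : pred I) (E : I -> conv R p) u :
  (\sum_(i <- s | P i) E i) u = \sum_(i <- s | P i) E i u.
Proof.
by elim/big_rec2: _ => [|i x y _ <-]; [exact: mps0E | exact: mpsDE].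
Qed.

Lemma regroup_ext (c d : mps m (conv R q)) :
  (forall k x, c k x = d k x) -> c = d.
Proof. by move=> cd; apply: mpsP => k; apply: convP => x. Qed.

Lemma regroup_is_zmod_morphism : zmod_morphism regroup.
Proof. by move=> a b; apply: regroup_ext. Qed.

Lemma regroup_is_monoid_morphism : monoid_morphism regroup.
Proof.
split=> [|a b]; apply: regroup_ext => k x.
  rewrite regroupE [LHS]mps1E mjoin_eq0 mps1E.
  by case: (k == 0%MM); rewrite ?andbT ?andbF ?mps1E ?mps0E.
rewrite regroupE [LHS]mps_mulE_lowers (perm_big _ (lowers_mjoin x k)).
rewrite big_allpairs_dep mps_mulE_lowers conv_sumE; apply: eq_bigr => l _.
rewrite [RHS]mps_mulE_lowers; apply: eq_bigr => y _.
by rewrite -mjoinB !regroupE.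
Qed.

HB.instance Definition _ := GRing.isZmodMorphism.Build (conv R (q + m))
  (mps m (conv R q)) regroup regroup_is_zmod_morphism.
HB.instance Definition _ := GRing.isMonoidMorphism.Build (conv R (q + m))
  (mps m (conv R q)) regroup regroup_is_monoid_morphism.

Lemma regroup_incl_x (a : conv R q) :
  regroup (conv_incl (@lshift_inj q m) a) = mpsC m a.
Proof.
apply: regroup_ext => k x; rewrite regroupE /= /mps_incl /=.
have -> : [multinom mjoin x k (lshift m i) | i < q] = x.
  by apply/mnmP => i; rewrite mnmE mjoinl.
case: (k =P 0%MM) => [->|k0].
  case: ifP => // /negP[]; apply/forallP => j; rewrite -(splitK j).
  case: (split j) => i /=; first by rewrite codom_f.
  by rewrite mjoinr mnm0E eqxx orbT.
case: ifP => // /forallP H; last by rewrite mps0E.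
case: k0; apply/mnmP => i; have := H (rshift q i).
rewrite mjoinr mnm0E; case/orP => [/codomP[j] | /eqP //].
by move=> /eqP; rewrite eq_rlshift.
Qed.

Lemma regroup_incl_s (c : conv R m) :
  regroup (conv_incl (@rshift_inj q m) c) = mps_map (@convC R q) c.
Proof.
apply: regroup_ext => k x; rewrite regroupE /= /mps_incl /=.
have -> : [multinom mjoin x k (rshift q i) | i < m] = k.
  by apply/mnmP => i; rewrite mnmE mjoinr.
case: (x =P 0%MM) => [->|x0].
  case: ifP => // /negP[]; apply/forallP => j; rewrite -(splitK j).
  case: (split j) => i /=; last by rewrite codom_f.
  by rewrite mjoinl mnm0E eqxx orbT.
case: ifP => // /forallP H.
case: x0; apply/mnmP => i; have := H (lshift m i).
rewrite mjoinl mnm0E; case/orP => [/codomP[j] | /eqP //].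
by move=> /eqP; rewrite eq_lrshift.
Qed.

Lemma regroupX (j : 'I_m) : regroup (convX R (rshift q j)) = mpsX _ j.
Proof.
apply: regroup_ext => k x; rewrite regroupE /=.
have -> : U_(rshift q j)%MM = mjoin 0%MM U_(j)%MM.
  apply: mjoin_ext => i; rewrite ?mjoinl ?mjoinr mnm1E ?mnm1E.
    by rewrite eq_rlshift mnm0E.
  by rewrite (inj_eq (@rshift_inj _ _)).
case: (k =P U_(j)%MM) => [->|kj].
  rewrite mps1E; congr (_%:R); congr nat_of_bool.
  by apply/eqP/eqP => [/mjoin_inj[] | ->].
rewrite mps0E; case: eqP => // /mjoin_inj[_] //.
Qed.

Lemma regroup_der (i : 'I_q) a :
  regroup (conv_der (lshift m i) a) = mps_map (@conv_der R q i) (regroup a).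
Proof.
apply: regroup_ext => k x; rewrite regroupE /= mjoinl; congr (a _ *+ _).
apply: mjoin_ext => j; rewrite mnmDE ?mjoinl ?mjoinr mnm1E ?mnmDE ?mnm1E.
  by rewrite (inj_eq (@lshift_inj _ _)).
by rewrite eq_lrshift addn0.
Qed.

End Regroup.

Section Germ.
Variables (R : realType) (m : nat).

Lemma germ_of_poly_is_zmod_morphism : zmod_morphism (@germ_of_poly R m).
Proof. by move=> P Q; rewrite /germ_of_poly raddfB hornerD hornerN. Qed.

Lemma germ_of_poly_is_monoid_morphism : monoid_morphism (@germ_of_poly R m).
Proof.
split=> [|P Q]; first by rewrite /germ_of_poly rmorph1 hornerC.
by rewrite /germ_of_poly rmorphM hornerM.
Qed.

HB.instance Definition _ := GRing.isZmodMorphism.Build {poly conv R m} (conv R m.+1)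
  (@germ_of_poly R m) germ_of_poly_is_zmod_morphism.
HB.instance Definition _ := GRing.isMonoidMorphism.Build {poly conv R m} (conv R m.+1)
  (@germ_of_poly R m) germ_of_poly_is_monoid_morphism.

Lemma germ_of_poly_coef0 (P : {poly conv R m}) :
  conv_coef0 (germ_of_poly P) = conv_coef0 P`_0.
Proof.
rewrite /germ_of_poly -(horner_map (@conv_coef0 R m.+1)).
rewrite [X in _.[X]](_ : _ = 0); last first.
  rewrite /= /conv_coef0 /mps_coef0 /=; case: eqP => // /esym/eqP.
  by rewrite mnm1_eq0.
rewrite horner_coef0 coef_map coef_map /= /conv_coef0 /mps_coef0 /= /mps_incl /=.
case: ifP => [_|/negP[]]; last by apply/forallP => j; rewrite mnm0E eqxx orbT.
by congr (P`_0 _); apply/mnmP => i; rewrite mnmE !mnm0E.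
Qed.

End Germ.

(** * The Koszul complex of the partial derivatives *)

Section Ideal.
Variables (B : comNzRingType) (k : nat) (d : 'I_k -> B).

Lemma in_ideal0 : in_ideal d 0.
Proof. by exists (fun=> 0); rewrite big1 // => i _; rewrite mul0r. Qed.

Lemma in_idealD a b : in_ideal d a -> in_ideal d b -> in_ideal d (a + b).
Proof.
move=> [x ->] [y ->]; exists (fun i => x i + y i).
by rewrite -big_split; apply: eq_bigr => i _; rewrite mulrDl.
Qed.

Lemma in_idealMl a b : in_ideal d b -> in_ideal d (a * b).
Proof.
move=> [y ->]; exists (fun i => a * y i).
by rewrite mulr_sumr; apply: eq_bigr => i _; rewrite mulrA.
Qed.

Lemma in_idealN a : in_ideal d a -> in_ideal d (- a).
Proof. by move=> /(in_idealMl (-1)); rewrite mulN1r. Qed.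

End Ideal.

Lemma sum_antisym (V : zmodType) p (t : 'I_p -> 'I_p -> V) :
    (forall i, t i i = 0) -> (forall i j, t i j = - t j i) ->
  \sum_i \sum_j t i j = 0.
Proof.
move=> t0 tN; rewrite pair_bigA /= (bigID (fun u : 'I_p * 'I_p => (u.1 < u.2)%N)) /=.
rewrite [X in _ + X](bigID (fun u : 'I_p * 'I_p => u.1 == u.2)) /=.
rewrite [X in _ + (X + _)]big1 ?add0r; last first.
  by move=> [i j] /= /andP[_ /eqP ->].
pose swap (u : 'I_p * 'I_p) := (u.2, u.1).
rewrite [X in _ + X](reindex_onto swap swap) /=; last by case.
rewrite [X in _ + X](eq_bigl (fun u : 'I_p * 'I_p => (u.1 < u.2)%N)); last first.
  by move=> [i j] /=; rewrite eqxx andbT -leqNgt ltn_neqAle eq_sym andbC.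
by rewrite -big_split /= big1 // => -[i j] _; rewrite /= [t j i]tN subrr.
Qed.

Section MonomialIdeals.
Variables (R : realType) (p N : nat).
Local Notation O := (conv R p).
Implicit Types (a b : O) (m k : 'X_{1..p}) (q : nat).

Lemma mps_deltaM (A : comNzRingType) (a b : mps p A) k :
    (forall m, a m = (m == k)%:R) ->
  forall m, (a * b) m = if (k <= m)%MM then b (m - k)%MM else 0.
Proof.
move=> aE m; rewrite mps_mulE_lowers; case: ifP => km.
  rewrite (bigD1_seq k) ?mem_lowers ?lowers_uniq //= aE eqxx mul1r big1 ?addr0 //.
  by move=> l /negPf lk; rewrite aE lk mul0r.
rewrite big_seq big1 // => l; rewrite mem_lowers aE; case: eqP => [->|].
  by rewrite km.
by rewrite mul0r.
Qed.

Lemma mpsX_expE (A : comNzRingType) (i : 'I_p) M m :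
  (mpsX A i ^+ M) m = (m == U_(i) *+ M)%MM%:R.
Proof.
elim: M m => [|M IHM] m; first by rewrite mps1E.
rewrite exprS (mps_deltaM _ (k := U_(i)%MM)) // mulmS.
case: ifP => im; first by rewrite IHM -(inj_eq (@addIm _ U_(i)%MM)) submK // addmC.
by case: eqP => // m_E; rewrite m_E lem_addr in im.
Qed.

Lemma conv_XM (i : 'I_p) a m : (convX R i ^+ N * a) m =
  if (N <= m i)%N then a (m - U_(i) *+ N)%MM else 0.
Proof.
have -> : conv_mps (convX R i ^+ N * a) = mpsX _ i ^+ N * conv_mps a.
  by rewrite -[LHS]/(val _) rmorphM rmorphXn.
rewrite (mps_deltaM _ (mpsX_expE _ i N)).
congr (if _ then _ else _); apply/mnm_lepP/idP => [/(_ i)|Nm j].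
  by rewrite mulmnE mnm1E eqxx mul1n.
by rewrite mulmnE mnm1E; case: eqP => [<-|]; rewrite ?mul1n ?mul0n.
Qed.

(** Membership in the ideal (x_0^N, ..., x_(q-1)^N). *)
Definition mono_ideal q a := forall m, (forall j : 'I_p, (j < q)%N -> (m j < N)%N) -> a m = 0.

Lemma mono_idealD q a b : mono_ideal q a -> mono_ideal q b -> mono_ideal q (a + b).
Proof. by move=> qa qb m mN; rewrite mpsDE qa ?qb ?addr0. Qed.

Lemma mono_idealMl q a b : mono_ideal q b -> mono_ideal q (a * b).
Proof.
move=> qb m mN; rewrite [LHS]mps_mulE_lowers big_seq big1 // => k _.
by rewrite qb ?mulr0 // => j /mN; apply: leq_ltn_trans; rewrite mnmBE leq_subr.
Qed.

Lemma mono_idealN q a : mono_ideal q a -> mono_ideal q (- a).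
Proof. by move=> qa; rewrite -mulN1r; apply: mono_idealMl. Qed.

Lemma mono_idealB q a b : mono_ideal q a -> mono_ideal q b -> mono_ideal q (a - b).
Proof. by move=> qa qb; apply: mono_idealD => //; apply: mono_idealN. Qed.

Lemma mono_ideal_0 q : mono_ideal q 0.
Proof. by move=> m _; rewrite mps0E. Qed.

Lemma mono_ideal_sum q (I : Type) (s : seq I) (E : I -> O) :
  (forall i, mono_ideal q (E i)) -> mono_ideal q (\sum_(i <- s) E i).
Proof.
move=> qE; apply: (big_ind (mono_ideal q)) => //; first exact: mono_ideal_0.
by move=> a b; apply: mono_idealD.
Qed.

Lemma mono_ideal_none a : mono_ideal 0 a -> a = 0.
Proof. by move=> a0; apply: convP => m; rewrite a0 // mps0E. Qed.

Lemma mono_idealW q a : mono_ideal q a -> mono_ideal q.+1 a.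
Proof. by move=> qa m mN; apply: qa => j jq; apply: mN; rewrite ltnW. Qed.

Lemma mono_ideal_X (i : 'I_p) a : mono_ideal i.+1 (convX R i ^+ N * a).
Proof. by move=> m mN; rewrite conv_XM leqNgt mN. Qed.

(** The powers x_0^N, ..., x_(p-1)^N form a regular sequence. *)
Lemma mono_ideal_regular (i : 'I_p) a :
  mono_ideal i (convX R i ^+ N * a) -> mono_ideal i a.
Proof.
move=> H m mN; have := H (m + U_(i) *+ N)%MM; rewrite conv_XM addmK.
rewrite mnmDE mulmnE mnm1E eqxx mul1n leq_addl; apply=> j ji.
rewrite mnmDE mulmnE mnm1E; case: eqP => [E|_]; first by rewrite E ltnn in ji.
by rewrite mul0n addn0 mN.
Qed.

Lemma mono_idealS (i : 'I_p) a :
  mono_ideal i.+1 a -> exists b, mono_ideal i (a - convX R i ^+ N * b).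
Proof.
move=> H; pose b0 : mps p R[i] := Mps (fun m => a (m + U_(i) *+ N)%MM).
have cb : b0 \in @convergent R p.
  have /asboolP[r r0 [M aM]] := valP a; apply/asboolP; exists r => //.
  exists (r ^- N * M) => s us.
  have us' : uniq [seq (m + U_(i) *+ N)%MM | m <- s].
    by rewrite map_inj_uniq //; apply: addIm.
  apply: le_trans (ler_wpM2l _ (aM _ us')); last by rewrite invr_ge0 exprn_ge0 // ltW.
  rewrite mulr_sumr big_map; apply: ler_sum => m _ /=.
  have rk : r ^+ N != 0 by rewrite expf_neq0 // gt_eqF.
  have -> : mdeg (m + U_(i) *+ N) = (mdeg m + N)%N.
    by rewrite mdegD mdegMn mdeg1 mul1n.
  rewrite exprD /=; move: (r ^+ N) rk (r ^+ mdeg m) `|_| => z z0 w y.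
  by rewrite [leRHS](_ : _ = y * w) //; field.
exists (Conv cb) => m mN; rewrite mpsBE conv_XM; case: leqP => mi.
  rewrite /= submK ?subrr //; apply/mnm_lepP => j.
  by rewrite mulmnE mnm1E; case: eqP => [<-|]; rewrite ?mul1n ?mul0n.
rewrite subr0 H // => j; rewrite ltnS leq_eqVlt => /orP[/eqP/val_inj -> //|].
exact: mN.
Qed.

End MonomialIdeals.

Section Koszul.
Variables (R : realType) (p : nat) (gen : 'I_p -> conv R p).
Local Notation O := (conv R p).
Implicit Types (A : {set 'I_p}) (w v : {set 'I_p} -> O) (i j : 'I_p) (q : nat).

(** A form is the family of its coefficients, indexed by subsets of 'I_p;
    contract i and wedge i are the interior and exterior products by the i-th
    basis vector. *)
Definition koszul_sign i A : O := (-1) ^+ #|[set j in A | (j < i)%N]|.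

Definition contract i w : {set 'I_p} -> O := fun A =>
  if i \in A then 0 else koszul_sign i A * w (i |: A).
Definition wedge i w : {set 'I_p} -> O := fun A =>
  if i \in A then koszul_sign i A * w (A :\ i) else 0.

Lemma koszul_sign_sqr i A : koszul_sign i A * koszul_sign i A = 1.
Proof. by rewrite -expr2 sqrr_sign. Qed.

Lemma koszul_signU i j A : j \notin A ->
  koszul_sign i (j |: A) = (-1) ^+ (j < i)%N * koszul_sign i A.
Proof.
move=> jA; rewrite /koszul_sign; case: ltnP => ji.
  have -> : [set k in j |: A | (k < i)%N] = j |: [set k in A | (k < i)%N].
    by apply/setP => k; rewrite !inE; case: eqP => [->|]; rewrite ?ji.
  by rewrite cardsU1 !inE (negPf jA) exprD.
rewrite expr0 mul1r.
suff -> : [set k in j |: A | (k < i)%N] = [set k in A | (k < i)%N] by [].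
apply/setP => k; rewrite !inE; case: (eqVneq k j) => [->|_] //=.
by rewrite ltnNge ji andbF.
Qed.

Lemma koszul_signD1 i j A : j \in A ->
  koszul_sign i A = (-1) ^+ (j < i)%N * koszul_sign i (A :\ j).
Proof. by move=> jA; rewrite -koszul_signU ?setD1K // !inE eqxx. Qed.

Lemma ltn_sign i j : i != j -> (-1) ^+ (j < i)%N = - (-1) ^+ (i < j)%N :> O.
Proof.
rewrite neq_ltn => /orP[] ij; rewrite ij ltnNge (ltnW ij) /= expr1 expr0 ?opprK //.
Qed.

Lemma contract_wedge i j w A :
  contract i (wedge j w) A + wedge j (contract i w) A = (i == j)%:R * w A.
Proof.
rewrite /contract /wedge; case: (eqVneq i j) => [<-|ij]; rewrite ?mul1r ?mul0r.
  case: ifP => iA.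
    rewrite !inE eqxx /= [koszul_sign i A](koszul_signD1 _ iA) ltnn mul1r add0r.
    by rewrite mulrA koszul_sign_sqr mul1r setD1K.
  rewrite !inE eqxx /= addr0 koszul_signU ?iA // ltnn mul1r mulrA.
  by rewrite koszul_sign_sqr mul1r setU1K ?iA.
rewrite !inE [j == i]eq_sym (negPf ij) /=; case: (boolP (i \in A)) => iA /=.
  by case: ifP => _; rewrite ?mulr0 addr0.
case: (boolP (j \in A)) => jA /=; last by rewrite mulr0 addr0.
rewrite (koszul_signU _ iA) (koszul_signD1 i jA) (ltn_sign ij).
have -> : (i |: A) :\ j = i |: (A :\ j).
  apply/setP => k; rewrite !inE; case: (eqVneq k j) => [->|] //=.
  by rewrite eq_sym (negPf ij).
have := sqrr_sign O (i < j)%N.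
move: ((-1) ^+ (i < j)%N) (koszul_sign i _) (koszul_sign j _) (w _) => s x y z s2.
by ring: s2.
Qed.

Lemma contract_contract i j w A :
  contract i (contract j w) A = - contract j (contract i w) A.
Proof.
rewrite /contract; case: (eqVneq i j) => [<-|ij].
  by case: ifP => iA; rewrite ?oppr0 // !inE eqxx mulr0 oppr0.
rewrite !inE (negPf ij) [j == i]eq_sym (negPf ij) /=.
case: (boolP (i \in A)) => iA; case: (boolP (j \in A)) => jA /=; rewrite ?mulr0 ?oppr0 //.
rewrite (koszul_signU _ iA) (koszul_signU _ jA) (ltn_sign ij) setUCA.
by ring.
Qed.

Definition koszul w : {set 'I_p} -> O := fun A => \sum_i gen i * contract i w A.
Definition homotopy (c : 'I_p -> O) w : {set 'I_p} -> O :=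
  fun A => \sum_i c i * wedge i w A.

Lemma koszul_lin a w v A :
  koszul (fun A => w A + a * v A) A = koszul w A + a * koszul v A.
Proof.
rewrite mulr_sumr -big_split; apply: eq_bigr => i _; rewrite /contract /=.
by case: ifP => _; ring.
Qed.

(** The elements of the ideal act by zero on Koszul homology. *)
Lemma koszul_homotopy c w A : koszul (homotopy c w) A + homotopy c (koszul w) A =
  (\sum_i c i * gen i) * w A.
Proof.
have -> : koszul (homotopy c w) A =
    \sum_i \sum_j gen i * c j * contract i (wedge j w) A.
  apply: eq_bigr => i _; rewrite /contract /homotopy; case: ifP => _.
    by rewrite mulr0 big1 // => j _; rewrite mulr0.
  by rewrite !mulr_sumr; apply: eq_bigr => j _; ring.
have -> : homotopy c (koszul w) A =
    \sum_i \sum_j gen i * c j * wedge j (contract i w) A.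
  rewrite exchange_big; apply: eq_bigr => j _; rewrite /wedge /koszul; case: ifP => _.
    by rewrite !mulr_sumr; apply: eq_bigr => i _; ring.
  by rewrite mulr0 big1 // => i _; rewrite mulr0.
rewrite -big_split mulr_suml; apply: eq_bigr => i _; rewrite -big_split /=.
rewrite (bigD1 i) //= -mulrDr contract_wedge eqxx mul1r [gen i * _]mulrC big1 ?addr0 // => j ji.
by rewrite -mulrDr contract_wedge eq_sym (negPf ji) mul0r mulr0.
Qed.

Lemma koszul_koszul w A : koszul (koszul w) A = 0.
Proof.
rewrite -[RHS](@sum_antisym _ p (fun i j => gen i * gen j * contract i (contract j w) A)).
- apply: eq_bigr => i _; rewrite {1}/contract; case: ifP => iA.
    by rewrite mulr0 big1 // => j _; rewrite /contract iA mulr0.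
  rewrite /koszul !mulr_sumr; apply: eq_bigr => j _.
  by rewrite [contract i _ A]/contract iA; ring.
- move=> i; rewrite [contract i (contract i w) A](_ : _ = 0) ?mulr0 //.
  by rewrite /contract; case: ifP => // _; rewrite !inE eqxx mulr0.
by move=> i j; rewrite contract_contract; ring.
Qed.

Variable N : nat.
Hypothesis X_in_ideal : forall i, in_ideal gen (convX R i ^+ N).

(** The ideal generated by gen contains the regular sequence of the x_i^N, of
    the same length, hence its Koszul complex is acyclic.  The induction
    starts at q = p, where there are no forms of degree > p.  Going down, if w is
    a cycle of degree > q modulo the first q powers, then for the homotopy
    belonging to y = x_q^N the form h w is a cycle of degree > q + 1 modulo the
    first q + 1 powers; a primitive of it yields one of y w modulo the first q
    powers, where y is regular. *)
Lemma koszul_mono_exact q w : (q <= p)%N ->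
    (forall A, (#|A| <= q)%N -> w A = 0) ->
    (forall A, mono_ideal N q (koszul w A)) ->
  exists v, forall A, mono_ideal N q (w A - koszul v A).
Proof.
elim: {q}(p - q)%N {-2}q (leqnn (p - q)) w => [|k IHk] q le_k w le_q w0 kw.
  exists (fun=> 0) => A; rewrite w0; last first.
    by rewrite (leq_trans (max_card _)) // card_ord; lia.
  rewrite /koszul big1 ?subr0; first exact: mono_ideal_0.
  by move=> i _; rewrite /contract; case: ifP; rewrite !mulr0.
case: (ltnP q p) => [lt_q|le_p]; last by apply: IHk => //; lia.
pose i := Ordinal lt_q; have [c cE] := X_in_ideal i.
have hD A := koszul_homotopy c w A; rewrite -cE in hD.
have [||||v vP] := IHk q.+1 _ (homotopy c w).
- by lia.
- by [].
- move=> A Aq; rewrite /homotopy big1 // => j _; rewrite /wedge.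
  case: ifP => jA; rewrite ?mulr0 // w0 ?mulr0 //.
  by rewrite (cardsD1 j A) jA add1n ltnS in Aq.
- move=> A; rewrite (canRL (addrK _) (hD A)); apply: mono_idealB.
    exact: (@mono_ideal_X R p N i).
  apply: mono_ideal_sum => j; apply/mono_idealW/mono_idealMl; rewrite /wedge.
  by case: ifP => _; [apply: mono_idealMl | apply: mono_ideal_0].
have [v' v'P] := choice (fun A => @mono_idealS R p N i _ (vP A)).
exists v' => A; apply: (@mono_ideal_regular R p N i).
pose z A := homotopy c w A - koszul v A - convX R i ^+ N * v' A.
have -> : convX R i ^+ N * (w A - koszul v' A) = koszul z A + homotopy c (koszul w) A.
  rewrite mulrBr -hD.
  have -> : koszul z A = koszul (homotopy c w) A + (-1) * koszul (koszul v) A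
      + (- convX R i ^+ N) * koszul v' A.
    by rewrite -!koszul_lin; congr (koszul _ A); apply/funext => A'; rewrite /z; ring.
  by rewrite koszul_koszul; ring.
apply: mono_idealD; apply: mono_ideal_sum => j; apply: mono_idealMl.
  by rewrite /contract; case: ifP => _; [apply: mono_ideal_0 | apply/mono_idealMl/v'P].
by rewrite /wedge; case: ifP => _; [apply: mono_idealMl | apply: mono_ideal_0].
Qed.

(** The case q = 0, in degree 1. *)
Lemma koszul_relation (eta : 'I_p -> O) : \sum_i gen i * eta i = 0 ->
  exists xi : 'I_p -> 'I_p -> O, [/\ forall i, xi i i = 0,
    forall i j, xi i j = - xi j i & forall i, eta i = \sum_j gen j * xi i j].
Proof.
move=> rel; pose w A : O := \sum_(i | A == [set i]) eta i.
have w1 i : w [set i] = eta i.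
  rewrite /w (bigD1 i) //= big1 ?addr0 // => j /andP[/eqP/set1_inj ->].
  by rewrite eqxx.
have w0 A : #|A| != 1%N -> w A = 0.
  by move=> cA; rewrite /w big1 // => i /eqP E; rewrite E cards1 in cA.
have [|A|A|v vP] := @koszul_mono_exact 0 w; first by [].
- by move=> A0; apply: w0; lia.
- rewrite [koszul w A](_ : _ = 0); first exact: mono_ideal_0.
  case: (eqVneq A set0) => [->|/set0Pn[j jA]].
    rewrite -[RHS]rel; apply: eq_bigr => i _; rewrite /contract inE setU0 w1.
    rewrite /koszul_sign (_ : [set _ in _ | _] = set0) ?cards0 ?mul1r //.
    by apply/setP => k; rewrite !inE.
  rewrite /koszul big1 // => i _; rewrite /contract; case: ifP => iA; rewrite ?mulr0 //.
  rewrite w0 ?mulr0 // cardsU1 iA eqSS cards_eq0.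
  by apply/set0Pn; exists j.
exists (fun i j => contract j v [set i]); split.
- by move=> i; rewrite /contract inE eqxx.
- move=> i j; rewrite /contract !inE [j == i]eq_sym; case: (eqVneq i j) => [_|ij].
    by rewrite oppr0.
  rewrite setUC -mulNr; congr (_ * _).
  have E (x y : 'I_p) : koszul_sign x [set y] = (-1) ^+ (y < x)%N.
    by rewrite -(setU0 [set y]) koszul_signU ?inE // /koszul_sign
      (_ : [set _ in _ | _] = set0) ?cards0 ?mulr1 //; apply/setP => k; rewrite !inE.
  by rewrite !E; apply: ltn_sign; rewrite eq_sym.
by move=> i; have /mono_ideal_none/eqP := vP [set i]; rewrite subr_eq0 w1 => /eqP.
Qed.

End Koszul.

(** * Multiplication matrices on a finite free quotient ring *)

Section QuotBasis.
Variables (K B : comNzRingType) (iota : {rmorphism K -> B}).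
Variables (k : nat) (d : 'I_k -> B) (r : nat) (e : 'I_r -> B).
Hypothesis basis : quot_basis iota (in_ideal d) e.
Local Notation I := (in_ideal d).

Definition coords (a : B) : 'cV[K]_r := (projT1 (cid (basis a)))^T.

Lemma coordsP a : I (a - \sum_i iota (coords a i 0) * e i).
Proof.
rewrite /coords; case: cid => c [/= cP _].
by under eq_bigr do rewrite mxE.
Qed.

Lemma coords_uniq a (v : 'cV[K]_r) : I (a - \sum_i iota (v i 0) * e i) -> coords a = v.
Proof.
move=> av; apply: trmx_inj; rewrite /coords trmxK; case: cid => c [/= _ cU].
by apply: cU; under eq_bigr do rewrite mxE.
Qed.

Lemma coords_sum (v : 'cV[K]_r) : coords (\sum_i iota (v i 0) * e i) = v.
Proof. by apply: coords_uniq; rewrite subrr; apply: in_ideal0. Qed.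

Lemma coords_ideal a b : I (a - b) -> coords a = coords b.
Proof.
move=> ab; apply: coords_uniq; rewrite -[a](subrK b) -addrA.
exact: in_idealD (coordsP b).
Qed.

Lemma coordsD a b : coords (a + b) = coords a + coords b.
Proof.
apply: coords_uniq; have -> : \sum_i iota ((coords a + coords b) i 0) * e i =
    \sum_i iota (coords a i 0) * e i + \sum_i iota (coords b i 0) * e i.
  by rewrite -big_split; apply: eq_bigr => i _; rewrite mxE rmorphD mulrDl.
by rewrite opprD addrACA; apply: in_idealD; apply: coordsP.
Qed.

Lemma coordsZ c a : coords (iota c * a) = c *: coords a.
Proof.
apply: coords_uniq; have -> : \sum_i iota ((c *: coords a) i 0) * e i =
    iota c * \sum_i iota (coords a i 0) * e i.
  by rewrite mulr_sumr; apply: eq_bigr => i _; rewrite mxE rmorphM mulrA.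
by rewrite -mulrBr; apply/in_idealMl/coordsP.
Qed.

Lemma coords0 : coords 0 = 0.
Proof. by rewrite -(mul0r 1) -(rmorph0 iota) coordsZ scale0r. Qed.

Lemma coords_eq0 a : coords a = 0 -> I a.
Proof.
move=> a0; have := coordsP a; rewrite a0 big1 ?subr0 // => i _.
by rewrite mxE rmorph0 mul0r.
Qed.

Definition mulm (a : B) : 'M[K]_r := \matrix_(i, j) coords (a * e j) i 0.

Lemma coords_bigsum (J : Type) (s : seq J) (E : J -> B) :
  coords (\sum_(j <- s) E j) = \sum_(j <- s) coords (E j).
Proof. by rewrite (big_morph _ coordsD coords0). Qed.

Lemma coordsM a b : coords (a * b) = mulm a *m coords b.
Proof.
rewrite (@coords_ideal _ (a * \sum_j iota (coords b j 0) * e j)); last first.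
  by rewrite -mulrBr; apply/in_idealMl/coordsP.
rewrite mulr_sumr coords_bigsum; apply/colP => i; rewrite summxE mxE.
apply: eq_bigr => j _; by rewrite mulrCA coordsZ !mxE mulrC.
Qed.

Lemma mulm_matrix a (M : 'M[K]_r) :
  (forall j, I (a * e j - \sum_i iota (M i j) * e i)) -> mulm a = M.
Proof.
move=> aM; apply/matrixP => i j; rewrite mxE.
rewrite (@coords_uniq _ (col j M)) ?mxE //.
by under eq_bigr do rewrite mxE.
Qed.

Lemma coords_inj_mx (P Q : 'M[K]_r) :
  (forall a, P *m coords a = Q *m coords a) -> P = Q.
Proof.
move=> PQ; apply/matrixP => i j; have := PQ (\sum_i iota ((delta_mx j 0 : 'cV_r) i 0) * e i).
by rewrite coords_sum -!colE => /colP/(_ i); rewrite !mxE.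
Qed.

Lemma mulmM a b : mulm (a * b) = mulm a * mulm b.
Proof. by apply: coords_inj_mx => c; rewrite -mulmxA -!coordsM mulrA. Qed.

Lemma mulmC c : mulm (iota c) = c%:M.
Proof. by apply: coords_inj_mx => a; rewrite -coordsM coordsZ mul_scalar_mx. Qed.

Lemma mulmD a b : mulm (a + b) = mulm a + mulm b.
Proof. by apply: coords_inj_mx => c; rewrite mulmxDl -!coordsM mulrDl coordsD. Qed.

Lemma mulmX a i : mulm (a ^+ i) = mulm a ^+ i.
Proof.
elim: i => [|i IHi]; first by rewrite !expr0 -(rmorph1 iota) mulmC.
by rewrite !exprS mulmM IHi.
Qed.

Lemma mulm_ideal a : I a -> mulm a = 0.
Proof.
move=> Ia; apply: coords_inj_mx => b; rewrite -coordsM mul0mx -coords0.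
by apply: coords_ideal; rewrite subr0 mulrC; apply: in_idealMl.
Qed.

Lemma mulm_comm a b : mulm a * mulm b = mulm b * mulm a.
Proof. by rewrite -!mulmM mulrC. Qed.

(** The quotient ring is its own commutant. *)
Lemma mulm_commutant (P : 'M[K]_r) : (forall a, P * mulm a = mulm a * P) ->
  exists a, P = mulm a.
Proof.
move=> Pc; pose a := \sum_i iota ((P *m coords 1) i 0) * e i; exists a.
have aE : coords a = P *m coords 1 by exact: coords_sum.
apply: coords_inj_mx => b; rewrite -coordsM mulrC coordsM aE.
have -> : mulm b *m (P *m coords 1) = (mulm b * P) *m coords 1 by rewrite mulmxA.
by rewrite -Pc -mulmxA -coordsM mulr1.
Qed.

End QuotBasis.

Section CayleyHamilton.
Variables (K B : comNzRingType) (iota : {rmorphism K -> B}).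
Variables (k : nat) (d : 'I_k -> B) (r : nat) (e : 'I_r.+1 -> B).
Hypothesis basis : quot_basis iota (in_ideal d) e.
Local Notation mulm := (mulm basis).

Lemma mulm_horner a (P : {poly K}) :
  mulm (map_poly iota P).[a] = horner_mx (mulm a) P.
Proof.
elim/poly_ind: P => [|P c IHP].
  by rewrite !rmorph0 horner0 -(rmorph0 iota) mulmC raddf0.
rewrite !rmorphD !rmorphM /= map_polyX map_polyC !hornerE mulmD mulmM IHP mulmC.
by rewrite horner_mx_X horner_mx_C.
Qed.

Lemma char_poly_in_ideal a : in_ideal d (map_poly iota (char_poly (mulm a))).[a].
Proof.
apply: (coords_eq0 (basis := basis)); rewrite -[_.[a]]mulr1 coordsM mulm_horner.
by rewrite Cayley_Hamilton mul0mx.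
Qed.

End CayleyHamilton.

(** Cayley-Hamilton puts a monic polynomial of degree r in a into the ideal.  It
    is a^j times a polynomial in a with non-zero constant term, which is a unit
    since a vanishes at the origin. *)
Lemma nilpotent_in_ideal (R : realType) p (k : nat) (d : 'I_k -> conv R p) r
    (e : 'I_r -> conv R p) (a : conv R p) :
    quot_basis (@convC R p) (in_ideal d) e -> a 0%MM = 0 ->
  in_ideal d (a ^+ r).
Proof.
case: r e => [|r] e basis a0.
  by apply: (coords_eq0 (basis := basis)); apply/colP => -[].
have := char_poly_in_ideal basis a; set chi := char_poly _.
have chi0 : chi != 0 by rewrite monic_neq0 ?char_poly_monic.
have [j [q /implyP/(_ chi0) q0 chiE]] := multiplicity_XsubC chi 0.
have jr : (j <= r.+1)%N.
  have := size_char_poly (mulm basis a); rewrite -/chi chiE size_Mmonic; last 2 first.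
  - by apply: contraNneq q0 => ->; rewrite root0.
  - by rewrite monic_exp ?monicXsubC.
  rewrite size_exp_XsubC; have : size q != 0%N.
    by rewrite size_poly_eq0; apply: contraNneq q0 => ->; rewrite root0.
  by lia.
rewrite chiE rmorphM rmorphXn /= subr0 map_polyX hornerM hornerXn.
have [b bq] : exists b, b * (map_poly (@convC R p) q).[a] = 1.
  apply: conv_inverse; rewrite -[_ 0%MM]/(conv_coef0 _) -horner_map /=.
  rewrite [conv_coef0 a]a0 horner_coef0 !coef_map /= /conv_coef0 /mps_coef0 /= eqxx.
  by move: q0; rewrite /root horner_coef0.
move=> /(in_idealMl (b * a ^+ (r.+1 - j))).
rewrite mulrACA bq mul1r -exprD addnC.
by rewrite subnKC.
Qed.

(** An ideal of series vanishing at the origin does not contain 1. *)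
Lemma basis_size_gt0 (R : realType) p (k : nat) (d : 'I_k -> conv R p) r
    (e : 'I_r -> conv R p) :
    quot_basis (@convC R p) (in_ideal d) e -> (forall i, d i 0%MM = 0) ->
  (0 < r)%N.
Proof.
move=> basis d0; case: r e basis => // e basis.
have [b b1] : in_ideal d 1 by apply: (coords_eq0 (basis := basis)); apply/colP => -[].
have /eqP := congr1 (@conv_coef0 R p) b1; rewrite rmorph1 rmorph_sum big1 ?oner_eq0 // => i _.
by rewrite rmorphM /= [conv_coef0 (d i)]d0 mulr0.
Qed.

(** * The Brieskorn lattice is free *)

Section Order.
Variables (m : nat) (A : comNzRingType).
Implicit Types (a b : pser (mps m A)) (d k : nat) (l : 'X_{1..m}).

(** The order of vanishing in (s, u). *)
Definition vanishes d a := forall k l, (k + mdeg l < d)%N -> a k l = 0.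

Lemma vanishes0 d : vanishes d (0 : pser (mps m A)).
Proof. by move=> k l _; rewrite pser0E mps0E. Qed.

Lemma vanishesD d a b : vanishes d a -> vanishes d b -> vanishes d (a + b).
Proof. by move=> da db k l lt; rewrite pserDE mpsDE da ?db ?addr0. Qed.

Lemma vanishesN d a : vanishes d a -> vanishes d (- a).
Proof. by move=> da k l lt; rewrite [LHS]/= da ?oppr0. Qed.

Lemma vanishesB d a b : vanishes d a -> vanishes d b -> vanishes d (a - b).
Proof. by move=> da db; apply: vanishesD => //; apply: vanishesN. Qed.

Lemma vanishes_sum d (I : Type) (s : seq I) (E : I -> pser (mps m A)) :
  (forall i, vanishes d (E i)) -> vanishes d (\sum_(i <- s) E i).
Proof.
move=> dE; apply: (big_ind (vanishes d)) => //; first exact: vanishes0.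
by move=> a b; apply: vanishesD.
Qed.

Lemma vanishesW d d' a : (d' <= d)%N -> vanishes d a -> vanishes d' a.
Proof. by move=> dd da k l lt; apply: da; apply: leq_trans dd. Qed.

Lemma vanishes_eq0 a : (forall d, vanishes d a) -> a = 0.
Proof.
by move=> da; apply: pserP => k; apply: mpsP => l; rewrite pser0E mps0E (da (k + mdeg l).+1).
Qed.

Lemma pser_mul_coef a b k l :
  (a * b) k l = \sum_(j < k.+1) \sum_(l' <- lowers l) a j l' * b (k - j)%N (l - l')%MM.
Proof.
by rewrite pserME mps_sumE; apply: eq_bigr => j _; rewrite mps_mulE_lowers.
Qed.

Lemma vanishesMl d a b : vanishes d b -> vanishes d (a * b).
Proof.
move=> db k l lt; rewrite pser_mul_coef big1 // => j _.
rewrite big_seq big1 // => l'; rewrite mem_lowers => l'l.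
by rewrite db ?mulr0 //; have := mdeg_subm l'l; have := ltn_ord j; lia.
Qed.

Lemma vanishes_lead d a b k l : vanishes d b -> (k + mdeg l = d)%N ->
  (a * b) k l = a 0%N 0%MM * b k l.
Proof.
move=> db kl; rewrite pser_mul_coef big_ord_recl /= subn0.
rewrite (bigD1_seq 0%MM) ?lowers_uniq //=; last first.
  by rewrite mem_lowers; apply/mnm_lepP => i; rewrite mnm0E.
rewrite subm0 [X in _ + X]big1 ?addr0; last first.
  move=> j _; rewrite big_seq big1 // => l'; rewrite mem_lowers => l'l.
  rewrite db ?mulr0 //; have := mdeg_subm l'l; have := ltn_ord j.
  by rewrite /bump /=; lia.
rewrite [X in _ + X]big_seq_cond [X in _ + X]big1 ?addr0 // => l' /andP[].
rewrite mem_lowers => l'l; rewrite -mdeg_eq0 => l'0.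
by rewrite db ?mulr0 //; have := mdeg_subm l'l; lia.
Qed.

Lemma vanishesU d a : vanishes d a -> vanishes d.+1 (pserU * a).
Proof.
move=> da [|k] l lt; first by rewrite pserU0 mps0E.
by rewrite pserUS da.
Qed.

Lemma vanishes_inj_U k a : pserU ^+ k * a = 0 -> a = 0.
Proof.
elim: k => [|k IHk]; first by rewrite expr0 mul1r.
rewrite exprS -mulrA => E; apply: IHk; apply: pserP => j.
by have := congr1 (fun x : pser (mps m A) => x j.+1) E; rewrite pserUS !pser0E.
Qed.

(** The sum of a sequence whose d-th term vanishes to order d. *)
Definition adic_sum (w : nat -> pser (mps m A)) : pser (mps m A) :=
  Pser (fun k => Mps (fun l => \sum_(d < (k + mdeg l).+1) w d k l)).

Lemma adic_sumP w N : (forall d, vanishes d (w d)) ->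
  vanishes N (adic_sum w - \sum_(d < N) w d).
Proof.
move=> wd k l lt; rewrite pserBE mpsBE pser_sumE mps_sumE /=.
rewrite (big_ord_widen N (fun d => w d k l) lt) big_mkcond -sumrB big1 // => d _.
by case: ltnP => ld; rewrite ?subrr // wd // subr0.
Qed.

End Order.

Section Lattice.
Variables (R : realType) (n m r : nat).
Local Notation C := R[i].
Local Notation O := (conv R n.+1).
Local Notation S := (mps m O).
Variables (f : O) (g : 'I_m -> O) (e : 'I_r -> S).
Local Notation df := (fun j : 'I_n.+1 => conv_der j f).
Local Notation F := (unfolding f g).
Hypothesis basis0 : quot_basis (@convC R n.+1) (in_ideal df) (fun i => e i 0%MM).

(** The j-th component of u d - dF /\ on forms. *)
Definition twisted_d (j : 'I_n.+1) (a : pser S) : pser S :=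
  pserU * pser_map (ddx j) a - pserC (ddx j F) * a.

Lemma twisted_dD j : {morph twisted_d j : a b / a + b}.
Proof. by move=> a b; rewrite /twisted_d raddfD /=; ring. Qed.

Lemma twisted_d0 j : twisted_d j 0 = 0.
Proof. by rewrite /twisted_d raddf0 !mulr0 subr0. Qed.

Lemma twisted_dN j a : twisted_d j (- a) = - twisted_d j a.
Proof. by rewrite /twisted_d raddfN /=; ring. Qed.

Lemma brieskorn_dE eta : brieskorn_d f g eta = \sum_j twisted_d j (eta j).
Proof. by []. Qed.

Lemma ddx_comm i j (a : S) : ddx i (ddx j a) = ddx j (ddx i a).
Proof. by apply: mpsP => l /=; apply: conv_der_comm. Qed.

Lemma twisted_d_comm i j a :
  twisted_d i (twisted_d j a) = twisted_d j (twisted_d i a).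
Proof.
have DU l b : pser_map (@ddx R n m l) (pserU * b) = pserU * pser_map (ddx l) b.
  rewrite pser_ddxM (_ : pser_map _ pserU = 0) ?mul0r ?add0r //.
  by apply: pserP => k; rewrite pser0E /pser_map /pserU /= -(rmorph_nat (@scal R n m)) ddx_scal.
have DC l c b : pser_map (@ddx R n m l) (pserC c * b) =
    pserC (ddx l c) * b + pserC c * pser_map (ddx l) b.
  rewrite pser_ddxM; suff -> : pser_map (ddx l) (pserC c) = pserC (ddx l c) by [].
  by apply: pserP => -[|k] //; apply: raddf0.
have DD b : pser_map (@ddx R n m i) (pser_map (ddx j) b) =
    pser_map (ddx j) (pser_map (ddx i) b).
  by apply: pserP => k /=; apply: ddx_comm.
rewrite /twisted_d !raddfB /= !DU !DC DD (ddx_comm i j F).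
by ring.
Qed.

Lemma unfolding_coef0 : F 0%MM = f.
Proof.
rewrite mpsDE mps_sumE big1 => [|j _]; first by rewrite addr0 /= eqxx.
rewrite -[LHS]/(mps_coef0 _) rmorphM [X in _ * X](_ : _ = 0) ?mulr0 //.
by rewrite /mps_coef0 /= eq_sym mnm1_eq0.
Qed.

Lemma twisted_d_vanishes d j a : vanishes d a -> vanishes d (twisted_d j a).
Proof.
move=> da; apply: vanishesB; last exact: vanishesMl.
apply: vanishesMl => k l lt /=; rewrite da //; exact: raddf0.
Qed.

Lemma twisted_d_lead d j a k l : vanishes d a -> (k + mdeg l = d)%N ->
  twisted_d j a k l = - (conv_der j f * a k l).
Proof.
move=> da kl; rewrite pserBE mpsBE (vanishesU (d := d)) ?kl //; last first.
  by move=> k' l' lt /=; rewrite da //; exact: raddf0.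
rewrite sub0r (vanishes_lead _ da kl) [X in - (X * _)](_ : _ = conv_der j f) //.
by rewrite -[LHS]/(conv_der j (F 0%MM)) unfolding_coef0.
Qed.

Lemma koszul_partials : forall eta : 'I_n.+1 -> O,
  \sum_i conv_der i f * eta i = 0 ->
  exists xi : 'I_n.+1 -> 'I_n.+1 -> O, [/\ forall i, xi i i = 0,
    forall i j, xi i j = - xi j i & forall i, eta i = \sum_j conv_der j f * xi i j].
Proof.
move=> eta; apply: (koszul_relation (N := r)) => i.
apply: nilpotent_in_ideal basis0 _ => /=; case: eqP => // /esym/eqP.
by rewrite mnm1_eq0.
Qed.

(** A representative of the class with coordinates c, together with the
    coboundary of eta. *)
Definition lattice_sum (c : 'I_r -> pser (mps m C)) (eta : 'I_n.+1 -> pser S) : pser S :=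
  \sum_i pserC (e i) * brieskorn_scal n (c i) + brieskorn_d f g eta.

Lemma lattice_sumB c c' eta eta' : lattice_sum c eta - lattice_sum c' eta' =
  lattice_sum (fun i => c i - c' i) (fun j => eta j - eta' j).
Proof.
rewrite /lattice_sum -brieskorn_dB opprD addrACA -sumrB; congr (_ + _).
by apply: eq_bigr => i _; rewrite raddfB /= mulrBr.
Qed.

Lemma scal_vanishes d (c : pser (mps m C)) :
  vanishes d c -> vanishes d (brieskorn_scal n c).
Proof. by move=> dc k l lt /=; rewrite dc //; apply: raddf0. Qed.

Lemma lattice_sum_vanishes d c eta : (forall i, vanishes d (c i)) ->
  (forall j, vanishes d (eta j)) -> vanishes d (lattice_sum c eta).
Proof.
move=> dc deta; apply: vanishesD; apply: vanishes_sum => i.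
  exact/vanishesMl/scal_vanishes.
exact: twisted_d_vanishes.
Qed.

Lemma lattice_sum_lead d c eta k l : (forall i, vanishes d (c i)) ->
    (forall j, vanishes d (eta j)) -> (k + mdeg l = d)%N ->
  lattice_sum c eta k l =
    \sum_i convC n.+1 (c i k l) * e i 0%MM - \sum_j eta j k l * conv_der j f.
Proof.
move=> dc deta kl; rewrite pserDE mpsDE !pser_sumE !mps_sumE -sumrN; congr (_ + _).
  apply: eq_bigr => i _.
  by rewrite (vanishes_lead _ (scal_vanishes (dc i)) kl) mulrC.
by apply: eq_bigr => j _; rewrite (twisted_d_lead _ (deta j) kl) mulrC.
Qed.

(** Divide the coefficients of lowest order by the e_i and the partial
    derivatives of f; this raises the order of the remainder, and the
    successive corrections add up. *)
Lemma lattice_generated (w : pser S) : exists c eta, w = lattice_sum c eta.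
Proof.
have ex (a : O) : exists cb : ('I_r -> C) * ('I_n.+1 -> O),
    a = \sum_i convC n.+1 (cb.1 i) * e i 0%MM - \sum_j cb.2 j * conv_der j f
    /\ (a = 0 -> (forall i, cb.1 i = 0) /\ (forall j, cb.2 j = 0)).
  have [-> | /eqP a0] := eqVneq a 0.
    exists (fun=> 0, fun=> 0); split=> //=.
    by rewrite !big1 ?subr0 // => i _; rewrite ?rmorph0 mul0r.
  have [v [[b bE] _]] := basis0 a.
  exists (fun i => v 0 i, fun j => - b j); split=> //=.
  have -> : \sum_j (- b j) * conv_der j f = - \sum_j b j * conv_der j f.
    by rewrite -sumrN; apply: eq_bigr => j _; rewrite mulNr.
  by rewrite opprK -bE addrC subrK.
have [cb cbP] := choice ex.
pose c0 (v : pser S) i : pser (mps m C) := Pser (fun k => Mps (fun l => (cb (v k l)).1 i)).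
pose b0 (v : pser S) j : pser S := Pser (fun k => Mps (fun l => (cb (v k l)).2 j)).
have c0d d v i : vanishes d v -> vanishes d (c0 v i).
  by move=> dv k l lt /=; case: ((cbP (v k l)).2 (dv k l lt)).
have b0d d v j : vanishes d v -> vanishes d (b0 v j).
  by move=> dv k l lt /=; case: ((cbP (v k l)).2 (dv k l lt)).
pose T v := v - lattice_sum (c0 v) (b0 v).
have Td d v : vanishes d v -> vanishes d.+1 (T v).
  move=> dv k l; rewrite ltnS leq_eqVlt => /orP[/eqP kl | lt]; last first.
    rewrite pserBE mpsBE dv // (@lattice_sum_vanishes d) ?subr0 // => i.
      exact: c0d.
    exact: b0d.
  rewrite pserBE mpsBE (lattice_sum_lead _ _ kl); last 2 first.
  - by move=> i; apply: c0d.
  - by move=> j; apply: b0d.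
  by rewrite {1}(cbP (v k l)).1 subrr.
pose W d := iter d T w.
have Wd d : vanishes d (W d) by elim: d => [|d IHd] //; apply: Td.
exists (fun i => adic_sum (fun d => c0 (W d) i)), (fun j => adic_sum (fun d => b0 (W d) j)).
apply/eqP; rewrite -subr_eq0; apply/eqP/vanishes_eq0 => N.
have -> : w = W N + lattice_sum (fun i => \sum_(d < N) c0 (W d) i)
                               (fun j => \sum_(d < N) b0 (W d) j).
  elim: N => [|N IHN].
    rewrite /lattice_sum big1 => [|i _]; last by rewrite big_ord0 raddf0 mulr0.
    rewrite brieskorn_dE big1 ?addr0 // => j _.
    by rewrite big_ord0 twisted_d0.
  rewrite IHN -[W N.+1]/(T (W N)) /T -addrA; congr (_ + _); apply/eqP.
  rewrite eq_sym addrC subr_eq addrC -subr_eq lattice_sumB; apply/eqP.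
  by congr lattice_sum; apply: funext => i; rewrite big_ord_recr /= addrAC subrr add0r.
rewrite -addrA lattice_sumB; apply: vanishesD; first exact: Wd.
by apply: lattice_sum_vanishes => i; rewrite -opprB; apply: vanishesN;
  apply: adic_sumP => d; [apply: c0d | apply: b0d].
Qed.

(** Koszul relations among the lowest terms of eta lift to twisted Koszul
    relations since the twisted derivatives commute, so eta can be pushed to
    the order of c; then the lowest terms of c vanish. *)
Lemma lattice_free c eta : lattice_sum c eta = 0 -> forall i, c i = 0.
Proof.
move=> rel i; apply: vanishes_eq0 => d; move: i.
elim: d => [|d IHd]; first by [].
have [eta' eta'd rel'] : exists2 eta', (forall j, vanishes d (eta' j)) & lattice_sum c eta' = 0.
  suff H d' : (d' <= d)%N ->
      exists2 eta', (forall j, vanishes d' (eta' j)) & lattice_sum c eta' = 0 by apply: H.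
  elim: d' => [_|d' IHd' lt]; first by exists eta.
  have {IHd'} [eta' eta'd rel'] := IHd' (ltnW lt).
  have kos (kl : nat * 'X_{1..m}) : exists xi : 'I_n.+1 -> 'I_n.+1 -> O,
    [/\ forall i, xi i i = 0, forall i j, xi i j = - xi j i &
     forall i, (if (kl.1 + mdeg kl.2 == d')%N then eta' i kl.1 kl.2 else 0) =
       \sum_j conv_der j f * xi i j].
    apply: koszul_partials; case: kl => k l /=; case: eqP => kl; last first.
      by rewrite big1 // => j _; rewrite mulr0.
    have := congr1 (fun a : pser S => a k l) rel'.
    rewrite pser0E mps0E (@lattice_sum_lead d') //; last first.
      by move=> i; apply: vanishesW (IHd i); apply: ltnW.
    rewrite [X in X - _]big1 => [|i _]; last by rewrite IHd ?kl // rmorph0 mul0r.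
    move/eqP; rewrite sub0r oppr_eq0 => /eqP E; rewrite -[RHS]E.
    by apply: eq_bigr => j _; rewrite mulrC.
  have [xi xiP] := choice kos.
  pose Xi i j : pser S := Pser (fun k => Mps (fun l =>
    if (k + mdeg l == d')%N then xi (k, l) i j else 0)).
  have Xid i j : vanishes d' (Xi i j).
    by move=> k l /ltn_eqF /= ->.
  exists (fun i => eta' i + \sum_j twisted_d j (Xi i j)).
    move=> i k l; rewrite ltnS leq_eqVlt => /orP[/eqP kl | lt']; last first.
      by apply: (vanishesD (d := d')) => //; apply: vanishes_sum => j;
        apply: twisted_d_vanishes.
    rewrite pserDE mpsDE pser_sumE mps_sumE.
    have [_ _ /(_ i)/=] := xiP (k, l); rewrite kl eqxx => ->.
    rewrite -big_split big1 // => j _.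
    have E : twisted_d j (Xi i j) k l = - (conv_der j f * xi (k, l) i j).
      by rewrite (twisted_d_lead _ (Xid i j) kl) [Xi i j k l]/= kl eqxx.
    rewrite -[LHS]/(conv_der j f * xi (k, l) i j + twisted_d j (Xi i j) k l).
    by rewrite E subrr.
  rewrite -[RHS]rel' /lattice_sum; congr (_ + _); rewrite !brieskorn_dE.
  under eq_bigr do rewrite twisted_dD.
  rewrite big_split /= -[RHS]addr0; congr (_ + _).
  rewrite -[RHS](@sum_antisym _ n.+1 (fun i j => twisted_d i (twisted_d j (Xi i j)))).
  - apply: eq_bigr => i _. by rewrite (big_morph _ (twisted_dD i) (twisted_d0 i)).
  - move=> i; rewrite (_ : Xi i i = 0) ?twisted_d0 //.
    apply: pserP => k; apply: mpsP => l; rewrite pser0E mps0E /=.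
    by case: eqP => // _; have [-> _ _] := xiP (k, l).
  move=> i j; rewrite twisted_d_comm -!twisted_dN; congr (twisted_d _ (twisted_d _ _)).
  apply: pserP => k; apply: mpsP => l /=.
  by case: eqP => [_|]; rewrite ?oppr0 //; have [_ -> _] := xiP (k, l).
move=> i k l; rewrite ltnS leq_eqVlt => /orP[/eqP kl | lt]; last exact: IHd.
have := congr1 (fun a : pser S => a k l) rel'.
rewrite pser0E mps0E (@lattice_sum_lead d) // => /eqP; rewrite subr_eq0 => /eqP E.
have [v [_ vU]] := basis0 0.
have v0 : v = 0.
  apply: vU; rewrite big1 ?subr0; first exact: in_ideal0.
  by move=> j _; rewrite mxE rmorph0 mul0r.
have /rowP/(_ i) : v = \row_i c i k l.
  apply: vU; under eq_bigr do rewrite mxE.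
  by rewrite E sub0r; apply: in_idealN; exists (fun j => eta' j k l).
by rewrite v0 !mxE.
Qed.

End Lattice.

(** * Splitting fields and simple spectra *)

Lemma irreducible_factor (F : fieldType) (p : {poly F}) : (1 < size p)%N ->
  exists2 q, irreducible_poly q & q %| p.
Proof.
elim: {p}(size p) {-2}p (leqnn (size p)) => [|k IHk] p le_k p1; first by lia.
have [irr | red] := pselect (irreducible_poly p); first by exists p; rewrite ?dvdpp.
have [d d1 [dp dnp]] : exists2 d : {poly F}, size d != 1%N & d %| p /\ ~~ (d %= p).
  apply: contrapT => no; apply: red; split=> // d d1 dp.
  by apply/negPn/negP => dnp; apply: no; exists d.
have p0 : p != 0 by rewrite -size_poly_gt0; lia.
have d0 : d != 0 by apply: contraNneq p0 => d0; rewrite -dvd0p -d0.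
have lt_d : (size d < size p)%N.
  by rewrite ltn_neqAle dvdp_leq // andbT dvdp_size_eqp.
have [||q irr qd] := IHk d; last by exists q; rewrite // (dvdp_trans qd).
- by rewrite -ltnS (leq_trans lt_d).
- by move: d1 d0; rewrite -size_poly_gt0; lia.
Qed.

(** Adjoin a root of an irreducible factor, then divide by it. *)
Lemma splitting_field (F : fieldType) (p : {poly F}) : p \is monic ->
  exists (L : fieldType) (iota : {rmorphism F -> L}) (rs : seq L),
    map_poly iota p = \prod_(z <- rs) ('X - z%:P).
Proof.
move: {2}(size p) (leqnn (size p)) => k; elim: k F p => [|k IHk] F p le_k mp.
  by have := monic_neq0 mp; rewrite -size_poly_gt0; lia.
have [p1 | p1] := leqP (size p) 1.
  exists F, idfun, [::]; rewrite big_nil map_poly_id //.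
  by move: mp; rewrite (size1_polyC p1) monicE lead_coefC => /eqP ->.
have [q irr_q qp] := irreducible_factor p1.
have [L _ [z qz _]] := irredp_FAdjoin irr_q.
have pz : root (map_poly (in_alg L) p) z.
  by have [q' ->] := dvdpP _ _ qp; rewrite rmorphM rootM qz orbT.
have [p' pE] := factor_theorem _ _ pz.
have mp' : p' \is monic.
  by rewrite -(monicMr _ (monicXsubC z)) -pE map_monic.
have [|L' [iota [rs E]]] := IHk L p' _ mp'.
  have := congr1 (fun s : {poly L} => size s) pE.
  rewrite size_map_poly size_Mmonic ?monic_neq0 ?monicXsubC // size_XsubC.
  by rewrite addn2 /= => E; rewrite -ltnS -E.
exists L', (iota \o in_alg L), (iota z :: rs).
rewrite big_cons -E map_poly_comp [map_poly (in_alg L) p]pE rmorphM /=.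
by rewrite map_polyXsubC mulrC.
Qed.

Section SimpleSpectrum.
Variables (A : comNzRingType) (L : fieldType) (iota : {rmorphism A -> L}).
Hypothesis iota_inj : injective iota.
Variables (n : nat) (T : 'M[A]_n.+1) (rs : seq L).
Hypotheses (charT : map_poly iota (char_poly T) = \prod_(z <- rs) ('X - z%:P))
           (uniq_rs : uniq rs).
Implicit Types X Y : 'M[A]_n.+1.

Let map_iota_inj p q : injective (map_mx iota : 'M_(p, q) -> _).
Proof.
move=> M N /matrixP MN; apply/matrixP => i j; apply: iota_inj.
by have := MN i j; rewrite !mxE.
Qed.

Let diag_form : exists (V : 'M[L]_n.+1) (D : 'rV[L]_n.+1),
  [/\ V \in unitmx, V *m map_mx iota T = diag_mx D *m V & injective (D 0)].
Proof.
move: charT; rewrite map_char_poly; set t := map_mx iota T => chart.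
have : diagonalizable t.
  apply/diagonalizableP; exists rs => //; rewrite -chart.
  exact: mxminpoly_dvd_char.
case=> V Vu /diagonalizable_forPex[D /(simmxP Vu) VtD].
exists V, D; split=> //.
have sz : size rs = n.+1.
  by have := size_char_poly t; rewrite chart size_prod_XsubC => -[].
have sub : {subset rs <= codom (D 0)}.
  move=> z zrs; have : root (char_poly t) z by rewrite chart root_prod_XsubC.
  rewrite -eigenvalue_root_char => /eigenvalueP[v vt v0].
  pose w := v *m invmx V.
  have w0 : w != 0.
    by apply: contraNneq v0 => w0; rewrite -[v](mulmxKV Vu) -/w w0 mul0mx.
  have wD : w *m diag_mx D = z *: w.
    apply: (can_inj (mulmxK Vu)); rewrite -mulmxA -VtD mulmxA mulmxKV // vt.
    by rewrite -scalemxAl mulmxKV.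
  move: w w0 wD => w /rV0Pn[j wj] wD.
  have /rowP/(_ j) := wD; rewrite mul_mx_diag !mxE mulrC => /(mulIf wj) <-.
  exact: codom_f.
apply/injectiveP; apply: (leq_size_uniq uniq_rs sub).
by rewrite size_map -cardE card_ord sz.
Qed.

(** In an eigenbasis of T with distinct eigenvalues, the commutant of T consists
    of diagonal matrices. *)
Let diag_coords (V : 'M[L]_n.+1) (D : 'rV[L]_n.+1) X :
    V \in unitmx -> V *m map_mx iota T = diag_mx D *m V -> injective (D 0) ->
    X * T = T * X ->
  exists y : 'rV[L]_n.+1, V *m map_mx iota X = diag_mx y *m V.
Proof.
move=> Vu VT Dinj XT; set x := map_mx iota X; pose Y := V *m x *m invmx V.
have YV : V *m x = Y *m V by rewrite mulmxKV.
have YD : Y *m diag_mx D = diag_mx D *m Y.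
  apply: (can_inj (mulmxK Vu)); rewrite -mulmxA -VT -[RHS]mulmxA -YV !mulmxA.
  rewrite -VT -YV -!mulmxA; congr (_ *m _).
  by rewrite -!map_mxM; congr map_mx.
exists (\row_j Y j j); rewrite YV; congr (_ *m _).
apply/matrixP => i j; rewrite !mxE; have [-> | ij] := eqVneq i j; first by rewrite mulr1n.
have /matrixP/(_ i j) := YD; rewrite mul_mx_diag mul_diag_mx !mxE => /eqP.
rewrite [D 0 i * _]mulrC -subr_eq0 -mulrBr mulf_eq0 subr_eq0 => /orP[/eqP -> // | /eqP/Dinj ji].
by rewrite ji eqxx in ij.
Qed.

Lemma simple_spectrum_comm X Y : X * T = T * X -> Y * T = T * Y -> X * Y = Y * X.
Proof.
move=> XT YT; have [V [D [Vu VT Dinj]]] := diag_form.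
have [x Vx] := diag_coords Vu VT Dinj XT; have [y Vy] := diag_coords Vu VT Dinj YT.
apply: map_iota_inj; rewrite !map_mxM.
apply: (can_inj (mulKmx Vu)); rewrite !mulmxA Vx Vy -!mulmxA Vx Vy !mulmxA.
by congr (_ *m _); rewrite !mulmx_diag; congr diag_mx; apply/rowP => j; rewrite !mxE mulrC.
Qed.

(** In an eigenbasis of T the matrix X is diagonal.  If it had an entry y != 0,
    take a polynomial q with q(0) = 0 that vanishes at the entries other than y
    but not at y: the trace of q(X) would be a positive multiple of q(y). *)
Lemma simple_spectrum_trace0 X : [pchar L] =i pred0 -> X * T = T * X ->
  (forall i, \tr (X ^+ i.+1) = 0) -> X = 0.
Proof.
move=> charL XT trX; have [V [D [Vu VT Dinj]]] := diag_form.
have [y Vx] := diag_coords Vu VT Dinj XT; set x := map_mx iota X in Vx.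
have VX i : V *m x ^+ i = diag_mx (\row_j y 0 j ^+ i) *m V.
  elim: i => [|i IHi].
    rewrite expr0 mulmx1 (_ : \row_j _ = const_mx 1) ?diag_const_mx ?mul1mx //.
    by apply/rowP => j; rewrite !mxE.
  rewrite exprSr mulmxA IHi -mulmxA Vx mulmxA mulmx_diag; congr (diag_mx _ *m _).
  by apply/rowP => j; rewrite !mxE exprSr.
have tr i : \sum_j y 0 j ^+ i.+1 = 0.
  have := congr1 iota (trX i); rewrite rmorph0 -trace_map_mx rmorphXn /= -/x.
  rewrite -[_ ^+ _](mulKmx Vu) VX mulmxA mxtrace_mulC mulmxA mulmxV // mul1mx.
  by rewrite mxtrace_diag => E; rewrite -[RHS]E; apply: eq_bigr => j _; rewrite mxE.
have trq (q : {poly L}) : q`_0 = 0 -> \sum_j q.[y 0 j] = 0.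
  move=> q0; under eq_bigr do rewrite horner_coef.
  rewrite exchange_big big1 //= => i _; rewrite -mulr_sumr.
  by case: i => -[|i] lt /=; rewrite ?q0 ?mul0r // tr mulr0.
suff y0 : y = 0.
  apply: map_iota_inj; rewrite map_mx0 -/x.
  by apply: (can_inj (mulKmx Vu)); rewrite Vx y0 raddf0 mul0mx mulmx0.
apply/rowP => j0; rewrite mxE; apply/eqP/negPn/negP => yj0.
pose s := [seq z <- codom (y 0) | z != y 0 j0].
pose q := 'X * \prod_(z <- s) ('X - z%:P).
have qj0 : q.[y 0 j0] != 0.
  rewrite hornerM hornerX mulf_neq0 //; have := root_prod_XsubC s (y 0 j0).
  by rewrite mem_filter eqxx /= => /negbT.
have := trq q; rewrite -horner_coef0 hornerM hornerX mul0r => /(_ erefl).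
rewrite (bigID (fun j => y 0 j == y 0 j0)) /= [X in _ + X]big1 ?addr0; last first.
  move=> j yj; rewrite hornerM; apply/eqP; rewrite mulf_eq0; apply/orP; right.
  by apply/rootP/eqP; rewrite -/(root _ _) root_prod_XsubC mem_filter yj codom_f.
under eq_bigr => j /eqP -> do [].
rewrite sumr_const => /eqP; rewrite -mulr_natr mulf_eq0 (negPf qj0) /=.
have /pcharf0P -> := charL; move=> /eqP/card0_eq/(_ j0) E.
by have : (y 0 j0 == y 0 j0) = false := E; rewrite eqxx.
Qed.

End SimpleSpectrum.

(** * Reduced discriminants have simple spectrum *)

Section AlmostIntegral.
Variables (A : comNzRingType) (L : fieldType) (iota : {rmorphism A -> L}).

Lemma integral_prod_XsubC (s : seq L) : {in s, integralRange iota} ->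
  forall i, integralOver iota (\prod_(z <- s) ('X - z%:P))`_i.
Proof.
elim: s => [|z s IHs] sI i.
  by rewrite big_nil coef1; case: eqP => _; [apply: integral1 | apply: integral0].
have sI' : {in s, integralRange iota} by move=> y ys; apply: sI; rewrite inE ys orbT.
have zI : integralOver iota z by apply: sI; rewrite inE eqxx.
rewrite big_cons mulrBl coefB coefXM coefCM; apply: integral_sub.
  by case: eqP => _; [apply: integral0 | apply: IHs].
by apply: integral_mul => //; apply: IHs.
Qed.

(** If h = g / b satisfies a monic equation of degree N, then every power of h is
    a combination of 1, ..., h^(N-1), so b^N is a common denominator. *)
Lemma integral_fraction_powers (g b : A) (h : L) : injective iota ->
    integralOver iota h -> iota g = iota b * h ->
  exists N, forall n, exists x, b ^+ N * g ^+ n = x * b ^+ n.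
Proof.
move=> iota_inj [P mP Ph] gbh; pose N := (size P).-1; exists N.
have NP : size P = N.+1 by rewrite prednK // size_poly_gt0 monic_neq0.
suff H n : exists x, iota b ^+ N * h ^+ n = iota x.
  move=> n; have [x xE] := H n; exists x; apply: iota_inj.
  by rewrite !rmorphM !rmorphXn /= gbh exprMn -xE; ring.
have hN : h ^+ N = - \sum_(j < N) iota P`_j * h ^+ j.
  have := Ph; rewrite /root (@horner_coef_wide _ N.+1); last by rewrite -NP size_poly.
  rewrite big_ord_recr /= coef_map /= -{2}[N]/((size P).-1).
  have -> : P`_N = 1 by move: mP; rewrite monicE lead_coefE => /eqP.
  rewrite rmorph1 mul1r addrC addr_eq0 => /eqP ->; congr (- _).
  by apply: eq_bigr => j _; rewrite coef_map.
elim: n {-2}n (leqnn n) => [|n IHn] k le_k.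
  exists (b ^+ N); have -> : k = 0%N by lia.
  by rewrite expr0 mulr1 rmorphXn.
have [kN | Nk] := leqP k N.
  exists (b ^+ (N - k) * g ^+ k); rewrite rmorphM !rmorphXn /= gbh exprMn mulrA -exprD.
  by rewrite subnK.
have ex (j : 'I_N) : exists x, iota b ^+ N * h ^+ (k - N + j) = iota x.
  by apply: IHn; have := ltn_ord j; lia.
have [x xE] := choice ex; exists (- \sum_(j < N) P`_j * x j).
have -> : h ^+ k = h ^+ (k - N) * h ^+ N by rewrite -exprD subnK // ltnW.
rewrite hN rmorphN rmorph_sum !mulrN; congr (- _); rewrite !mulr_sumr.
by apply: eq_bigr => j _; rewrite rmorphM /= -xE exprD; ring.
Qed.

End AlmostIntegral.

Section SquarefreeGerm.
Variables (R : realType) (m : nat) (chi : {poly conv R m}).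
Hypotheses (chi_monic : chi \is monic).
Variables (L : fieldType) (iota : {rmorphism conv R m -> L}) (rs : seq L).
Hypotheses (iota_inj : injective iota)
           (chi_split : map_poly iota chi = \prod_(z <- rs) ('X - z%:P)).

(** C{s} is integrally closed: the coefficients of the monic polynomial g / b,
    a product of linear factors of the monic chi, are integral. *)
Lemma monic_of_dvd_square (g q : {poly conv R m}) (c : conv R m) :
    c != 0 -> c *: chi = q * g ^+ 2 ->
  exists h q', [/\ h \is monic, size h = size g & chi = q' * h ^+ 2].
Proof.
move=> c0 E.
have chi0 := monic_neq0 chi_monic.
have g0 : g != 0.
  apply: contraNneq chi0 => g0; move/eqP: E.
  by rewrite g0 expr0n mulr0 -mul_polyC mulf_eq0 polyC_eq0 (negPf c0).
pose b := lead_coef g; have b0 : b != 0 by rewrite lead_coef_eq0.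
have ib0 : iota b != 0 by rewrite -(rmorph0 iota) (inj_eq iota_inj).
have ic0 : iota c != 0 by rewrite -(rmorph0 iota) (inj_eq iota_inj).
have gL : map_poly iota g %| \prod_(z <- rs) ('X - z%:P).
  rewrite -chi_split -(dvdpZr _ _ ic0) -map_polyZ E expr2 mulrA rmorphM.
  exact: dvdp_mull (dvdpp _).
have [mask_ gE] := dvdp_prod_XsubC gL.
set h := \prod_(z <- mask mask_ rs) ('X - z%:P) in gE.
have {}gE : map_poly iota g = iota b *: h.
  move/eqpP: gE => [[c1 c2] /andP[/= c10 c20] /= Ec].
  have l := congr1 (fun p : {poly L} => lead_coef p) Ec.
  move: l; rewrite /= !lead_coefZ lead_coef_map_inj ?rmorph0 // -/b.
  rewrite (monicP (monic_prod_XsubC _ _ _)) mulr1 => c2E.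
  by apply: (scalerI c10); rewrite Ec scalerA c2E.
have hI i : integralOver iota h`_i.
  apply: integral_prod_XsubC => z /mem_mask zrs.
  apply: (@integral_root_monic _ _ _ _ (map_poly iota chi)).
  - exact: monic_map.
  - by rewrite chi_split root_prod_XsubC.
  by apply/integral_poly => j; rewrite coef_map; apply: integral_id.
have dvd i : exists x, g`_i = x * b.
  have [|N Nx] := integral_fraction_powers (g := g`_i) (b := b) iota_inj (hI i).
    by rewrite -coef_map gE coefZ.
  by apply: (conv_dvd_of_dvd_powers (d := b ^+ N)) => //; rewrite expf_neq0.
have [x xE] := choice dvd.
pose h' := \poly_(i < size g) x i.
have gh' : g = b *: h'.
  apply/polyP => i; rewrite coefZ coef_poly; case: ltnP => gi; first by rewrite xE mulrC.
  by rewrite mulr0 nth_default.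
have sh' : size h' = size g by rewrite gh' size_scale.
have mh' : h' \is monic.
  by rewrite monicE; apply/eqP/(mulfI b0); rewrite mulr1 -lead_coefZ -gh'.
have : h' ^+ 2 %| chi.
  apply/Pdiv.Idomain.dvdpP; exists (c, q * (b ^+ 2)%:P) => //=.
  by rewrite E {1}gh' exprZn -mul_polyC mulrA.
have mh2 : h' ^+ 2 \is monic by rewrite monic_exp.
case/(Pdiv.IdomainMonic.dvdpP mh2) => q' chiE.
by exists h', q'.
Qed.

Hypothesis chi_coef0 : map_poly (@conv_coef0 R m) chi = 'X ^+ (size chi).-1.
Hypothesis chi_sqf : squarefree (germ_of_poly chi).

Lemma natr_conv_neq0 i : (i.+1%:R : conv R m) != 0.
Proof.
apply/eqP => /(congr1 (@conv_coef0 R m)); rewrite rmorph0 rmorph_nat => /eqP.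
by rewrite pnatr_eq0.
Qed.

(** A multiple root of chi produces a square factor in C{s}[t]; it is not a
    unit of C{t, s} as chi specialises to a power of t at s = 0. *)
Lemma squarefree_uniq_roots : uniq rs.
Proof.
suff : separable_poly chi.
  rewrite unlock => /Pdiv.Idomain.Bezout_coprimepP[[u v] /= uv].
  move/Pdiv.Idomain.eqpP: uv => [[c1 c2] /= /andP[c10 c20] E].
  rewrite -separable_prod_XsubC unlock -chi_split deriv_map.
  apply/Bezout_coprimepP; exists (map_poly iota u, map_poly iota v) => /=.
  have := congr1 (map_poly iota) E; rewrite !map_polyZ rmorph1 rmorphD !rmorphM /= => E'.
  apply/eqpP; exists (iota c1, iota c2) => //=.
  by rewrite -(rmorph0 iota) !(inj_eq iota_inj) c10.
have chi0 := monic_neq0 chi_monic.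
apply/separable_polyP; split=> [u v uv | u _ u1]; last first.
  apply/eqP => /polyP/(_ (size u).-2); rewrite coef_deriv coef0 => /eqP.
  have -> : ((size u).-2.+1 = (size u).-1)%N by lia.
  rewrite -mulr_natr mulf_eq0 -lead_coefE lead_coef_eq0.
  have -> : ((size u).-1 = (size u).-2.+1)%N by lia.
  by rewrite (negPf (natr_conv_neq0 _)) orbF -size_poly_eq0; lia.
apply/negPn/negP => ncop; set g := gcdp u v.
have g0 : g != 0.
  apply: contraNneq chi0 => /eqP; rewrite gcdp_eq0 => /andP[/eqP u0 _].
  by move: uv; rewrite u0 mul0r dvd0p.
have g1 : (1 < size g)%N.
  by move: ncop g0; rewrite Pdiv.Idomain.coprimep_def -/g -size_poly_gt0; lia.
have : g ^+ 2 %| chi.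
  apply: Pdiv.Idomain.dvdp_trans uv; rewrite expr2.
  by apply: Pdiv.Idomain.dvdp_mul; [apply: Pdiv.Idomain.dvdp_gcdl | apply: Pdiv.Idomain.dvdp_gcdr].
case/Pdiv.Idomain.dvdpP => -[c q] /= c0 E.
have [h [q' [mh sh chiE]]] := monic_of_dvd_square c0 E.
have [|w hw] := chi_sqf (h := germ_of_poly h).
  by exists (germ_of_poly q'); rewrite chiE rmorphM rmorphXn.
have hc0 : conv_coef0 h`_0 != 0.
  have := congr1 (@conv_coef0 R m.+1) hw.
  rewrite rmorphM rmorph1 /= germ_of_poly_coef0 => E1.
  by apply/eqP => E2; move/eqP: E1; rewrite E2 mul0r eq_sym oner_eq0.
have /closed_rootP[z zh] : size (map_poly (@conv_coef0 R m) h) != 1%N.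
  rewrite size_map_poly_id0 ?sh; first by rewrite gtn_eqF.
  by rewrite (monicP mh) rmorph1 oner_neq0.
have : root ('X ^+ (size chi).-1 : {poly R[i]}) z.
  by rewrite -chi_coef0 chiE rmorphM rmorphXn /= expr2 !rootM zh !orbT.
rewrite /root hornerXn expf_eq0 => /andP[_ /eqP z0].
by move: zh; rewrite z0 /root horner_coef0 coef_map (negPf hc0).
Qed.

End SquarefreeGerm.

(** * From convergent to formal deformations *)

(** The matrix expressing r generators in a basis of r elements is right
    invertible, hence invertible. *)
Lemma quot_basis_of_generators (K B : comNzRingType) (iota : {rmorphism K -> B})
    (k : nat) (d : 'I_k -> B) (r : nat) (e e' : 'I_r -> B) :
    quot_basis iota (in_ideal d) e ->
    (forall a, exists c : 'rV[K]_r, in_ideal d (a - \sum_i iota (c 0 i) * e' i)) ->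
  quot_basis iota (in_ideal d) e'.
Proof.
move=> basis gen; pose W : 'M[K]_r := \matrix_(i, j) coords basis (e' j) i 0.
have coordsW (c : 'rV[K]_r) : coords basis (\sum_i iota (c 0 i) * e' i) = W *m c^T.
  rewrite coords_bigsum; apply/colP => i; rewrite summxE mxE; apply: eq_bigr => j _.
  by rewrite coordsZ !mxE mulrC.
have coordsE a (c : 'rV[K]_r) : in_ideal d (a - \sum_i iota (c 0 i) * e' i) ->
    coords basis a = W *m c^T.
  by move=> /(coords_ideal basis) ->; apply: coordsW.
have [c cP] := choice (fun j => gen (e j)).
have WU : W *m (\matrix_(i, j) c j 0 i) = 1%:M.
  apply/matrixP => i j; have := coordsE _ _ (cP j).
  have -> : coords basis (e j) = delta_mx j 0.
    rewrite -(coords_sum basis (delta_mx j 0)); congr coords.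
    rewrite (bigD1 j) //= mxE !eqxx rmorph1 mul1r big1 ?addr0 // => i' /negPf ij.
    by rewrite mxE ij rmorph0 mul0r.
  move/colP/(_ i); rewrite !mxE eqxx andbT => ->.
  by apply: eq_bigr => l _; rewrite !mxE.
have UW := mulmx1C WU.
move=> a; have [v vP] := gen a; exists v; split=> // v' v'P.
apply: trmx_inj; rewrite -[v^T]mul1mx -[v'^T]mul1mx -UW -!mulmxA.
by rewrite -(coordsE _ _ vP) -(coordsE _ _ v'P).
Qed.

Arguments mps_coef0 : simpl never.
Arguments regroup : simpl never.

Section Transfer.
Variables (R : realType) (n m r : nat).
Local Notation C := R[i].
Local Notation O := (conv R n.+1).
Local Notation S := (mps m O).
Variables (f : O) (g : 'I_m -> O).
Local Notation F := (unfolding f g).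
Local Notation df := (fun j : 'I_n.+1 => conv_der j f).
Local Notation dF := (fun j : 'I_n.+1 => ddx j F).

Lemma regroup_unfolding : regroup (unfolding_germ f g) = F.
Proof.
rewrite rmorphD rmorph_sum /= regroup_incl_x; congr (_ + _); apply: eq_bigr => j _.
by rewrite rmorphM /= regroup_incl_x regroupX.
Qed.

Lemma regroup_critical (a : conv R (n.+1 + m)) :
  critical_ideal f g a -> in_ideal dF (regroup a).
Proof.
move=> [b ->]; exists (fun i => regroup (b i)); rewrite rmorph_sum.
by apply: eq_bigr => i _; rewrite rmorphM /= regroup_der regroup_unfolding.
Qed.

Lemma critical_coef0 (a : S) : in_ideal dF a -> in_ideal df (mps_coef0 a).
Proof.
move=> [b ->]; exists (fun i => mps_coef0 (b i)); rewrite rmorph_sum.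
apply: eq_bigr => i _; rewrite rmorphM /=; congr (_ * _).
by rewrite -[LHS]/(conv_der i (F 0%MM)) unfolding_coef0.
Qed.

Section Bases.
Variable e : 'I_r -> conv R (n.+1 + m).
Hypothesis gen : forall a, exists c : 'rV[conv R m]_r,
  critical_ideal f g (a - \sum_(i < r) @incl_s R n m (c 0 i) * e i).
Hypothesis milnor : milnor_number f r.

(** At s = 0 generators of the family span the Milnor algebra, of dimension r. *)
Lemma special_basis :
  quot_basis (@convC R n.+1) (in_ideal df) (fun i => mps_coef0 (regroup (e i))).
Proof.
have [e0 basis] := milnor.
apply: quot_basis_of_generators basis _ => a.
have [c cP] := gen (@incl_x R n m a); exists (\row_i conv_coef0 (c 0 i)).
have := critical_coef0 (regroup_critical cP).
rewrite !rmorphB /= /incl_x /incl_s regroup_incl_x !rmorph_sum /=.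
have -> : mps_coef0 (mpsC m a) = a by rewrite /mps_coef0 /= eqxx.
congr (in_ideal _ (_ - _)); apply: eq_bigr => i _.
rewrite !rmorphM /= regroup_incl_s mxE; congr (_ * _).
Qed.

End Bases.

End Transfer.

(** * Coordinates on the Gauss-Manin system *)

Section Coordinates.
Variables (R : realType) (n m r : nat).
Local Notation C := R[i].
Local Notation O := (conv R n.+1).
Local Notation S := (mps m O).
Local Notation A := (mps m C).
Local Notation K := (laurent A).
Variables (f : O) (g : 'I_m -> O) (e : 'I_r -> S).
Local Notation F := (unfolding f g).
Local Notation df := (fun j : 'I_n.+1 => conv_der j f).
Local Notation dF := (fun j : 'I_n.+1 => ddx j F).
Local Notation G := (gauss_manin_space f g).
Local Notation cls := (@gauss_manin_class R n m f g).
Hypothesis basis0 : quot_basis (@convC R n.+1) (in_ideal df) (fun i => mps_coef0 (e i)).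

Lemma twisted_d_coef0 j (a : pser S) : twisted_d f g j a 0%N = - (ddx j F * a 0%N).
Proof. by rewrite pserBE pserU0 sub0r pserCME. Qed.

Lemma lattice_sum_coef0 c eta : lattice_sum f g e c eta 0%N =
  \sum_i @scal R n m (c i 0%N) * e i - \sum_j eta j 0%N * ddx j F.
Proof.
rewrite pserDE !pser_sumE -sumrN; congr (_ + _); apply: eq_bigr => i _.
  by rewrite pserCME mulrC.
by rewrite [LHS]twisted_d_coef0 mulrC.
Qed.

Lemma lattice_sumU c eta : pserU * lattice_sum f g e c eta =
  lattice_sum f g e (fun i => pserU * c i) (fun j => pserU * eta j).
Proof.
rewrite mulrDr !mulr_sumr; congr (_ + _); apply: eq_bigr => i _.
  have -> : brieskorn_scal n (pserU * c i) = pserU * brieskorn_scal n (c i).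
    rewrite rmorphM; congr (_ * _).
    by apply: pserP => k; apply: (rmorph_nat (@scal R n m)).
  by rewrite mulrCA.
rewrite pser_ddxM (_ : pser_map (@ddx R n m i) pserU = 0); first by ring.
by apply: pserP => k; rewrite pser0E /pser_map /pserU /= -(rmorph_nat (@scal R n m)) ddx_scal.
Qed.

(** Setting u = 0 in the Brieskorn lattice gives the Jacobian ring of F, which
    is thus free over C[[s]]. *)
Lemma family_basis : quot_basis (@scal R n m) (in_ideal dF) e.
Proof.
move=> a; have [c [eta E]] := lattice_generated g basis0 (pserC a).
have rowE : \sum_i scal n ((\row_i c i 0%N : 'rV_r) 0 i) * e i = \sum_i scal n (c i 0%N) * e i.
  by apply: eq_bigr => i _; rewrite mxE.
exists (\row_i c i 0%N); split.
  exists (fun j => - eta j 0%N); rewrite rowE.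
  have := congr1 (fun x : pser S => x 0%N) E; rewrite lattice_sum_coef0 /= => ->.
  by rewrite addrAC subrr add0r -sumrN; apply: eq_bigr => j _; rewrite mulNr.
move=> v [b bE]; have aE : a = \sum_i scal n ((\row_i c i 0%N) 0 i) * e i
    - \sum_j eta j 0%N * ddx j F.
  have := congr1 (fun x : pser S => x 0%N) E; rewrite lattice_sum_coef0 /= => ->.
  by rewrite rowE.
pose w i : A := (\row_i c i 0%N) 0 i - v 0 i.
pose z j : S := eta j 0%N + b j.
have wz : \sum_i scal n (w i) * e i = \sum_j z j * ddx j F.
  have -> : \sum_i scal n (w i) * e i = \sum_i scal n ((\row_i c i 0%N) 0 i) * e i -
      \sum_i scal n (v 0 i) * e i.
    by rewrite -sumrB; apply: eq_bigr => i _; rewrite rmorphB mulrBl.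
  have -> : \sum_j z j * ddx j F = \sum_j eta j 0%N * ddx j F + \sum_j b j * ddx j F.
    by rewrite -big_split; apply: eq_bigr => j _; rewrite mulrDl.
  by rewrite -bE aE; ring.
have [c' [eta' E']] := lattice_generated g basis0 (\sum_j pserC (ddx j (z j))).
have zero : lattice_sum f g e (fun i => pserC (w i) - pserU * c' i)
    (fun j => pserC (z j) - pserU * eta' j) = 0.
  rewrite -lattice_sumB -lattice_sumU -E'; apply/eqP; rewrite subr_eq0; apply/eqP.
  rewrite /lattice_sum /brieskorn_d sumrB addrA addrAC.
  have -> : \sum_i pserC (e i) * brieskorn_scal n (pserC (w i)) = pserC (\sum_i scal n (w i) * e i).
    apply: pserP => -[|k]; rewrite pser_sumE [RHS]/=.
      by apply: eq_bigr => i _; rewrite pserCME mulrC.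
    by rewrite big1 // => i _; rewrite pserCME /= raddf0 mulr0.
  have -> : \sum_i pserC (ddx i F) * pserC (z i) = pserC (\sum_j z j * ddx j F).
    apply: pserP => -[|k]; rewrite pser_sumE [RHS]/=.
      by apply: eq_bigr => i _; rewrite pserCME mulrC.
    by rewrite big1 // => i _; rewrite pserCME /= mulr0.
  rewrite wz subrr add0r mulr_sumr; apply: eq_bigr => j _; congr (_ * _).
  by apply: pserP => -[|k] //=; rewrite raddf0.
apply/rowP => i; have := lattice_free basis0 zero i.
move/(congr1 (fun x : pser A => x 0%N)); rewrite pserBE pserU0 subr0 pser0E => /eqP.
by rewrite /= subr_eq0 => /eqP.
Qed.

Definition gm_basis i : G := cls (laurentC (e i)).

(** Coboundaries die in the Gauss-Manin system. *)
Lemma class_lattice_sum c eta :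
  cls (laurent_of (lattice_sum f g e c eta)) = \sum_i laurent_of (c i) *: gm_basis i.
Proof.
have cls0 : cls 0 = 0 by apply: (addIr (cls 0)); rewrite -gauss_manin_classD !addr0 add0r.
rewrite /lattice_sum raddfD /= gauss_manin_classD -gauss_manin_d_of.
rewrite [X in _ + X](_ : _ = 0) ?addr0; last first.
  by rewrite -cls0; apply/gauss_manin_classP; rewrite subr0; apply/gauss_manin_relP; eexists.
rewrite raddf_sum (big_morph cls (@gauss_manin_classD R n m f g) cls0).
apply: eq_bigr => i _; rewrite gauss_manin_classZ gauss_manin_scal_of -laurent_ofC.
by rewrite -rmorphM mulrC.
Qed.

Lemma gm_coords_exist (x : G) : exists h : 'cV[K]_r, x = \sum_i h i 0 *: gm_basis i.
Proof.
have [k [b ->]] := gauss_manin_rep x; have [c [eta ->]] := lattice_generated g basis0 b.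
exists (\col_i (upow _ (- k%:Z) * laurent_of (c i))).
rewrite gauss_manin_ofE class_lattice_sum scaler_sumr; apply: eq_bigr => i _.
by rewrite mxE scalerA.
Qed.

(** Clearing the poles of h leads back to the Brieskorn lattice. *)
Lemma gm_coords_free (h : 'cV[K]_r) : \sum_i h i 0 *: gm_basis i = 0 -> h = 0.
Proof.
move=> h0.
have /choice[kb kbE] i : exists kb : nat * pser A,
    h i 0 = upow _ (- kb.1%:Z) * laurent_of kb.2.
  by have [k [b ->]] := laurent_of_shift (h i 0); exists (k, b).
pose N := (\max_i (kb i).1)%N; pose c i := pserU ^+ (N - (kb i).1) * (kb i).2.
have hE i : upow _ N%:Z * h i 0 = laurent_of (c i).
  have le_kN : ((kb i).1 <= N)%N by exact: leq_bigmax.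
  rewrite rmorphM /= -upow_nat kbE mulrA -upowD.
  by rewrite (_ : N%:Z + - (kb i).1%:Z = (N - (kb i).1)%N%:Z) //; lia.
have E0 : cls (laurent_of (lattice_sum f g e c (fun=> 0))) = cls 0.
  rewrite class_lattice_sum; under eq_bigr do rewrite -hE -scalerA.
  rewrite -scaler_sumr h0 scaler0.
  by apply: (addIr (cls 0)); rewrite -gauss_manin_classD !addr0 add0r.
have [] := @gauss_manin_rel_clear R n m f g 0 0 (lattice_sum f g e c (fun=> 0)) 0.
  rewrite oppr0 upow0 !mul1r raddf0; exact/gauss_manin_classP.
move=> k; rewrite mulr0 subr0 addn0 => /brieskorn_relP[eta kE].
have {}kE : lattice_sum f g e (fun i => pserU ^+ k * c i) (fun j => - eta j) = 0.
  have iterU c1 eta1 : pserU ^+ k * lattice_sum f g e c1 eta1 =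
      lattice_sum f g e (fun i => pserU ^+ k * c1 i) (fun j => pserU ^+ k * eta1 j).
    elim: k {kE} => [|k IHk].
      by rewrite expr0 mul1r; congr lattice_sum; apply: funext => i; rewrite mul1r.
    rewrite exprS -mulrA IHk lattice_sumU; congr lattice_sum; apply: funext => i;
    by rewrite mulrA -exprS.
  have -> : lattice_sum f g e (fun i => pserU ^+ k * c i) (fun j => - eta j) =
      lattice_sum f g e (fun i => pserU ^+ k * c i) (fun j => pserU ^+ k * 0) -
      lattice_sum f g e (fun=> 0) eta.
    by rewrite lattice_sumB; congr lattice_sum; apply: funext => i;
      rewrite ?subr0 ?mulr0 ?sub0r.
  rewrite -(iterU c (fun=> 0)) kE /lattice_sum big1 ?add0r ?subrr // => i _.
  by rewrite raddf0 mulr0.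
have c0 i := vanishes_inj_U (lattice_free basis0 kE i).
apply/colP => i; rewrite mxE; have := hE i; rewrite c0 raddf0 => E.
by rewrite -[h i 0]mul1r -(upowK _ N%:Z) -mulrA E mulr0.
Qed.

Definition gm_coords (x : G) : 'cV[K]_r := projT1 (cid (gm_coords_exist x)).

Lemma gm_coordsE x : x = \sum_i gm_coords x i 0 *: gm_basis i.
Proof. exact: projT2 (cid (gm_coords_exist x)). Qed.

Lemma gm_coords_uniq x (h : 'cV[K]_r) : x = \sum_i h i 0 *: gm_basis i -> gm_coords x = h.
Proof.
move=> xE; apply/eqP; rewrite -subr_eq0; apply/eqP/gm_coords_free.
have -> : \sum_i (gm_coords x - h) i 0 *: gm_basis i =
    \sum_i gm_coords x i 0 *: gm_basis i - \sum_i h i 0 *: gm_basis i.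
  by rewrite -sumrB; apply: eq_bigr => i _; rewrite !mxE scalerBl.
by rewrite -gm_coordsE -xE subrr.
Qed.

Lemma gm_coordsD x y : gm_coords (x + y) = gm_coords x + gm_coords y.
Proof.
apply: gm_coords_uniq; rewrite {1}[x]gm_coordsE {1}[y]gm_coordsE -big_split.
by apply: eq_bigr => i _; rewrite mxE scalerDl.
Qed.

Lemma gm_coordsZ h x : gm_coords (h *: x) = h *: gm_coords x.
Proof.
apply: gm_coords_uniq; rewrite {1}[x]gm_coordsE scaler_sumr.
by apply: eq_bigr => i _; rewrite mxE scalerA.
Qed.

(** Modulo u the coordinates are those in the Jacobian ring. *)
Lemma gm_coords_class (w : S) : exists2 c : 'I_r -> pser A,
    gm_coords (cls (laurentC w)) = \col_i laurent_of (c i)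
  & forall i, c i 0%N = coords family_basis w i 0.
Proof.
have [c [eta E]] := lattice_generated g basis0 (pserC w); exists c.
  apply: gm_coords_uniq; rewrite -laurent_ofC E class_lattice_sum.
  by apply: eq_bigr => i _; rewrite mxE.
suff -> : coords family_basis w = \col_i c i 0%N by move=> i; rewrite mxE.
apply: coords_uniq; exists (fun j => - eta j 0%N).
have := congr1 (fun x : pser S => x 0%N) E; rewrite lattice_sum_coef0 /= => ->.
have -> : \sum_i scal n ((\col_i c i 0%N : 'cV_r) i 0) * e i = \sum_i scal n (c i 0%N) * e i.
  by apply: eq_bigr => i _; rewrite mxE.
by rewrite addrAC subrr add0r -sumrN; apply: eq_bigr => j _; rewrite mulNr.
Qed.

Lemma mulm_coef0 (a : S) :
  map_mx (@mps_coef0 m C) (mulm family_basis a) = mulm basis0 (mps_coef0 a).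
Proof.
apply/esym/mulm_matrix => j; have := critical_coef0 (coordsP family_basis (a * e j)).
rewrite rmorphB rmorph_sum /= rmorphM /=.
congr (in_ideal _ (_ - _)); apply: eq_bigr => i _.
by rewrite rmorphM /= !mxE.
Qed.

End Coordinates.

(** * Horizontal matrices *)

Section NilpotentMatrix.
Variables (F : closedFieldType) (n : nat) (N : 'M[F]_n.+1) (k : nat).
Hypothesis Nk : N ^+ k = 0.

(** All eigenvalues are zero. *)
Lemma nilpotent_char_poly : char_poly N = 'X ^+ n.+1.
Proof.
have [rs E] := closed_field_poly_normal (char_poly N).
rewrite (monicP (char_poly_monic N)) scale1r in E.
have sz : size rs = n.+1.
  by have := size_char_poly N; rewrite E size_prod_XsubC => -[].
suff rs0 z : z \in rs -> z = 0.
  rewrite E -sz (@eq_big_seq _ _ _ _ _ _ (fun=> 'X)) => [|z /rs0 ->]; last by rewrite subr0.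
  by rewrite big_const_seq count_predT iter_mulr_1.
move=> zrs.
have : root (char_poly N) z by rewrite E root_prod_XsubC.
rewrite -eigenvalue_root_char => /eigenvalueP[v vN v0].
have vX i : v *m N ^+ i = z ^+ i *: v.
  elim: i => [|i IHi]; first by rewrite !expr0 mulmx1 scale1r.
  by rewrite !exprSr mulmxA IHi -scalemxAl vN scalerA.
have /eqP := vX k; rewrite Nk mulmx0 eq_sym scaler_eq0 (negPf v0) orbF.
by rewrite expf_eq0 => /andP[_ /eqP].
Qed.

Lemma nilpotent_trace : \tr N = 0.
Proof.
apply/eqP; rewrite -oppr_eq0 -char_poly_trace // nilpotent_char_poly coefXn.
by rewrite /= eqn_leq ltnn andbF.
Qed.

End NilpotentMatrix.

Section LaurentMatrices.
Variables (A : idomainType) (n : nat).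
Local Notation M := 'M[laurent A]_n.+1.
Implicit Types (P T B : M) (v k : int).

(** The coefficient of u^v. *)
Definition ucoef v P : 'M[A]_n.+1 := map_mx (fun a : laurent A => a v) P.

Definition below v P := forall k, k < v -> ucoef k P = 0.

Lemma below_entry v P : below v P -> forall i j, zbelow (P i j) v.
Proof. by move=> Pv i j k kv; have /matrixP/(_ i j) := Pv k kv; rewrite !mxE. Qed.

Lemma belowW v v' P : v' <= v -> below v P -> below v' P.
Proof. by move=> le Pv k lt; apply: Pv (lt_le_trans lt le). Qed.

Lemma exists_below P : exists N, below N P.
Proof.
have [N NP] := choice (fun ij : 'I_n.+1 * 'I_n.+1 => lcf_bounded (P ij.1 ij.2)).
exists (- (\sum_ij `|N ij|%N)%N%:Z) => k lt; apply/matrixP => i j; rewrite !mxE.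
apply: (NP (i, j)); apply: lt_le_trans lt _; rewrite (bigD1 (i, j)) //=.
by move: (\sum_(_ | _) _)%N => x; lia.
Qed.

Lemma ucoefM0 v w P T : below v P -> below w T ->
  ucoef (v + w) (P * T) = ucoef v P * ucoef w T.
Proof.
move=> /below_entry Pv /below_entry Tw; apply/matrixP => i j.
rewrite !mxE laurent_sumE; apply: eq_bigr => l _; rewrite !mxE.
have := laurent_mul_zbelow 0 (Pv i l) (Tw l j).
by rewrite big_ord_recl big_ord0 !addr0.
Qed.

Lemma ucoefM1 v w P T : below v P -> below w T ->
  ucoef (v + w + 1) (P * T) =
    ucoef v P * ucoef (w + 1) T + ucoef (v + 1) P * ucoef w T.
Proof.
move=> /below_entry Pv /below_entry Tw; apply/matrixP => i j.
rewrite !mxE laurent_sumE -big_split; apply: eq_bigr => l _; rewrite !mxE.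
have := laurent_mul_zbelow 1 (Pv i l) (Tw l j).
by rewrite !big_ord_recl big_ord0 !addr0.
Qed.

Lemma ucoef_is_zmod_morphism v : zmod_morphism (ucoef v).
Proof. by move=> P T; apply/matrixP => i j; rewrite !mxE. Qed.
HB.instance Definition _ v := GRing.isZmodMorphism.Build M 'M[A]_n.+1
  (ucoef v) (ucoef_is_zmod_morphism v).

Lemma ucoef_u2du v P : ucoef (v + 1) (map_mx (@u2du A) P) = ucoef v P *~ v.
Proof.
apply/matrixP => i j; rewrite [LHS]mxE mxE /= addrK.
by case: v => k; rewrite ?NegzE ?mulrNz -?pmulrn ?mxE mulmxnE mxE.
Qed.

Lemma trace_commutator (Y Z : 'M[A]_n.+1) : \tr (Y * Z - Z * Y) = 0.
Proof. by rewrite raddfB /= mxtrace_mulC subrr. Qed.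

Section TFlat.
Variables (T : M) (T0 : 'M[A]_n.+1).
Hypotheses (T_below : below 0 T) (T_coef0 : ucoef 0 T = T0).
Hypothesis T0_trace0 : forall X : 'M[A]_n.+1, X * T0 = T0 * X ->
  (forall i, \tr (X ^+ i.+1) = 0) -> X = 0.
Hypothesis charA : forall i, (i.+1%:R : A) != 0.
Variable P : M.
Hypothesis PT : P * T = map_mx (@u2du A) P + T * P.

Lemma lowest_comm v : below v P -> ucoef v P * T0 = T0 * ucoef v P.
Proof.
move=> Pv.
have E1 : ucoef v (P * T) = ucoef v P * T0.
  by have := ucoefM0 Pv T_below; rewrite addr0 T_coef0.
have E2 : ucoef v (T * P) = T0 * ucoef v P.
  by have := ucoefM0 T_below Pv; rewrite add0r T_coef0.
have := congr1 (ucoef v) PT; rewrite raddfD /= E1 E2 => ->.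
by rewrite -[v in ucoef v (map_mx _ _)](subrK 1) ucoef_u2du Pv ?mul0rz ?add0r // gtrBl.
Qed.

Lemma trace_mulrz_eq0 (Y : 'M[A]_n.+1) v : v != 0 -> \tr (Y *~ v) = 0 -> \tr Y = 0.
Proof.
case: v => [[//|k]|k] _; rewrite ?NegzE ?mulrNz -?pmulrn ?raddfN raddfMn /= => /eqP;
by rewrite ?oppr_eq0 -mulr_natr mulf_eq0 (negPf (charA k)) orbF => /eqP.
Qed.

(** The coefficient of u^(v+1) in the commutation with t says that v P_v is a
    sum of commutators with T_0 and with matrices commuting with P_v, so all
    powers of P_v are traceless unless v = 0. *)
Lemma lowest_zero v : below v P -> v != 0 -> ucoef v P = 0.
Proof.
move=> Pv v0; have XT := lowest_comm Pv; set X := ucoef v P in XT *.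
set X1 := ucoef (v + 1) P; set T1 := ucoef 1 T.
have E : X *~ v = X * T1 - T1 * X + (X1 * T0 - T0 * X1).
  have E1 : ucoef (v + 1) (P * T) = X * T1 + X1 * T0.
    by have := ucoefM1 Pv T_below; rewrite addr0 add0r T_coef0.
  have E2 : ucoef (v + 1) (T * P) = T0 * X1 + T1 * X.
    by have := ucoefM1 T_below Pv; rewrite !add0r T_coef0.
  have := congr1 (ucoef (v + 1)) PT; rewrite raddfD /= ucoef_u2du E1 E2 => E.
  by rewrite addrACA E -opprD [T1 * X + _]addrC addrK.
apply: T0_trace0 => // i.
have XiT : X ^+ i * T0 = T0 * X ^+ i by exact: esym (commrX i (esym XT)).
have tr0 : \tr (X ^+ i.+1 *~ v) = 0.
  have -> : X ^+ i.+1 *~ v = (X * (X ^+ i * T1) - (X ^+ i * T1) * X) +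
      (X ^+ i * X1 * T0 - T0 * (X ^+ i * X1)).
    by rewrite exprSr -mulrzAr E mulrDr !mulrBr !mulrA -XiT -exprS -exprSr.
  by rewrite raddfD /= !trace_commutator addr0.
exact: trace_mulrz_eq0 tr0.
Qed.

(** An endomorphism preserves the Brieskorn lattice. *)
Lemma horizontal_below0 : below 0 P.
Proof.
have [N NP] := exists_below P.
suff H (k : nat) : N + k%:Z <= 0 -> below (N + k%:Z) P.
  case: (leP 0 N) => N0; first exact: belowW NP.
  have := H `|N|%N; rewrite (_ : N + `|N|%N%:Z = 0); last by lia.
  by apply.
elim: k => [_|k IHk le]; first by rewrite addr0.
have lt : N + k%:Z < 0 by lia.
have bk := IHk (ltW lt).
move=> j jlt; case: (ltP j (N + k%:Z)) => [/bk //|le'].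
have -> : j = N + k%:Z by lia.
by apply: lowest_zero; rewrite // ltr0_neq0.
Qed.

(** An endomorphism that is zero modulo u on the lattice is zero. *)
Lemma horizontal_eq0 : ucoef 0 P = 0 -> P = 0.
Proof.
move=> P0; suff H (k : nat) : below k%:Z P.
  apply/matrixP => i j; apply: laurentP => v; rewrite mxE laurent0E.
  by have /below_entry := H `|v|.+1%N; apply; lia.
elim: k => [|k IHk]; first exact: horizontal_below0.
move=> j jlt; case: (ltP j k%:Z) => [/IHk //|le'].
have -> : j = k%:Z by lia.
by case: k IHk {jlt le'} => // k IHk; apply: lowest_zero.
Qed.

End TFlat.

(** A derivation kills the traces of the powers of a solution X of a Lax
    equation. *)
Lemma lax_trace_powers (d : {additive A -> A}) (X B X1 G : 'M[A]_n.+1) :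
    (forall x y, d (x * y) = d x * y + x * d y) -> X * G = G * X ->
    map_mx d X = X * B - B * X - (X1 * G - G * X1) ->
  forall i, d (\tr (X ^+ i)) = 0.
Proof.
move=> dM XG dX i.
have dMmx Y Z : map_mx d (Y * Z) = map_mx d Y * Z + Y * map_mx d Z :> 'M[A]_n.+1.
  apply/matrixP => a b; rewrite !mxE raddf_sum -big_split.
  by apply: eq_bigr => c _; rewrite dM !mxE.
suff [Y dXi] : exists Y, map_mx d (X ^+ i) = X ^+ i * B - B * X ^+ i - (Y * G - G * Y).
  have -> : d (\tr (X ^+ i)) = \tr (map_mx d (X ^+ i)).
    by rewrite raddf_sum; apply: eq_bigr => j _; rewrite mxE.
  by rewrite dXi raddfB /= !trace_commutator subrr.
elim: i => [|i [Y dXi]].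
  exists 0; rewrite !expr0 mul1r mulr1 subrr mul0r mulr0 subrr subr0.
  have d1 : d 1 = 0 by apply: (addIr (d 1)); rewrite -[in RHS](mul1r 1) dM mul1r mulr1 add0r.
  apply/matrixP => a b; rewrite !mxE; case: (a == b); rewrite ?mulr1n ?mulr0n //.
  exact: raddf0.
exists (X1 * X ^+ i + X * Y); rewrite exprS dMmx dXi dX.
have XiG : X ^+ i * G = G * X ^+ i by exact: esym (commrX i (esym XG)).
rewrite !mulrBl !mulrBr !mulrDl !mulrDr -!mulrA XiG.
have -> : X * (G * Y) = G * (X * Y) by rewrite !mulrA XG.
move: (X * (X ^+ i * B)) (B * (X * X ^+ i)) (X * (B * X ^+ i)) (X1 * (G * X ^+ i))
  (G * (X1 * X ^+ i)) (X * (Y * G)) (G * (X * Y)) => m1 m2 m3 m4 m5 m6 m7.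
by apply/matrixP => a b; rewrite !mxE; ring.
Qed.

End LaurentMatrices.

(** * Endomorphisms of the Gauss-Manin system *)

Lemma natr_mps_neq0 (R : realType) m i : (i.+1%:R : mps m R[i]) != 0.
Proof.
apply/eqP => /(congr1 (@mps_coef0 m _)); rewrite rmorph0 rmorph_nat => /eqP.
by rewrite pnatr_eq0.
Qed.

(** In characteristic 0 a series without derivatives is constant. *)
Lemma mps_der_eq0 (R : realType) m (a : mps m R[i]) :
  (forall j, mps_der j a = 0) -> mps_coef0 a = 0 -> a = 0.
Proof.
move=> da a0; apply: mpsP => k; rewrite mps0E.
have [-> // | k0] := eqVneq k 0%MM.
have [j kj] : exists j, k j != 0%N.
  apply: contrapT => no; case/eqP: k0; apply/mnmP => j; rewrite mnm0E; apply/eqP.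
  by apply/negPn/negP => kj; apply: no; exists j.
have Uk : (U_(j) <= k)%MM by rewrite lep1mP.
have := congr1 (fun b : mps m R[i] => b (k - U_(j))%MM) (da j).
rewrite mps0E /= submK // -mulr_natr => /eqP.
by rewrite mulf_eq0 pnatr_eq0 orbF => /eqP.
Qed.

Section ConstantEndomorphisms.
Variables (C : comNzRingType) (m : nat).
Implicit Types M N : gm_module C m.

Lemma gm_homD M N (phi : M -> N) : gm_hom phi -> {morph phi : x y / x + y}.
Proof. by case=> L _ _ x y; have := L 1 x y; rewrite !scale1r. Qed.

Lemma gm_homZ M N (phi : M -> N) h x : gm_hom phi -> phi (h *: x) = h *: phi x.
Proof.
move=> hphi; have phi0 : phi 0 = 0.
  by apply: (addIr (phi 0)); rewrite -gm_homD // !addr0 add0r.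
by case: hphi => L _ _; have := L h x 0; rewrite phi0 !addr0.
Qed.

Lemma u2du_const c : u2du (gm_const m c : laurent (mps m C)) = 0.
Proof.
by apply: laurentP => k; rewrite laurent0E /=; case: eqP => [-> | _]; rewrite ?mulr0z ?mul0rz.
Qed.

Lemma lau_ds_const j c : lau_ds j (gm_const m c : laurent (mps m C)) = 0.
Proof. by rewrite /lau_ds laurent_mapC /= mps_derC raddf0. Qed.

Lemma gm_hom_const M c : gm_hom (fun x : M => gm_const m c *: x).
Proof.
split=> [h x y | x | j x]; first by rewrite scalerDr !scalerA mulrC.
  by rewrite gm_tZ u2du_const scale0r add0r.
by rewrite gm_dsZ lau_ds_const scale0r add0r.
Qed.

Lemma gm_tN M (x : M) : gm_t (- x) = - gm_t x.
Proof.
have t0 : gm_t (0 : M) = 0 by apply: (addIr (gm_t 0)); rewrite -gm_tD !add0r.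
by apply: (addIr (gm_t x)); rewrite -gm_tD !addNr t0.
Qed.

Lemma gm_dsN M j (x : M) : gm_ds j (- x) = - gm_ds j x.
Proof.
have ds0 : gm_ds j (0 : M) = 0 by apply: (addIr (gm_ds j 0)); rewrite -gm_dsD !add0r.
by apply: (addIr (gm_ds j x)); rewrite -gm_dsD !addNr ds0.
Qed.

Lemma gm_homB M N (phi psi : M -> N) : gm_hom phi -> gm_hom psi ->
  gm_hom (fun x => phi x - psi x).
Proof.
move=> [phiL phit phids] [psiL psit psids]; split=> [h x y | x | j x].
- by rewrite phiL psiL scalerBr opprD addrACA.
- by rewrite phit psit gm_tD gm_tN.
by rewrite phids psids gm_dsD gm_dsN.
Qed.

End ConstantEndomorphisms.

Section Endomorphisms.
Variables (R : realType) (n m r : nat).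
Local Notation C := R[i].
Local Notation O := (conv R n.+1).
Local Notation S := (mps m O).
Local Notation A := (mps m C).
Local Notation K := (laurent A).
Variables (f : O) (g : 'I_m -> O) (e : 'I_r.+1 -> S).
Local Notation F := (unfolding f g).
Local Notation df := (fun j : 'I_n.+1 => conv_der j f).
Hypothesis basis0 : quot_basis (@convC R n.+1) (in_ideal df) (fun i => mps_coef0 (e i)).
Local Notation GM := (gauss_manin f g).
Local Notation E := (gm_basis f g e).
Local Notation gc := (gm_coords (g := g) basis0).
Local Notation basis := (family_basis g basis0).
Local Notation T0 := (mulm basis F).
Hypothesis T0_comm : forall X Y : 'M[A]_r.+1,
  X * T0 = T0 * X -> Y * T0 = T0 * Y -> X * Y = Y * X.
Hypothesis T0_trace0 : forall X : 'M[A]_r.+1, X * T0 = T0 * X ->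
  (forall i, \tr (X ^+ i.+1) = 0) -> X = 0.

Lemma gm_coords_sum (I : Type) (s : seq I) (x : I -> GM) :
  gc (\sum_(i <- s) x i) = \sum_(i <- s) gc (x i).
Proof.
have g0 : gc 0 = 0 by rewrite -(scale0r (0 : GM)) gm_coordsZ scale0r.
by rewrite (big_morph gc (gm_coordsD basis0) g0).
Qed.

Definition gm_matrix (phi : GM -> GM) : 'M[K]_r.+1 := \matrix_(i, j) gc (phi (E j)) i 0.

Lemma gm_matrix_col phi j : col j (gm_matrix phi) = gc (phi (E j)).
Proof. by apply/colP => i; rewrite !mxE. Qed.

(** This covers linear maps (d = 0) as well as t and the s-derivatives, whose
    matrices are the connection matrices of the basis. *)
Lemma gm_coords_connection (D : GM -> GM) (d : K -> K) :
    {morph D : x y / x + y} -> (forall h x, D (h *: x) = d h *: x + h *: D x) ->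
  forall x, gc (D x) = map_mx d (gc x) + gm_matrix D *m gc x.
Proof.
move=> DD DZ x; have D0 : D 0 = 0 by apply: (addIr (D 0)); rewrite -DD !add0r.
rewrite {1}(gm_coordsE basis0 x) (big_morph D DD D0) gm_coords_sum.
under eq_bigr do rewrite DZ gm_coordsD !gm_coordsZ.
rewrite big_split /=; congr (_ + _); last first.
  apply/colP => i; rewrite summxE mxE; apply: eq_bigr => j _.
  by rewrite [in RHS]mxE [LHS]mxE mulrC.
have dE : map_mx d (gc x) = gc (\sum_i d (gc x i 0) *: E i).
  by apply/esym/gm_coords_uniq; apply: eq_bigr => i _; rewrite mxE.
by rewrite dE gm_coords_sum; apply: eq_bigr => j _; rewrite gm_coordsZ.
Qed.

Lemma gm_coords_hom (phi : GM -> GM) x : gm_hom phi -> gc (phi x) = gm_matrix phi *m gc x.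
Proof.
move=> hphi; rewrite (@gm_coords_connection phi (fun=> 0)).
- by rewrite [map_mx _ _](_ : _ = 0) ?add0r //; apply/colP => i; rewrite !mxE.
- exact: gm_homD.
by move=> h y; rewrite scale0r add0r gm_homZ.
Qed.

Lemma gm_matrix_commute (phi D : GM -> GM) (d : K -> K) : gm_hom phi ->
    {morph D : x y / x + y} -> (forall h x, D (h *: x) = d h *: x + h *: D x) ->
    (forall x, phi (D x) = D (phi x)) ->
  gm_matrix phi * gm_matrix D = map_mx d (gm_matrix phi) + gm_matrix D * gm_matrix phi.
Proof.
move=> hphi DD DZ phiD; apply/matrixP => i j.
have /colP/(_ i) : gc (phi (D (E j))) = gc (D (phi (E j))) by rewrite phiD.
rewrite (gm_coords_connection DD DZ) (gm_coords_hom _ hphi) -!gm_matrix_col.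
rewrite !mxE => E1; rewrite (eq_bigr (fun l => gm_matrix phi i l * col j (gm_matrix D) l 0)).
  rewrite E1; congr (_ + _); apply: eq_bigr => l _.
  by rewrite [col j _ l 0]mxE.
by move=> l _; rewrite [col j _ l 0]mxE.
Qed.

Lemma class_matrix (w : 'I_r.+1 -> S) :
  let W : 'M[K]_r.+1 := \matrix_(i, j) gc (gauss_manin_class f g (laurentC (w j))) i 0 in
  below 0 W /\ ucoef 0 W = \matrix_(i, j) coords basis (w j) i 0.
Proof.
move=> W; have ex j : exists c : 'I_r.+1 -> pser A,
    gc (gauss_manin_class f g (laurentC (w j))) = \col_i laurent_of (c i)
    /\ forall i, c i 0%N = coords basis (w j) i 0.
  by have [c c1 c2] := gm_coords_class g basis0 (w j); exists c.
have [c cP] := choice ex.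
have WE i j : W i j = laurent_of (c j i) by rewrite [LHS]mxE (cP j).1 mxE.
split=> [k k0 | ]; apply/matrixP => i j; rewrite [LHS]mxE WE [RHS]mxE.
  by case: k k0.
exact: (cP j).2.
Qed.

Lemma t_matrix : let T := gm_matrix (@gm_t _ _ GM) in below 0 T /\ ucoef 0 T = T0.
Proof.
have := class_matrix (fun j => F * e j).
have -> : (\matrix_(i, j) gc (gauss_manin_class f g (laurentC (F * e j))) i 0) =
    gm_matrix (@gm_t _ _ GM).
  apply/matrixP => i j; rewrite !mxE /=; congr (gc _ _ _).
  rewrite gauss_manin_tE; congr gauss_manin_class.
  by rewrite /form_t u2duC addr0 -rmorphM.
by move=> [b E0]; split; [exact: b | exact: E0].
Qed.

(** The pole part comes from the term - u^-1 g_l of the s-derivative. *)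
Lemma ds_matrix l : let B := gm_matrix (@gm_ds _ _ GM l) in
  below (-1) B /\ ucoef (-1) B = - mulm basis (mpsC m (g l)).
Proof.
have [B1 _] := class_matrix (fun j => mps_der l (e j)).
have [B2 B2E] := class_matrix (fun j => mpsC m (g l) * e j).
set W1 := \matrix_(i, j) _ in B1; set W2 := \matrix_(i, j) _ in B2 B2E.
have BE i j k : gm_matrix (@gm_ds _ _ GM l) i j k = W1 i j k - W2 i j (k + 1).
  rewrite mxE /= gauss_manin_dsE /form_ds laurent_mapC -mulrA -rmorphM.
  have -> : gauss_manin_class f g (laurentC (mps_der l (e j)) -
      upow S (-1) * laurentC (mpsC m (g l) * e j)) =
      gauss_manin_class f g (laurentC (mps_der l (e j))) +
      (- upow _ (-1)) *: gauss_manin_class f g (laurentC (mpsC m (g l) * e j)).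
    rewrite gauss_manin_classZ raddfN /= gauss_manin_scal_upow -gauss_manin_classD.
    by rewrite mulNr.
  rewrite gm_coordsD gm_coordsZ [W1 i j]mxE [W2 i j]mxE !mxE laurentDE mulNr laurentNE.
  by rewrite upowME opprK.
split=> [k k1 | ]; apply/matrixP => i j; rewrite [LHS]mxE BE [RHS]mxE.
  by rewrite (below_entry B1) ?(below_entry B2) ?subr0 //; lia.
rewrite (below_entry B1) // sub0r addNr; congr (- _).
by have /matrixP/(_ i j) := B2E; rewrite [LHS]mxE.
Qed.

(** The coefficient P_0 of the matrix of phi is the multiplication by some
    element of the Jacobian ring of F, and X = P_0 - c is nilpotent at s = 0
    when c is the value of that element at the origin, as the special fibre of
    the critical locus has no other point.  The traces of the powers of X being
    constant in s, they vanish. *)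
Lemma endomorphism_scalar (phi : GM -> GM) : gm_hom phi ->
  exists c : C, forall x, phi x = gm_const m c *: x.
Proof.
move=> hphi; have [Tb T0E] := t_matrix.
have flat psi : gm_hom psi -> gm_matrix psi * gm_matrix (@gm_t _ _ GM) =
    map_mx (@u2du A) (gm_matrix psi) + gm_matrix (@gm_t _ _ GM) * gm_matrix psi.
  move=> hpsi; apply: gm_matrix_commute => //; [exact: gm_tD | exact: gm_tZ |].
  by case: hpsi.
have horiz psi : gm_hom psi -> below 0 (gm_matrix psi) /\
    ucoef 0 (gm_matrix psi) * T0 = T0 * ucoef 0 (gm_matrix psi).
  move=> hpsi; have := flat _ hpsi => PT.
  have b0 := horizontal_below0 Tb T0E T0_trace0 (natr_mps_neq0 R m) PT.
  exact: conj b0 (lowest_comm Tb T0E PT b0).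
have [_ XT] := horiz _ hphi.
have [eps epsE] : exists a, ucoef 0 (gm_matrix phi) = mulm basis a.
  apply: mulm_commutant => a.
  exact: (T0_comm (X := ucoef 0 (gm_matrix phi)) XT (mulm_comm basis a F)).
pose c := conv_coef0 (mps_coef0 eps); exists c.
pose psi x := phi x - gm_const m c *: x.
have hpsi : gm_hom psi := gm_homB hphi (gm_hom_const _ c).
have [Pb PT0] := horiz _ hpsi; set P := gm_matrix psi in Pb PT0.
have PE : P = gm_matrix phi - (gm_const m c)%:M.
  apply/matrixP => i j; rewrite !mxE /psi gm_coordsD -scaleNr gm_coordsZ mxE.
  have -> : gc (E j) = delta_mx j 0.
    apply: gm_coords_uniq; rewrite (bigD1 j) //= mxE !eqxx scale1r big1 ?addr0 //.
    by move=> l /negPf lj; rewrite mxE lj scale0r.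
  by rewrite !mxE mulNr; case: (i == j); rewrite /= ?mulr1 ?mulr0 ?mulr1n ?mulr0n.
set X := ucoef 0 P in PT0.
pose a := eps - @scal R n m (mpsC m c).
have XE : X = mulm basis a.
  rewrite /X PE raddfB /= epsE /a -[X in mulm _ (_ - X)]mul1r -mulNr.
  have -> : ucoef 0 (gm_const m c)%:M = (mpsC m c)%:M :> 'M[A]_r.+1.
    by apply/matrixP => i j; rewrite !mxE; case: (i == j);
      rewrite ?mulr1n ?mulr0n ?laurent0E //= eqxx.
  have -> : eps + -1 * @scal R n m (mpsC m c) = eps + @scal R n m (- mpsC m c).
    by rewrite mulN1r raddfN.
  by rewrite mulmD mulmC raddfN.
have X_nil : map_mx (@mps_coef0 m C) X ^+ r.+1 = 0.
  rewrite XE mulm_coef0 -mulmX; apply: mulm_ideal.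
  apply: (nilpotent_in_ideal basis0).
  have scal0 : mps_coef0 (@scal R n m (mpsC m c)) = convC n.+1 c.
    by rewrite /mps_coef0 /= eqxx.
  have c0 : conv_coef0 (convC n.+1 c) = c by rewrite /conv_coef0 /mps_coef0 /= eqxx.
  have a0 : mps_coef0 a = mps_coef0 eps - convC n.+1 c by rewrite -scal0; apply: rmorphB.
  rewrite a0; transitivity (conv_coef0 (mps_coef0 eps) - conv_coef0 (convC n.+1 c)).
    exact: (rmorphB (@conv_coef0 R n.+1)).
  by rewrite c0 subrr.
have X_tr i : \tr (X ^+ i.+1) = 0.
  apply: mps_der_eq0 => [l|]; last first.
    rewrite -[LHS]trace_map_mx rmorphXn /=.
    by apply: (@nilpotent_trace _ _ _ r.+1); rewrite -exprM mulnC exprM X_nil expr0n.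
  have [Bb BE] := ds_matrix l; set B := gm_matrix (@gm_ds _ _ GM l) in Bb BE.
  set Gl := mulm basis (mpsC m (g l)) in BE.
  apply: (@lax_trace_powers _ _ (@mps_der m C l) X (ucoef 0 B) (ucoef 1 P) Gl).
  - exact: mps_derM.
  - by rewrite XE; apply: mulm_comm.
  have PB : P * B = map_mx (lau_ds l) P + B * P.
    apply: gm_matrix_commute => //; [exact: gm_dsD | exact: gm_dsZ |].
    by case: hpsi.
  (* The coefficient of u^0 in PB is the Lax equation of X; the pole of B
     contributes the commutator of G_l with the next coefficient of P. *)
  have := congr1 (ucoef 0) PB; rewrite raddfD /=.
  have -> : ucoef 0 (map_mx (lau_ds l) P) = map_mx (@mps_der m C l) X.
    by apply/matrixP => i' j'; rewrite !mxE.
  have := ucoefM1 Pb Bb; rewrite add0r addNr add0r BE => ->.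
  have := ucoefM1 Bb Pb; rewrite addr0 addNr add0r BE => ->.
  move=> /esym/(canRL (addrK _)) ->; rewrite -/X mulrN mulNr.
  move: (X * _) (ucoef 1 P * Gl) (ucoef 0 B * X) (Gl * ucoef 1 P) => m1 m2 m3 m4.
  by apply/matrixP => i' j'; rewrite !mxE; ring.
have X0 : X = 0 by apply: T0_trace0.
have P0 : P = 0.
  exact: (horizontal_eq0 Tb T0E T0_trace0 (natr_mps_neq0 R m) (flat _ hpsi) X0).
move=> x; apply/eqP; rewrite -subr_eq0 -/(psi x) (gm_coordsE basis0 (psi x)).
by rewrite (gm_coords_hom _ hpsi) -/P P0 mul0mx big1 // => i _; rewrite mxE scale0r.
Qed.

End Endomorphisms.

Section ReducedDiscriminant.
Variables (R : realType) (n m r : nat).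
Local Notation C := R[i].
Local Notation O := (conv R n.+1).
Local Notation A := (mps m C).
Variables (f : O) (g : 'I_m -> O).
Local Notation df := (fun j : 'I_n.+1 => conv_der j f).
Variable e : 'I_r.+1 -> conv R (n.+1 + m).
Hypothesis basis0 : quot_basis (@convC R n.+1) (in_ideal df)
  (fun i => mps_coef0 (regroup (e i))).
Local Notation T0 := (mulm (family_basis g basis0) (unfolding f g)).
Variable M : 'M[conv R m]_r.+1.
Hypothesis relM : forall j, critical_ideal f g
  (unfolding_germ f g * e j - \sum_i @incl_s R n m (M i j) * e i).
Hypothesis f0 : f 0%MM = 0.
Hypothesis reduced : squarefree (germ_of_poly (char_poly M)).

Lemma family_matrix : T0 = map_mx val M.
Proof.
apply: mulm_matrix => j; have := regroup_critical (relM j).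
rewrite rmorphB rmorphM rmorph_sum /= regroup_unfolding.
congr (in_ideal _ (_ - _)); apply: eq_bigr => i _.
by rewrite rmorphM /= /incl_s regroup_incl_s mxE.
Qed.

(** As f vanishes at the origin, it is nilpotent in its Milnor algebra. *)
Lemma special_char_poly : map_poly (@conv_coef0 R m) (char_poly M) =
  'X ^+ (size (char_poly M)).-1.
Proof.
rewrite map_char_poly size_char_poly.
have -> : map_mx (@conv_coef0 R m) M = map_mx (@mps_coef0 m C) T0.
  by rewrite family_matrix -map_mx_comp.
rewrite mulm_coef0; apply: (@nilpotent_char_poly _ _ _ r.+1).
rewrite -mulmX; apply: mulm_ideal; apply: (nilpotent_in_ideal basis0).
by rewrite -[mps_coef0 _]/(unfolding f g 0%MM) unfolding_coef0.
Qed.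

(** A splitting field over the fractions of C[[s]] contains C{s} as well, so the
    square-freeness over C{s} applies to its roots. *)
Lemma reduced_simple_spectrum : exists (L : fieldType) (iota : {rmorphism A -> L}) (rs : seq L),
  [/\ injective iota, map_poly iota (char_poly T0) = \prod_(z <- rs) ('X - z%:P) & uniq rs].
Proof.
have mchi : char_poly (map_mx (@tofrac A) T0) \is monic := char_poly_monic _.
have [L [j [rs E]]] := splitting_field mchi.
pose iota : {rmorphism A -> L} := j \o @tofrac A.
have iota_inj : injective iota.
  by move=> x y /fmorph_inj/eqP; rewrite tofrac_eq => /eqP.
exists L, iota, rs; split=> //.
  by rewrite map_poly_comp map_char_poly.
apply: (@squarefree_uniq_roots R m (char_poly M) (char_poly_monic M) L (iota \o val) rs) => //.
- by move=> x y /iota_inj/val_inj.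
- by rewrite -E family_matrix -!map_char_poly !map_poly_comp.
exact: special_char_poly.
Qed.

End ReducedDiscriminant.

Theorem mainTheorem4 (R : realType) (n m r : nat)
    (f : conv R n.+1) (g : 'I_m -> conv R n.+1)
    (f0 : f 0%MM = 0)
    (f_isol : isolated_singularity f)
    (f_milnor : milnor_number f r)
    (D_reduced : discriminant_reduced f g r) :
  (forall phi : gauss_manin f g -> gauss_manin f g,
     gm_hom phi <->
     exists! c : R[i], forall x, phi x = gm_const m c *: x) /\
  (forall S1 S2 : gauss_manin f g -> gm_dual (gauss_manin f g),
     gm_iso S1 -> gm_iso S2 ->
     exists2 c : R[i], c != 0 & forall x, S2 x = gm_const m c *: S1 x).
Proof.
case: D_reduced => P [e [M [basis relM ->]]] reduced {P}.
have gen a : exists c : 'rV[conv R m]_r,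
    critical_ideal f g (a - \sum_(i < r) @incl_s R n m (c 0 i) * e i).
  by have [c [cP _]] := basis a; exists c.
have basis0 := special_basis gen f_milnor.
have := basis_size_gt0 basis0 f_isol.1.
case: r e M {basis f_milnor} relM reduced gen basis0 => // r e M relM reduced _ basis0 _.
have [L [iota [rs [iota_inj split_rs uniq_rs]]]] :=
  reduced_simple_spectrum basis0 relM f0 reduced.
have charL : [pchar L] =i pred0.
  apply/pcharf0P => -[|i]; first by rewrite mulr0n !eqxx.
  rewrite -(rmorph_nat iota) -(rmorph0 iota) (inj_eq iota_inj).
  exact: negPf (natr_mps_neq0 R m i).
have scalar := @endomorphism_scalar R n m r f g (fun i => regroup (e i)) basis0
  (simple_spectrum_comm iota_inj split_rs uniq_rs)
  (fun X => @simple_spectrum_trace0 _ _ _ iota_inj _ _ _ split_rs uniq_rs X charL).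
have E0 : gm_basis f g (fun i => regroup (e i)) ord0 != 0.
  apply/eqP => E0; have := @gm_coords_free _ _ _ _ _ g _ basis0 (delta_mx ord0 0).
  rewrite (bigD1 ord0) //= mxE !eqxx scale1r E0 add0r big1; last first.
    by move=> i /negPf i0; rewrite mxE i0 scale0r.
  by move=> /(_ erefl)/colP/(_ ord0)/eqP; rewrite !mxE !eqxx oner_eq0.
have const0 c : (forall x : gauss_manin f g, gm_const m c *: x = 0) -> c = 0.
  move=> c0; apply/eqP/negPn/negP => cn0; case/eqP: E0.
  rewrite -[LHS]scale1r (_ : 1 = gm_const m c^-1 * gm_const m c) -?scalerA ?c0 ?scaler0 //.
  by rewrite /gm_const -!rmorphM mulVf // !rmorph1.
split=> [phi | S1 S2 [hS1 [S1' S1K S1'K]] [hS2 [S2' S2K S2'K]]].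
  split=> [hphi | [c [cP _]]]; last first.
    by rewrite (_ : phi = fun x => gm_const m c *: x); [exact: gm_hom_const | exact: funext].
  have [c cP] := scalar _ hphi; exists c; split=> // c' c'P.
  apply/eqP; rewrite -subr_eq0; apply/eqP/const0 => x.
  by rewrite /gm_const !rmorphB scalerBl -/(gm_const m c) -/(gm_const m c') -cP -c'P subrr.
have hS1' : gm_hom S1'.
  case: hS1 => [L1 t1 ds1]; split=> [h x y | x | j x]; apply: (can_inj S1K).
  - by rewrite L1 !S1'K.
  - by rewrite t1 !S1'K.
  by rewrite ds1 !S1'K.
have [|c cP] := scalar (fun x => S1' (S2 x)).
  case: hS1' hS2 => [L1 t1 ds1] [L2 t2 ds2]; split=> [h x y | x | j x].
  - by rewrite L2 L1.
  - by rewrite t2 t1.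
  by rewrite ds2 ds1.
exists c; last first.
  by move=> x; rewrite -[S2 x]S1'K cP (gm_homZ _ _ hS1).
apply: contraNneq E0 => c0; apply/eqP/(can_inj S2K)/(can_inj S1'K).
by rewrite !cP c0 /gm_const !rmorph0 !scale0r.
Qed.
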